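(* Let $X^x$ be a continuous $\mathbb{R}^d$-valued Markov process started at $x$, with semigroup $\mathcal{T}_s f(x)=\mathbb{E}_{\mathbb{P}} f(X^x(s))$ and generator $\mathcal{A}$, satisfying property (P) (stated in the context), and let $B$ be an independent one-dimensional Brownian motion started at $0$. Let $f:\mathbb{R}^d\to\mathbb{R}$ be a bounded continuous function in the domain $\mathbb{D}(\mathcal{A})$ of $\mathcal{A}$ such that $D_{ij}f$ is bounded and Hölder continuous with exponent $0<\alpha\le1$ for all $1\le i,j\le d$. Let $\epsilon>0$. If $$u_\epsilon(t,x)=\mathbb{E}_{\mathbb{P}}\left[f\big(\mathbb{X}^{x,k}_{\epsilon B,e}(t)\big)\exp\left(-\frac{|B(t)|}{\epsilon}\right)\right]$$ for any $k\in\mathbb{N}$, or if $\mathbb{X}^{x,k}_{\epsilon B,e}(t)$ is replaced by $\mathbb{X}^{x}_{\epsilon B,e}(t)$ in this definition, then $u_\epsilon$ solves $$\begin{cases}\dfrac{\partial}{\partial t}u_\epsilon(t,x)=\dfrac{1}{\sqrt{2\pi t}}\left[\epsilon\,\mathcal{A}f(x)-\dfrac1\epsilon f(x)\right]+\dfrac{1}{2\epsilon^2}u_\epsilon(t,x)-\mathcal{A}u_\epsilon(t,x)+\dfrac{\epsilon^2}{2}\mathcal{A}^2u_\epsilon(t,x); & t>0,\ x\in\mathbb{R}^d,\\[2mm] u_\epsilon(0,x)=f(x)=\displaystyle\lim_{t\downarrow0,\ y\to x}u_\epsilon(t,y); & x\in\mathbb{R}^d,\end{cases}$$ where $\mathcal{A}$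 acts on $u_\epsilon(t,x)$ as a function of $x$ with $t$ fixed. In particular, if the outer Markov process $X^x$ is a Brownian motion, then $u_\epsilon$ solves $$\begin{cases}\dfrac{\partial}{\partial t}u_\epsilon(t,x)=\dfrac{1}{\sqrt{2\pi t}}\left[\dfrac{\epsilon}{2}\Delta f(x)-\dfrac1\epsilon f(x)\right]+\dfrac{1}{2\epsilon^2}u_\epsilon(t,x)-\dfrac12\Delta u_\epsilon(t,x)+\dfrac{\epsilon^2}{8}\Delta^2u_\epsilon(t,x); & t>0,\ x\in\mathbb{R}^d,\\[2mm] u_\epsilon(0,x)=f(x)=\displaystyle\lim_{t\downarrow0,\ y\to x}u_\epsilon(t,y); & x\in\mathbb{R}^d.\end{cases}$$
   Context: All processes are defined on a probability space $(\Omega,\mathcal{F},\{\mathcal{F}_t\},\mathbb{P})$ with expectation $\mathbb{E}_{\mathbb{P}}$. $D_{ij}f=\partial^2 f/\partial x_i\partial x_j$. $p_t(0,s)=(2\pi t)^{-1/2}e^{-s^2/2t}$ is the transition density of $B(t)$. The $\epsilon$-scaled Brownian-time process is $\mathbb{X}^x_{\epsilon B}(t)=X^x(\epsilon|B(t)|)$. An excursion interval of $|B|$ is a maximal time interval $(r,s)$ on which $|B(t)|>0$. The process $\mathbb{X}^{x,k}_{\epsilon B,e}$ is obtained as follows: let $X^{x,1},\dots,X^{x,k}$ be independent copies of $X^x$ started at $x$ (independent of $B$), and on each excursion interval of $|B(t)|$ use one of the $k$ copies, chosen at random, in place of $X^x$ in $X^x(\epsilon|B(t)|)$; for $k=1$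 this is $\mathbb{X}^x_{\epsilon B}$. The process $\mathbb{X}^x_{\epsilon B,e}$ is obtained by using a new independent copy of $X^x$ on each excursion interval of $|B(t)|$. For each fixed $t$, all these processes have the same one-dimensional distribution as $\mathbb{X}^x_{\epsilon B}(t)$. Property (P): for every bounded $f:\mathbb{R}^d\to\mathbb{R}$ such that $D_{ij}f$ is Hölder continuous for all $1\le i,j\le d$, one has that $\frac{\partial^2}{\partial s^2}\mathcal{T}_sf(x)=\mathcal{A}^2\mathcal{T}_sf(x)$ is continuous on $(0,\infty)\times\mathbb{R}^d$, and (a) $\mathcal{A}^2\int_0^\infty \mathcal{T}_sf(x)\,p_t(0,s)\,ds=\int_0^\infty\mathcal{A}^2\mathcal{T}_sf(x)\,p_t(0,s)\,ds$; (b) $\mathcal{A}^2\int_0^t\int_0^\infty\mathcal{T}_sf(x)\,p_r(0,s)\,ds\,dr=\int_0^t\int_0^\infty\mathcal{A}^2\mathcal{T}_sf(x)\,p_r(0,s)\,ds\,dr$. *)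

(* Defs.v *)
From HB Require Import structures.
From mathcomp Require Import all_boot all_order all_algebra.
From mathcomp Require Import all_classical all_reals all_analysis.

Set Implicit Arguments.
Unset Strict Implicit.
Unset Printing Implicit Defensive.

Import Order.TTheory GRing.Theory Num.Theory.
Import numFieldNormedType.Exports.

Local Open Scope classical_set_scope.
Local Open Scope ring_scope.

Definition borel (V : topologicalType) : set (set V) := <<s @open V >>.

Definition borel_fun (V W : topologicalType) (f : V -> W) : Prop :=
  forall A, borel A -> borel (f @^-1` A).

(** Stochastic processes [Y : R -> T -> V]; the time set is [0, +oo[, and the
    values [Y t] for [t < 0] are never used. *)
Section processes.
Context {R : realType} {disp : measure_display} {T : measurableType disp}.
Variable P : probability T R.

Definition filtration (F : R -> set (set T)) : Prop :=
  [/\ forall t, 0 <= t -> sigma_algebra setT (F t),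
      forall t, 0 <= t -> F t `<=` measurable &
      forall s t, 0 <= s -> s <= t -> F s `<=` F t].

Definition adapted (V : topologicalType) (F : R -> set (set T))
    (Y : R -> T -> V) : Prop :=
  forall t A, 0 <= t -> borel A -> F t (Y t @^-1` A).

Definition continuous_paths (V : topologicalType) (Y : R -> T -> V) : Prop :=
  forall w, {within `[0, +oo[, continuous (Y ^~ w)}.

Definition continuous_process (V : topologicalType) (Y : R -> T -> V) : Prop :=
  adapted (fun _ => measurable) Y /\ continuous_paths Y.

Definition sigma_process (V : topologicalType) (Y : R -> T -> V) :
    set (set T) :=
  <<s [set E | exists t A, [/\ 0 <= t, borel A & E = Y t @^-1` A]] >>.

Definition sigma_variable (L : Type) (K : T -> L) : set (set T) :=
  [set E | exists A : set L, E = K @^-1` A].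

Definition mutually_independent (I : eqType) (G : I -> set (set T)) : Prop :=
  forall (s : seq I) (E : I -> set T), uniq s ->
    (forall i, i \in s -> G i (E i)) ->
    P (\big[setI/setT]_(i <- s) E i) = (\big[mule/1]_(i <- s) P (E i))%E.

Definition same_law (V : topologicalType) (Y Z : R -> T -> V) : Prop :=
  forall n (t : 'I_n -> R) (A : 'I_n -> set V),
    (forall i, 0 <= t i) -> (forall i, borel (A i)) ->
    P [set w | forall i, A i (Y (t i) w)] =
    P [set w | forall i, A i (Z (t i) w)].

(** One-dimensional Brownian motion relative to [F], started at [x]
    (the second parameter of [normal_prob] is the standard deviation). *)
Definition brownian_motion (F : R -> set (set T)) (x : R) (W : R -> T -> R) :
    Prop :=
  [/\ adapted F W, continuous_paths W, forall w, W 0 w = x &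
      forall s t E A, 0 <= s -> s < t -> F s E -> borel A ->
        P (E `&` [set w | A (W t w - W s w)]) =
        (P E * normal_prob 0 (Num.sqrt (t - s)) A)%E].

Definition brownian_motion_rV (d : nat) (F : R -> set (set T)) (x : 'rV[R]_d)
    (W : R -> T -> 'rV[R]_d) : Prop :=
  (forall i, brownian_motion F (x ord0 i) (fun t w => W t w ord0 i)) /\
  mutually_independent (fun i : 'I_d => sigma_process (fun t w => W t w ord0 i)).

(** [X x] is the process started at [x]; the transition kernel is
    [(s, y, A) |-> P (X y s \in A)]. *)
Definition continuous_markov_process (d : nat) (F : R -> set (set T))
    (X : 'rV[R]_d -> R -> T -> 'rV[R]_d) : Prop :=
  [/\ forall x, adapted F (X x),
      forall x, continuous_paths (X x),
      forall x w, X x 0 w = x,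
      forall s A, 0 <= s -> borel A ->
        borel_fun (fun y => fine (P (X y s @^-1` A))) &
      forall x s t E A, 0 <= s -> 0 <= t -> F t E -> borel A ->
        P (E `&` X x (t + s) @^-1` A) =
        (\int[P]_(w in E) P (X (X x t w) s @^-1` A))%E].

Definition semigroup (d : nat) (X : 'rV[R]_d -> R -> T -> 'rV[R]_d)
    (s : R) (f : 'rV[R]_d -> R) (x : 'rV[R]_d) : R :=
  fine ('E_P[fun w => f (X x s w)])%E.

End processes.

(** The generator of a semigroup of operators on the bounded Borel functions
    on a topological space, with convergence in the supremum norm. *)
Section generator.
Context {R : realType} {V : topologicalType}.
Variable S : R -> (V -> R) -> V -> R.

Definition in_domain (f : V -> R) : Prop :=
  [/\ borel_fun f, bounded_fun f &
      exists g : V -> R, forall e, 0 < e ->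
        \forall h \near 0^'+, forall x, `|(S h f x - f x) / h - g x| < e].

Definition generator (f : V -> R) (x : V) : R :=
  lim ((S h f x - f x) / h @[h --> (0 : R)^'+]).

Definition in_domain2 (f : V -> R) : Prop :=
  in_domain f /\ in_domain (generator f).

Definition generator2 (f : V -> R) : V -> R := generator (generator f).

End generator.

Section derivatives.
Context {R : realType} {d : nat}.
Implicit Types f : 'rV[R]_d -> R.

Definition partial (i : 'I_d) f (x : 'rV[R]_d) : R :=
  'D_(delta_mx ord0 i) f x.

Definition partial2 (i j : 'I_d) f : 'rV[R]_d -> R := partial i (partial j f).

Definition has_partial2 (i j : 'I_d) f : Prop :=
  forall x, derivable f x (delta_mx ord0 j) /\
            derivable (partial j f) x (delta_mx ord0 i).

Definition laplacian f (x : 'rV[R]_d) : R := \sum_(i < d) partial2 i i f x.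

Definition has_laplacian f : Prop := forall i, has_partial2 i i f.

(** The norm of ['rV[R]_d] is the maximum norm; being equivalent to the
    Euclidean one, it gives the same notion. *)
Definition hoelder_continuous (alpha : R) f : Prop :=
  exists C, forall x y, `|f x - f y| <= C * `|x - y| `^ alpha.

End derivatives.

(** The transition density from [0] to [s] of Brownian motion. *)
Definition heat_kernel (R : realType) (t s : R) : R :=
  (Num.sqrt (2 * pi * t))^-1 * expR (- s ^+ 2 / (2 * t)).

Section property_P.
Context {R : realType} {d : nat}.
Variable S : R -> ('rV[R]_d -> R) -> 'rV[R]_d -> R.
Local Notation mu := (@lebesgue_measure R).

(** [A^2 (S s f)] being continuous includes [S s f \in D(A^2)], and the
    equalities of integrals include that the functions to which [A^2] is applied
    are in [D(A^2)] and that the right-hand sides converge absolutely. *)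
Definition property_P : Prop :=
  forall f : 'rV[R]_d -> R, bounded_fun f ->
    (forall i j, has_partial2 i j f /\
       exists2 alpha, 0 < alpha <= 1 & hoelder_continuous alpha (partial2 i j f)) ->
  [/\ forall s, 0 < s -> in_domain2 S (S s f),
      forall s x, 0 < s ->
        [/\ derivable (fun r => S r f x) s 1,
            derivable (derive1 (fun r => S r f x)) s 1 &
            derive1n 2 (fun r => S r f x) s = generator2 S (S s f) x],
      forall s x, 0 < s ->
        {for (s, x), continuous
          (fun z : R * 'rV[R]_d => generator2 S (S z.1 f) z.2)},
      forall t, 0 < t ->
        let v x := \int[mu]_(s in `]0, +oo[) (S s f x * heat_kernel t s) in
        let g x s := generator2 S (S s f) x * heat_kernel t s in
        in_domain2 S v /\
        forall x, mu.-integrable `]0, +oo[ (EFin \o g x) /\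
          generator2 S v x = \int[mu]_(s in `]0, +oo[) g x s &
      forall t, 0 < t ->
        let v x := \int[mu]_(r in `]0, t])
          \int[mu]_(s in `]0, +oo[) (S s f x * heat_kernel r s) in
        let g x r s := generator2 S (S s f) x * heat_kernel r s in
        let G x r := \int[mu]_(s in `]0, +oo[) g x r s in
        in_domain2 S v /\
        forall x,
          [/\ forall r, 0 < r <= t -> mu.-integrable `]0, +oo[ (EFin \o g x r),
              mu.-integrable `]0, t] (EFin \o G x) &
              generator2 S v x = \int[mu]_(r in `]0, t]) G x r]].

End property_P.

Section excursions.
Context {R : realType} {disp : measure_display} {T : measurableType disp}.
Variable P : probability T R.

Definition excursion_interval (b : R -> R) (I : set R) : Prop :=
  let pos J := [/\ is_interval J, J !=set0 &
                   J `<=` [set t | 0 <= t /\ 0 < `|b t|]] in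
  pos I /\ forall J, pos J -> I `<=` J -> J = I.

(** A measurable numbering of the excursion intervals of [|B|]: [e t] is the
    number of the interval that contains [t], distinct intervals having distinct
    numbers. When [B t = 0] the value of [e t] is irrelevant. *)
Definition excursion_numbering (B : R -> T -> R) (e : R -> T -> nat) : Prop :=
  (forall t n, 0 <= t -> sigma_process B [set w | e t w = n]) /\
  forall w I J s t, excursion_interval (B ^~ w) I ->
    excursion_interval (B ^~ w) J -> I s -> J t ->
    (e s w = e t w <-> I = J).

Context {d : nat}.
Variables (X : 'rV[R]_d -> R -> T -> 'rV[R]_d) (B : R -> T -> R) (eps : R).
Implicit Types Y : 'rV[R]_d -> R -> T -> 'rV[R]_d.

Definition is_copy (x : 'rV[R]_d) (Z : R -> T -> 'rV[R]_d) : Prop :=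
  continuous_process Z /\ same_law P (X x) Z /\ forall w, Z 0 w = x.

(** On the excursion interval with number [n] one uses the copy with index
    [K n], where the [K n] are independent and uniform on the [k] indices. *)
Definition k_excursion_process (k : nat) Y : Prop :=
  exists (Z : 'I_k -> 'rV[R]_d -> R -> T -> 'rV[R]_d)
         (K : nat -> T -> 'I_k) (e : R -> T -> nat),
  [/\ forall j x, is_copy x (Z j x),
      forall n j, measurable [set w | K n w = j] /\
                  P [set w | K n w = j] = (k%:R^-1)%:E,
      excursion_numbering B e,
      forall x, mutually_independent P
        (fun i : option ('I_k + nat) =>
           match i with
           | None => sigma_process B
           | Some (inl j) => sigma_process (Z j x)
           | Some (inr n) => sigma_variable (K n)
           end) &
      forall x t w, Y x t w = Z (K (e t w) w) x (eps * `|B t w|) w].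

Definition excursion_process Y : Prop :=
  exists (Z : nat -> 'rV[R]_d -> R -> T -> 'rV[R]_d) (e : R -> T -> nat),
  [/\ forall n x, is_copy x (Z n x),
      excursion_numbering B e,
      forall x, mutually_independent P
        (fun i : option nat =>
           if i is Some n then sigma_process (Z n x) else sigma_process B) &
      forall x t w, Y x t w = Z (e t w) x (eps * `|B t w|) w].

Definition u_eps Y (f : 'rV[R]_d -> R) (t : R) (x : 'rV[R]_d) : R :=
  fine ('E_P[(fun w => f (Y x t w) * expR (- (`|B t w| / eps)))%R])%E.

End excursions.

Section equations.
Context {R : realType} {d : nat}.
Implicit Types (f : 'rV[R]_d -> R) (u : R -> 'rV[R]_d -> R).

Definition initial_condition f u : Prop :=
  forall x, u 0 x = f x /\
    u z.1 z.2 @[z --> within [set z : R * 'rV[R]_d | 0 < z.1] (nbhs (0, x))]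
      --> f x.

Definition solves_generator_pde (S : R -> ('rV[R]_d -> R) -> 'rV[R]_d -> R)
    (eps : R) f u : Prop :=
  (forall t x, 0 < t ->
    [/\ in_domain2 S (u t), derivable (u ^~ x) t 1 &
        derive1 (u ^~ x) t =
          (Num.sqrt (2 * pi * t))^-1 * (eps * generator S f x - eps^-1 * f x)
          + (2 * eps ^+ 2)^-1 * u t x
          - generator S (u t) x
          + eps ^+ 2 / 2 * generator2 S (u t) x]) /\
  initial_condition f u.

Definition solves_laplacian_pde (eps : R) f u : Prop :=
  (forall t x, 0 < t ->
    [/\ has_laplacian (u t), has_laplacian (laplacian (u t)),
        derivable (u ^~ x) t 1 &
        derive1 (u ^~ x) t =
          (Num.sqrt (2 * pi * t))^-1 * (eps / 2 * laplacian f x - eps^-1 * f x)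
          + (2 * eps ^+ 2)^-1 * u t x
          - 2^-1 * laplacian (u t) x
          + eps ^+ 2 / 8 * laplacian (laplacian (u t)) x]) /\
  initial_condition f u.

End equations.

(* Main.v *)
Require Import Defs.
From HB Require Import structures.
From mathcomp Require Import all_boot all_order all_algebra.
From mathcomp Require Import all_classical all_reals all_analysis.
From mathcomp Require Import measurable_realfun ring lra.

Set Implicit Arguments.
Unset Strict Implicit.
Unset Printing Implicit Defensive.

Import Order.TTheory GRing.Theory Num.Theory.
Import numFieldNormedType.Exports.

Local Open Scope classical_set_scope.
Local Open Scope ring_scope.

(** At a fixed time the copy of [X x] used by the excursion process is fresh and
    independent of [B], whatever the selection rule ([excursion_process_copy]).
    Conditioning on [|B t|], whose density is twice the heat kernel, gives
    [u t x = \int_0^oo phi_t(r) S_(eps r) f(x) dr] with the weight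
    [phi_t(r) = 2 (2 pi t)^(-1/2) exp(- r / eps - r^2 / (2 t))] ([u_epsE]):
    the function [u t] is an average of the semigroup along the time axis.

    Such an average is regularising in time. Applying [S h] shifts the argument of
    the semigroup, and the shift can be moved onto the weight; hence an average
    with weight [phi] belongs to the domain, and its generator is
    [- (phi(0) f + average of phi') / eps] ([has_generator_average]). As [f] is in
    the domain, this applies twice to [u t]. On the other hand the heat equation
    for the kernel reads [2 d/dt phi_t = (d/dr + 1 / eps)^2 phi_t]. Replacing each
    derivative in [r] by [- eps] times the generator, plus a boundary term at
    [r = 0], gives the equation; the boundary terms form its inhomogeneous part
    ([u_eps_equation]). The initial condition holds because [u t x - f x] is at
    most the expectation of a bounded continuous function of [B t] vanishing at
    the origin, uniformly in [x] ([u_eps_initial]).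

    When [X] is a Brownian motion it remains to identify the generator with half
    the Laplacian and to show that the derivatives exist. This is done on the class
    [smooth] of bounded uniformly continuous functions with bounded uniformly
    continuous pure second partial derivatives. It contains [f]
    ([hoelder_smooth]); it is preserved by averages, since the Brownian semigroup
    commutes with translations ([smooth_average]); and on it the generator is half
    the Laplacian ([brownian_generator]): the increment is added one coordinate at
    a time, the sign of a coordinate is averaged out by symmetry, and Taylor's
    formula leaves half the variance times a second derivative. The generator of
    [u t] is a combination of [f] and of an average, so it is smooth as well, and
    the square of the generator is a quarter of the bi-Laplacian. *)

(** * Borel functions *)

Section borel_functions.
Context {R : realType} {V : ptopologicalType}.
Implicit Types (f g : V -> R).

Lemma borel_setR (A : set R) : borel A <-> measurable A.
Proof.
split.
- apply: smallest_sub; first exact: sigma_algebra_measurable.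
  by move=> U oU; exact: open_measurable.
- rewrite /measurable/= /measurableR (RGenOpens.measurableE R).
  apply: smallest_sub; first exact: smallest_sigma_algebra.
  move=> _ [x [y ->]]; apply: sub_gen_smallest.
  exact: interval_open.
Qed.

Lemma borel_funP f :
  borel_fun f <-> measurable_fun [set: g_sigma_algebraType (@open V)] f.
Proof.
split=> [bf _ A mA|mf A bA].
- by rewrite setTI; apply: bf; apply/borel_setR.
- by rewrite -[_ @^-1` _]setTI; apply: mf => //; apply/borel_setR.
Qed.

Lemma continuous_borel_fun f : continuous f -> borel_fun f.
Proof.
move=> cf A; pose S := [set A : set R | borel (f @^-1` A)].
suff : @borel R `<=` S by exact.
apply: smallest_sub.
- split=> [|B SB|F SF]; rewrite /S/=.
  + rewrite preimage_set0; exact: (@sigma_algebra0 _ setT (@open V)).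
  + rewrite setTD -preimage_setC; exact: sigma_algebraC.
  + rewrite preimage_bigcup; exact: (@sigma_algebra_bigcup _ setT (@open V)).
- by move=> U oU; apply: sub_gen_smallest; move/continuousP: cf; exact.
Qed.

Definition bounded_borel f : Prop := borel_fun f /\ exists M : R, forall x, `|f x| <= M.

Lemma bounded_funP f : bounded_fun f <-> exists M : R, forall x, `|f x| <= M.
Proof.
split=> [[M [_ fM]]|[M fM]].
  by exists (M + 1) => x; apply: fM => //; rewrite ltrDl.
by exists M; split => [|N MN x _]; [exact: num_real|exact: le_trans (fM x) (ltW MN)].
Qed.

Lemma bounded_borel_indic A : borel A -> bounded_borel (\1_A : V -> R).
Proof.
move=> bA; split.
  by apply/borel_funP; apply/measurable_indicP.
by exists 1 => x; rewrite indicE; case: (_ \in _); rewrite ?normr1 ?normr0.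
Qed.

Lemma bounded_borel_lin a f g : bounded_borel f -> bounded_borel g ->
  bounded_borel (fun x => a * f x + g x).
Proof.
move=> [/borel_funP mf [M fM]] [/borel_funP mg [N gN]]; split.
  apply/borel_funP; apply: measurable_funD => //.
  exact: measurable_funM.
exists (`|a| * M + N) => x; rewrite (le_trans (ler_normD _ _))//.
by rewrite lerD// normrM ler_wpM2l.
Qed.

Lemma bounded_borel0 : bounded_borel (fun=> 0 : R).
Proof.
split; last by exists 0 => x; rewrite normr0.
by apply/borel_funP; exact: measurable_cst.
Qed.

Lemma sum_pick (n p : nat) (a : nat -> R) :
  \sum_(k < n) ((p == k)%:R * a k) = if (p < n)%N then a p else 0.
Proof.
case: ltnP => [pn|np].
  rewrite (bigD1 (Ordinal pn))//= eqxx mul1r big1 ?addr0// => i ip.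
  suff /negbTE -> : p != i by rewrite mul0r.
  by apply: contra ip => /eqP pi; apply/eqP/val_inj.
rewrite big1// => i _; suff /negbTE -> : p != i by rewrite mul0r.
by rewrite gtn_eqF// (leq_trans (ltn_ord i)).
Qed.

(** Every bounded Borel function is a uniform limit of finite combinations of
    indicators, obtained by rounding its values. *)
Lemma bounded_borel_ind (Q : (V -> R) -> Prop) :
  (forall A, borel A -> Q \1_A) ->
  (forall a f g, bounded_borel f -> bounded_borel g -> Q f -> Q g ->
    Q (fun x => a * f x + g x)) ->
  (forall f, bounded_borel f -> (forall e : R, 0 < e -> exists g,
    [/\ bounded_borel g, Q g & forall x, `|f x - g x| <= e]) -> Q f) ->
  forall f, bounded_borel f -> Q f.
Proof.
move=> Q1 QD Qlim f bf; apply: Qlim => // e e0.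
have [bf1 [M fM]] := bf.
have M0 : 0 <= M by exact: le_trans (normr_ge0 _) (fM point).
have fM0 x : 0 <= (f x + M) / e.
  by rewrite divr_ge0 ?(ltW e0)//; have := fM x; rewrite ler_norml -lerBlDr sub0r => /andP[].
pose A k := [set x | Num.truncn ((f x + M) / e) = k].
have bA k : borel (A k).
  suff -> : A k = f @^-1` `[k%:R * e - M, k.+1%:R * e - M[.
    by apply: bf1; apply/borel_setR; exact: measurable_itv.
  apply/seteqP; split=> x /=; rewrite in_itv/=.
    by move/eqP; rewrite truncn_eq// ler_pdivlMr// ltr_pdivrMr// lerBlDr ltrBrDr.
  by rewrite lerBlDr ltrBrDr -ler_pdivlMr// -ltr_pdivrMr// -truncn_eq// => /eqP.
pose g n := fun x => \sum_(k < n) ((Num.truncn ((f x + M) / e) == k)%:R * (k%:R * e - M)).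
have gS n : g n.+1 = fun x => (n%:R * e - M) * \1_(A n) x + g n x.
  apply/funext => x; rewrite /g big_ord_recr/= addrC mulrC indicE; congr (_ * (nat_of_bool _)%:R + _).
  by apply/idP/idP => [/eqP H|/set_mem/eqP//]; exact: mem_set.
have Qg n : bounded_borel (g n) /\ Q (g n).
  elim: n => [|n [IH1 IH2]].
    have -> : g 0%N = \1_set0.
      by apply/funext => x; rewrite /g big_ord0 indicE in_set0.
    have b0 : borel (set0 : set V) by exact: (@sigma_algebra0 _ setT (@open V)).
    by split; [exact: bounded_borel_indic|exact: Q1].
  rewrite gS; split; first by apply: bounded_borel_lin => //; exact: bounded_borel_indic.
  by apply: QD => //; [exact: bounded_borel_indic|exact: Q1].
exists (g (Num.truncn ((M + M) / e)).+1); split; [exact: (Qg _).1|exact: (Qg _).2|].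
move=> x; rewrite /g (sum_pick _ _ (fun k => k%:R * e - M)) ifT; last first.
  rewrite ltnS; apply: le_truncn; rewrite ler_wpM2r ?invr_ge0 ?(ltW e0)// lerD2r.
  exact: le_trans (ler_norm _) (fM x).
have /andP[] := truncn_itv (fM0 x).
set k := Num.truncn _; rewrite ler_pdivlMr// ltr_pdivrMr// -natr1 => k1 k2.
by rewrite ler_norml; apply/andP; split; nra.
Qed.

Lemma bounded_borel_scale a f : bounded_borel f -> bounded_borel (fun x => a * f x).
Proof.
move=> bf; have := bounded_borel_lin a bf bounded_borel0.
by under eq_fun do rewrite addr0.
Qed.

Lemma borel_fun_cvg (f_ : nat -> V -> R) f : (forall n, borel_fun (f_ n)) ->
  (forall x, f_ n x @[n --> \oo] --> f x) -> borel_fun f.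
Proof.
move=> bf cf; apply/borel_funP.
by apply: measurable_fun_cvg => [n|x _]; [exact/borel_funP|exact: cf].
Qed.

End borel_functions.

Section convergence_of_integrals.
Context {R : realType} {disp : measure_display} {T : measurableType disp}.
Variables (mu : {measure set T -> \bar R}) (D : set T) (mD : measurable D).

Lemma integrable_dominated (f g : T -> R) : measurable_fun D f ->
  mu.-integrable D (EFin \o g) -> (forall x, D x -> `|f x| <= g x) ->
  mu.-integrable D (EFin \o f).
Proof.
move=> mf ig fg; apply: le_integrable ig => //; first exact/measurable_EFinP.
by move=> x Dx /=; rewrite lee_fin (le_trans (fg _ Dx))// ler_norm.
Qed.

Lemma le_norm_Rintegral (f g : T -> R) : measurable_fun D f ->
  mu.-integrable D (EFin \o g) -> (forall x, D x -> `|f x| <= g x) ->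
  `|\int[mu]_(x in D) f x| <= \int[mu]_(x in D) g x.
Proof.
move=> mf ig fg; have fi := integrable_dominated mf ig fg.
apply: le_trans (le_normr_Rintegral mD fi) _; apply: le_Rintegral => //.
exact: integrable_norm.
Qed.

Lemma Rintegral_sum {I : Type} (s : seq I) (f : I -> T -> R) :
  (forall i, mu.-integrable D (EFin \o f i)) ->
  mu.-integrable D (EFin \o (fun w => \sum_(i <- s) f i w)) /\
  \int[mu]_(w in D) (\sum_(i <- s) f i w) = \sum_(i <- s) \int[mu]_(w in D) f i w.
Proof.
move=> fi; elim: s => [|i s [IH1 IH2]].
  split; last by under eq_Rintegral do rewrite big_nil; rewrite Rintegral_cst// mul0r big_nil.
  by apply: eq_integrable (integrable0 mu D) => // w _; rewrite /= big_nil.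
have E w : \sum_(j <- i :: s) f j w = f i w + \sum_(j <- s) f j w by rewrite big_cons.
split; last by under eq_Rintegral do rewrite E; rewrite RintegralD// IH2 big_cons.
by apply: eq_integrable (integrableD mD (fi i) IH1) => // w _; rewrite /= E EFinD.
Qed.

Lemma Rintegral_dominated_cvg (f_ : nat -> T -> R) (f g : T -> R) :
  (forall n, measurable_fun D (f_ n)) ->
  (forall x, D x -> f_ n x @[n --> \oo] --> f x) ->
  mu.-integrable D (EFin \o g) ->
  (forall n x, D x -> `|f_ n x| <= g x) ->
  \int[mu]_(x in D) f_ n x @[n --> \oo] --> \int[mu]_(x in D) f x.
Proof.
move=> mf cf ig fg.
have mlim : measurable_fun D f by apply: measurable_fun_cvg cf.
have [] := @dominated_convergence _ _ _ mu D mD (fun n => EFin \o f_ n)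
  (EFin \o f) (EFin \o g).
- by move=> n; exact/measurable_EFinP.
- exact/measurable_EFinP.
- apply: aeW => x Dx; apply: cvg_EFin; last exact: cf.
  exact: nearW.
- exact: ig.
- by apply: aeW => x n Dx; rewrite /= lee_fin; exact: fg.
move=> fi _ H; apply: fine_cvg; rewrite fineK; first exact: H.
exact: integrable_fin_num.
Qed.

End convergence_of_integrals.

(** * Discretization in time *)

Section discretization.
Context {R : realType}.

Definition grid_index (m : nat) (y : R) : nat := Num.truncn (m.+1%:R * y).

Definition grid_point (m k : nat) : R := k%:R / m.+1%:R.

Lemma grid_point_ge0 m k : 0 <= grid_point m k.
Proof. by rewrite divr_ge0. Qed.

Lemma grid_point_cvg (y : R) : 0 <= y ->
  grid_point m (grid_index m y) @[m --> \oo] --> y.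
Proof.
move=> y0; apply/cvgrPdist_le => e e0.
have [N Ne] : exists N : nat, e^-1 <= N%:R.
  by exists (Num.truncn e^-1).+1; rewrite ltW// truncnS_gt.
exists N => // m /= Nm; rewrite /grid_point /grid_index.
have m0 : 0 < (m.+1%:R : R) by [].
have /truncn_itv/andP[] : 0 <= m.+1%:R * y by rewrite mulr_ge0.
set k := Num.truncn _; rewrite -[k.+1%:R]natr1 => k1 k2.
have -> : y - k%:R / m.+1%:R = (m.+1%:R * y - k%:R) / m.+1%:R.
  by field; rewrite gt_eqF.
rewrite normrM normfV (ger0_norm (ltW m0)) ler_pdivrMr//.
have : 1 <= e * m.+1%:R.
  rewrite mulrC -ler_pdivrMr// div1r (le_trans Ne)// ler_nat.
  exact: leqW.
by apply: le_trans; rewrite ler_norml; apply/andP; split; lra.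
Qed.

Lemma grid_index_small (y : R) : 0 <= y ->
  \forall m \near \oo, (grid_index m y < m.+1 ^ 2)%N.
Proof.
move=> y0; exists (Num.truncn y).+1 => // m /= ym.
rewrite /grid_index -(@ltr_nat R); have /andP[+ _] := truncn_itv (mulr_ge0 (ler0n R m.+1) y0).
move=> /le_lt_trans; apply; rewrite natrX expr2 ltr_pM2l//.
by rewrite (lt_trans (truncnS_gt y))// ltr_nat.
Qed.

Context {disp : measure_display} {T : measurableType disp}.
Variables (mu : {measure set T -> \bar R}) (D : set T) (beta : T -> R)
  (G : R -> T -> R).
Hypotheses (mD : measurable D) (mbeta : measurable_fun D beta)
  (beta0 : forall w, D w -> 0 <= beta w)
  (mG : forall s, 0 <= s -> measurable_fun D (G s))
  (cG : forall w, D w -> continuous (G ^~ w)).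

(** The mesh is [1 / (m + 1)] and the grid stops at [m + 1], hence [(m + 1)^2]
    cells: a finite sum that reaches every time in the limit. *)
Let step m w : R :=
  \sum_(k < m.+1 ^ 2) ((grid_index m (beta w) == k)%:R * G (grid_point m k) w).

Let stepE m w : step m w = if (grid_index m (beta w) < m.+1 ^ 2)%N
  then G (grid_point m (grid_index m (beta w))) w else 0.
Proof. by rewrite -(sum_pick _ _ (fun k => G (grid_point m k) w)). Qed.

Let step_cvg w : D w -> step m w @[m --> \oo] --> G (beta w) w.
Proof.
move=> Dw; have := @cG w Dw (beta w).
move=> /(cvg_comp _ _ (grid_point_cvg (beta0 Dw))).
apply: cvg_trans; apply: near_eq_cvg.
near=> m; rewrite stepE/= ifT//.
near: m; exact: grid_index_small (beta0 Dw).
Unshelve. all: by end_near. Qed.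

Lemma measurable_grid_index m k :
  measurable_fun D (fun w => (grid_index m (beta w) == k)%:R : R).
Proof.
have m0 : 0 < (m.+1%:R : R) by [].
pose E := `[k%:R / m.+1%:R, k.+1%:R / m.+1%:R[%classic : set R.
have mE : measurable_fun D (\1_E \o beta : T -> R).
  by apply: measurableT_comp mbeta; apply: measurable_indic; exact: measurable_itv.
apply: eq_measurable_fun mE.
  move=> w /set_mem Dw; rewrite /= indicE /grid_index truncn_eq; last first.
    by rewrite mulr_ge0// beta0.
  rewrite (mulrC m.+1%:R) -ler_pdivrMr// -ltr_pdivlMr//; congr (nat_of_bool _)%:R.
  by apply/idP/idP => [/set_mem/=|H]; [|apply/mem_set]; rewrite /= ?in_itv.
Qed.

Let measurable_step m : measurable_fun D (step m).
Proof.
apply: measurable_sum => k; apply: measurable_funM.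
  exact: measurable_grid_index.
exact: mG (grid_point_ge0 _ _).
Qed.

Variable g : T -> R.
Hypotheses (ig : mu.-integrable D (EFin \o g))
  (Gg : forall s w, 0 <= s -> D w -> `|G s w| <= g w).

Let stepM m w : D w -> `|step m w| <= g w.
Proof.
move=> Dw; rewrite stepE; case: ifP => _; first exact: Gg (grid_point_ge0 _ _) Dw.
by rewrite normr0 (le_trans _ (Gg (lexx 0) Dw)).
Qed.

Let Rintegral_step m : \sum_(k < m.+1 ^ 2)
    \int[mu]_(w in D) ((grid_index m (beta w) == k)%:R * G (grid_point m k) w) =
  \int[mu]_(w in D) step m w.
Proof.
apply/esym; rewrite /step.
apply: (Rintegral_sum mD (index_enum 'I_(m.+1 ^ 2))
  (f := fun (k : 'I_(m.+1 ^ 2)) w => (grid_index m (beta w) == k)%:R * G (grid_point m k) w) _).2 => k.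
apply: integrable_dominated ig _ => //.
  by apply: measurable_funM; [exact: measurable_grid_index|exact: mG (grid_point_ge0 _ _)].
move=> w Dw; have := Gg (grid_point_ge0 m k) Dw.
by case: eqP => _; rewrite ?mul1r// mul0r normr0 => /(le_trans (normr_ge0 _)).
Qed.

(** Rounding the random time [beta w] to the grid turns [G] into a finite sum that
    involves deterministic times only; continuity in time gives the limit. *)
Lemma Rintegral_random_time :
  (\sum_(k < m.+1 ^ 2)
    \int[mu]_(w in D) ((grid_index m (beta w) == k)%:R * G (grid_point m k) w))
    @[m --> \oo] --> \int[mu]_(w in D) G (beta w) w.
Proof.
under eq_fun do rewrite Rintegral_step.
apply: (Rintegral_dominated_cvg mD measurable_step _ ig).
  by move=> w Dw; exact: step_cvg.
by move=> m w Dw; exact: stepM.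
Qed.

Lemma le_Rintegral_random_time m :
  `|\sum_(k < m.+1 ^ 2)
    \int[mu]_(w in D) ((grid_index m (beta w) == k)%:R * G (grid_point m k) w)|
  <= \int[mu]_(w in D) g w.
Proof.
by rewrite Rintegral_step; apply: le_norm_Rintegral => // w; exact: stepM.
Qed.

End discretization.

Lemma measurable_grid_cell (R : realType) m n :
  measurable [set y : R | grid_index m `|y| = n].
Proof.
have mn : measurable_fun setT (fun y : R => `|y|).
  by apply: continuous_measurable_fun; exact: norm_continuous.
have := measurable_grid_index (beta := fun y : R => `|y|) mn (fun y _ => normr_ge0 y) m n.
move=> /(_ measurableT [set 1] (measurable_set1 _)); rewrite setTI.
congr measurable; apply/seteqP; split => y /=; last by move=> ->; rewrite eqxx.
by case: eqP => // _ /eqP; rewrite eq_sym oner_eq0.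
Qed.

Lemma continuous_abs_halfline (R : realType) (W : topologicalType) (g : R -> W) :
  {within `[0, +oo[, continuous g} -> continuous (fun s : R => g `|s|).
Proof.
move=> /subspace_continuousP cg s.
apply: (@cvg_comp _ _ _ (fun s : R => `|s|) g _ (within `[0, +oo[ (nbhs `|s|))).
  move=> U /= wU; have : `|z| @[z --> s] --> `|s| by exact: norm_continuous.
  move=> /(_ _ wU)/=; apply: (@filterS _ (nbhs s)) => z; apply.
  by rewrite /= in_itv/= andbT.
by apply: cg; rewrite /= in_itv/= andbT.
Qed.

(** * The semigroup of a continuous Markov process *)

Section expectations.
Context {R : realType} {disp : measure_display} {T : measurableType disp}.
Variable P : probability T R.

Lemma integrable_bounded (f : T -> R) M : measurable_fun setT f ->
  (forall w, `|f w| <= M) -> P.-integrable setT (EFin \o f).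
Proof.
move=> mf fM; apply: (@integrable_dominated _ _ _ P setT measurableT f (cst M)) => //.
by apply: finite_measure_integrable_cst; rewrite ?probability_setT ?ltry.
Qed.

Lemma Rintegral_prob_cst (c : R) : \int[P]_w c = c.
Proof. by rewrite Rintegral_cst//= probability_setT mulr1. Qed.

Lemma le_norm_expectation (f : T -> R) M : measurable_fun setT f ->
  (forall w, `|f w| <= M) -> `|\int[P]_w f w| <= M.
Proof.
move=> mf fM; rewrite -[leRHS]Rintegral_prob_cst.
apply: (@le_norm_Rintegral _ _ _ P setT measurableT f (cst M)) => //.
by apply: finite_measure_integrable_cst; rewrite ?probability_setT ?ltry.
Qed.

Lemma Rintegral_indic_prob (E : set T) : measurable E ->
  \int[P]_w (\1_E w) = fine (P E).
Proof. by move=> mE; rewrite /Rintegral integral_indic// setIT. Qed.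

Lemma measurable_comp_borel {V : ptopologicalType} (Z : T -> V) (g : V -> R) :
  (forall A, borel A -> measurable (Z @^-1` A)) -> borel_fun g ->
  measurable_fun setT (fun w => g (Z w)).
Proof.
move=> mZ bg _ A mA; rewrite setTI.
by apply: (mZ (g @^-1` A)); apply: bg; apply/borel_setR.
Qed.

Lemma continuous_expectation (G : R -> T -> R) (M : R) :
  (forall s, measurable_fun setT (G s)) ->
  (forall w, continuous (G ^~ w)) -> (forall s w, `|G s w| <= M) ->
  continuous (fun s => \int[P]_w G s w).
Proof.
move=> mG cG GM s; apply/(@cvg_nbhsP _ R^o) => u us.
apply: (@Rintegral_dominated_cvg _ _ _ P setT measurableT (fun n => G (u n)) (G s) (cst M)).
- by move=> n; exact: mG.
- by move=> w _; exact: (cvg_comp u (G ^~ w) us (cG w s)).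
- by apply: finite_measure_integrable_cst; rewrite ?probability_setT ?ltry.
- by move=> n w _; exact: GM.
Qed.

End expectations.

Section markov_semigroup.
Context {R : realType} {disp : measure_display} {T : measurableType disp}.
Variable P : probability T R.
Context {d : nat} {F : R -> set (set T)} {X : 'rV[R]_d -> R -> T -> 'rV[R]_d}.
Hypotheses (hF : filtration F) (hX : continuous_markov_process P F X).
Local Notation V := 'rV[R]_d.
Local Notation S := (semigroup P X).
Implicit Types (f g : V -> R) (x y : V) (s t : R).

Lemma semigroupE s g x : S s g x = \int[P]_w g (X x s w).
Proof. by rewrite /semigroup unlock. Qed.

Lemma markov_measurable x s A : 0 <= s -> borel A -> measurable (X x s @^-1` A).
Proof.
case: hF hX => _ Fm _ [Xa _ _ _ _] s0 bA; apply: (Fm s s0); exact: Xa.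
Qed.

Lemma measurable_markov g x s : borel_fun g -> 0 <= s ->
  measurable_fun setT (fun w => g (X x s w)).
Proof. by move=> bg s0; apply: measurable_comp_borel bg => A; exact: markov_measurable. Qed.

Lemma semigroup0 g x : S 0 g x = g x.
Proof.
case: hX => _ _ X0 _ _; rewrite semigroupE.
by under eq_Rintegral do rewrite X0; rewrite Rintegral_prob_cst.
Qed.

Lemma semigroup_le M g s x : borel_fun g -> 0 <= s -> (forall y, `|g y| <= M) ->
  `|S s g x| <= M.
Proof.
by move=> bg s0 gM; rewrite semigroupE; apply: le_norm_expectation => //; exact: measurable_markov.
Qed.

Lemma semigroup_lin a f g s x : bounded_borel f -> bounded_borel g -> 0 <= s ->
  S s (fun y => a * f y + g y) x = a * S s f x + S s g x.
Proof.
move=> [bf [M fM]] [bg [N gN]] s0; rewrite !semigroupE.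
have fi := integrable_bounded P (measurable_markov x bf s0) (fun w => fM _).
have gi := integrable_bounded P (measurable_markov x bg s0) (fun w => gN _).
have afi : P.-integrable setT (EFin \o (fun w => a * f (X x s w))).
  apply: (integrable_bounded P (M := `|a| * M)).
    by apply: measurable_funM => //; exact: measurable_markov.
  by move=> w; rewrite normrM ler_wpM2l.
by rewrite RintegralD// RintegralZl.
Qed.

Lemma semigroup_cst a s x : S s (fun=> a) x = a.
Proof. by rewrite semigroupE Rintegral_prob_cst. Qed.

Lemma semigroupB f g s x : bounded_borel f -> bounded_borel g -> 0 <= s ->
  S s (fun y => f y - g y) x = S s f x - S s g x.
Proof.
move=> bf bg s0; rewrite addrC -mulN1r -semigroup_lin//.
by congr (S s _ x); apply/funext => y; rewrite mulN1r addrC.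
Qed.

Lemma semigroup_dist e f g s x : bounded_borel f -> bounded_borel g -> 0 <= s ->
  (forall y, `|f y - g y| <= e) -> `|S s f x - S s g x| <= e.
Proof.
move=> bf bg s0 fg; rewrite -semigroupB//; apply: semigroup_le => //.
have := bounded_borel_lin (-1) bg bf.
by under eq_fun do rewrite mulN1r addrC; case.
Qed.

Lemma bounded_borel_semigroup g s : bounded_borel g -> 0 <= s -> bounded_borel (S s g).
Proof.
move=> bg s0; split; last first.
  by case: (bg) => b1 [M gM]; exists M => x; exact: semigroup_le.
move: g bg; apply: bounded_borel_ind => [A bA|a f g bf bg Hf Hg|f bf H].
- case: hX => _ _ _ XA _.
  suff -> : S s \1_A = (fun y => fine (P (X y s @^-1` A))) by exact: XA.
  apply/funext => y; rewrite semigroupE -Rintegral_indic_prob//.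
  exact: markov_measurable.
- have -> : S s (fun x => a * f x + g x) = (fun x => a * S s f x + S s g x).
    by apply/funext => x; rewrite semigroup_lin.
  apply/borel_funP; apply: measurable_funD; last exact/borel_funP.
  by apply: measurable_funM => //; exact/borel_funP.
- have H' n : exists g, [/\ bounded_borel g, borel_fun (S s g) &
      forall x, `|f x - g x| <= n.+1%:R^-1] by apply: H.
  have [g_ Hg] := choice H'.
  apply: (@borel_fun_cvg _ _ (fun n => S s (g_ n))); first by move=> n; have [] := Hg n.
  move=> x; apply/cvgrPdist_le => e e0.
  near=> n.
  have [bg _ fg] := Hg n.
  apply: le_trans (semigroup_dist x bf bg s0 fg) _.
  by near: n; apply: filterS (near_infty_natSinv_lt (PosNum e0)) => n /ltW.
Unshelve. all: by end_near. Qed.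

(** Chapman-Kolmogorov: the Markov property is the case of an indicator, and both
    sides are linear and respect uniform limits. *)
Lemma semigroupD g s t x : bounded_borel g -> 0 <= s -> 0 <= t ->
  S (t + s) g x = S t (S s g) x.
Proof.
move=> bg s0 t0; have ts0 := addr_ge0 t0 s0.
move: g bg; apply: bounded_borel_ind => [A bA|a f g bf bg Hf Hg|f bf H].
- case: (hX) => _ _ _ XA XM; case: (hF) => Fs _ _.
  rewrite !semigroupE.
  have Hy y u : 0 <= u -> \int[P]_w \1_A (X y u w) = fine (P (X y u @^-1` A)).
    by move=> u0; rewrite -Rintegral_indic_prob//; exact: markov_measurable.
  rewrite Hy//; under eq_Rintegral do rewrite semigroupE Hy//.
  have FT : F t setT.
    case: (Fs t t0) => F0 FC _; have := FC _ F0; by rewrite setD0.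
  have := XM x s t setT A s0 t0 FT bA; rewrite setTI => ->.
  rewrite /Rintegral; congr fine; apply: eq_integral => w _.
  by rewrite fineK// fin_num_measure//; exact: markov_measurable.
- rewrite semigroup_lin// Hf Hg.
  have -> : S s (fun x => a * f x + g x) = (fun x => a * S s f x + S s g x).
    by apply/funext => y; rewrite semigroup_lin.
  by rewrite semigroup_lin//; exact: bounded_borel_semigroup.
- apply/eqP; rewrite -subr_eq0 -normr_le0; apply/ler_addgt0Pr => e e0.
  have e20 : 0 < e / 2 by rewrite divr_gt0.
  have [g [bg Hg fg]] := H _ e20.
  have h1 := semigroup_dist x bf bg ts0 fg.
  have h2 : `|S t (S s g) x - S t (S s f) x| <= e / 2.
    apply: semigroup_dist => //; try exact: bounded_borel_semigroup.
    by move=> y; rewrite distrC; exact: semigroup_dist.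
  rewrite add0r; have := lerD h1 h2; rewrite -splitr; apply: le_trans.
  by rewrite (le_trans _ (ler_normD _ _))// Hg addrA subrK.
Qed.

(** The absolute value extends the trajectory continuously to negative times,
    where [S] carries no information. *)
Lemma continuous_semigroup f x : continuous f -> (exists M, forall y, `|f y| <= M) ->
  continuous (fun s => S `|s| f x).
Proof.
move=> cf [M fM].
have -> : (fun s => S `|s| f x) = (fun s => \int[P]_w f (X x `|s| w)).
  by apply/funext => s; rewrite semigroupE.
apply: (@continuous_expectation _ _ _ P (fun s w => f (X x `|s| w)) M) => //.
  by move=> s; apply: measurable_markov => //; exact: continuous_borel_fun.
move=> w s; apply: continuous_comp; last exact: cf.
case: hX => _ Xc _ _ _; exact: (continuous_abs_halfline (Xc x w)).
Qed.

Lemma bounded_borel_continuous f : continuous f -> bounded_fun f -> bounded_borel f.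
Proof. by move=> cf /bounded_funP fM; split => //; exact: continuous_borel_fun. Qed.

End markov_semigroup.

(** * Laplace-type integrals on the half-line *)

Section lebesgue_shift.
Context {R : realType}.
Local Notation mu := (@lebesgue_measure R).

Lemma lebesgue_measure_shift (k : R) (A : set R) : measurable A ->
  mu ((fun r : R => r + k) @^-1` A) = mu A.
Proof.
move=> mA.
have mk : @measurable_fun _ _ (measurableTypeR R) (measurableTypeR R) setT
    (fun r : R => r + k).
  by move=> mT; apply: (@measurable_funD _ R R).
pose m : {measure set (measurableTypeR R) -> \bar R} :=
  @pushforward _ _ (measurableTypeR R) (measurableTypeR R) R mu (fun r : R => r + k).
rewrite [RHS](lebesgue_measure_unique (mu := m mk))// => _ [[a b] _ <-].
rewrite /m/= /pushforward/=.
have -> : (fun r : R => r + k) @^-1` `]a, b]%classic = `]a - k, b - k]%classic.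
  by apply/seteqP; split=> r; rewrite /= !in_itv/= ltrBlDr lerBrDr.
rewrite !lebesgue_measure_itv/= !lte_fin ltrD2r; case: ifPn => //= _.
by rewrite -EFinD; congr EFin; ring.
Qed.

Lemma Rintegral_shift (k : R) (g : R -> R) : measurable_fun setT g ->
  mu.-integrable `]0, +oo[ (fun r => (g (r + k))%:E) ->
  \int[mu]_(r in `]0, +oo[) g (r + k) = \int[mu]_(r in `]k, +oo[) g r.
Proof.
move=> mg ig.
have mk : @measurable_fun _ _ (measurableTypeR R) (measurableTypeR R) setT
    (fun r : R => r + k).
  by move=> mT; apply: (@measurable_funD _ R R).
have pk : (fun r : R => r + k) @^-1` `]k, +oo[%classic = `]0, +oo[%classic.
  by apply/seteqP; split=> r; rewrite /= !in_itv/= !andbT -{1}(add0r k) ltrD2r.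
have := @integral_pushforward _ _ _ _ _ _ mk mu `]k, +oo[%classic (EFin \o g).
rewrite pk => H; rewrite /Rintegral -[in LHS]/(integral mu _ ((EFin \o g) \o (fun r => r + k))) -H//.
- congr fine; apply: eq_measure_integral => A mA _.
  exact: lebesgue_measure_shift.
- exact/measurable_EFinP.
Qed.

End lebesgue_shift.

Section laplace.
Context {R : realType}.
Local Notation mu := (@lebesgue_measure R).
Local Notation H := (`]0, +oo[%classic : set R).
Implicit Types (phi G : R -> R) (r C M k w x c : R).

(** The weights: this domination makes them integrable against every bounded
    function, and is preserved by shifts. *)
Definition exp_bounded phi : Prop :=
  continuous phi /\ exists2 C, 0 <= C & forall r, `|phi r| <= C * expR (- `|r|).

Definition laplace phi G : R := \int[mu]_(r in H) (phi r * G r).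

Definition exp_mass : R := \int[mu]_(r in H) expR (- r).

Lemma integrable_expRN : mu.-integrable H (fun r => (expR (- r))%:E).
Proof.
have : mu.-integrable H (EFin \o exponential_pdf 1).
  by apply: integrableS (@integrable_exponential_pdf R 1 ltr01).
apply: eq_integrable => // r /set_mem /=; rewrite in_itv/= andbT => r0.
by rewrite exponential_pdfE ?ltW// mul1r mulN1r.
Qed.

Lemma exp_mass_ge0 : 0 <= exp_mass.
Proof. by apply: Rintegral_ge0 => r _; exact: expR_ge0. Qed.

Lemma exp_bounded_continuous phi : exp_bounded phi -> continuous phi.
Proof. by case. Qed.

Lemma integrable_laplace phi G M : exp_bounded phi -> measurable_fun H G ->
  (forall r, 0 < r -> `|G r| <= M) ->
  mu.-integrable H (fun r => (phi r * G r)%:E).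
Proof.
move=> [cphi [C C0 phiC]] mG GM.
have ig : mu.-integrable H (fun r => ((C * M)%:E * (expR (- r))%:E)%E).
  by apply: integrableZl => //; exact: integrable_expRN.
apply: (@integrable_dominated _ _ _ mu H _ _ (fun r => C * M * expR (- r))) => //.
- apply: measurable_funM => //; apply: measurable_funTS.
  exact: continuous_measurable_fun.
- move=> r /=; rewrite in_itv/= andbT => r0.
  rewrite normrM mulrAC ler_pM//; last exact: GM.
  by rewrite (le_trans (phiC r))// gtr0_norm.
Qed.

Lemma le_laplace phi G C M : exp_bounded phi -> measurable_fun H G ->
  0 <= C -> 0 <= M ->
  (forall r, 0 < r -> `|phi r| <= C * expR (- r)) ->
  (forall r, 0 < r -> `|G r| <= M) ->
  `|laplace phi G| <= C * M * exp_mass.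
Proof.
move=> [cphi _] mG C0 M0 phiC GM.
have ig : mu.-integrable H (fun r => ((C * M)%:E * (expR (- r))%:E)%E).
  by apply: integrableZl => //; exact: integrable_expRN.
rewrite /exp_mass -RintegralZl//; last exact: integrable_expRN.
apply: le_norm_Rintegral => //.
- apply: measurable_funM => //; apply: measurable_funTS.
  exact: continuous_measurable_fun.
- move=> r /=; rewrite in_itv/= andbT => r0.
  by rewrite normrM mulrAC ler_pM//; [exact: phiC|exact: GM].
Qed.

Lemma exp_bounded_lin a phi psi : exp_bounded phi -> exp_bounded psi ->
  exp_bounded (fun r => a * phi r + psi r).
Proof.
move=> [cphi [C C0 phiC]] [cpsi [C' C'0 psiC]]; split.
  move=> r; apply: cvgD; last exact: cpsi.
  by apply: cvgM; [exact: cvg_cst|exact: cphi].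
exists (`|a| * C + C'); first by rewrite addr_ge0// mulr_ge0.
move=> r; rewrite (le_trans (ler_normD _ _))// mulrDl lerD// normrM -mulrA.
by rewrite ler_wpM2l.
Qed.

Lemma laplace_lin a phi psi G M : exp_bounded phi -> exp_bounded psi ->
  measurable_fun H G -> (forall r, 0 < r -> `|G r| <= M) ->
  laplace (fun r => a * phi r + psi r) G = a * laplace phi G + laplace psi G.
Proof.
move=> bphi bpsi mG GM.
have i1 := integrable_laplace bphi mG GM.
have i2 := integrable_laplace bpsi mG GM.
rewrite /laplace -RintegralZl// -RintegralD//.
- by apply: eq_Rintegral => r _; rewrite mulrDl mulrA.
- have : mu.-integrable H (fun r => (a%:E * (phi r * G r)%:E)%E).
    exact: integrableZl.
  by apply: eq_integrable.
Qed.

Lemma exp_bounded_scale a phi : exp_bounded phi -> exp_bounded (fun r => a * phi r).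
Proof.
move=> [cphi [C C0 phiC]]; split.
  by move=> r; apply: cvgM; [exact: cvg_cst|exact: cphi].
exists (`|a| * C) => [|r]; first exact: mulr_ge0.
by rewrite normrM -mulrA ler_wpM2l.
Qed.

Lemma laplace_scale a phi G M : exp_bounded phi ->
  measurable_fun H G -> (forall r, 0 < r -> `|G r| <= M) ->
  laplace (fun r => a * phi r) G = a * laplace phi G.
Proof.
move=> bphi mG GM; rewrite /laplace -RintegralZl//; last exact: integrable_laplace mG GM.
by apply: eq_Rintegral => r _; rewrite mulrA.
Qed.

Lemma laplace_linr a phi G G' M M' : exp_bounded phi ->
  measurable_fun H G -> (forall r, 0 < r -> `|G r| <= M) ->
  measurable_fun H G' -> (forall r, 0 < r -> `|G' r| <= M') ->
  laplace phi (fun r => a * G r + G' r) = a * laplace phi G + laplace phi G'.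
Proof.
move=> bphi mG GM mG' GM'.
have i1 := integrable_laplace bphi mG GM.
have i2 := integrable_laplace bphi mG' GM'.
rewrite /laplace -RintegralZl// -RintegralD//.
- by apply: eq_Rintegral => r _; rewrite mulrDr mulrCA.
- have : mu.-integrable H (fun r => (a%:E * (phi r * G r)%:E)%E).
    exact: integrableZl.
  by apply: eq_integrable.
Qed.

Lemma mean_value (f df : R -> R) (a b : R) : a <= b ->
  (forall x, is_derive x 1 f (df x)) ->
  exists2 c, a <= c <= b & f b - f a = df c * (b - a).
Proof.
move=> ab fdf.
have [c + ->] : exists2 c, c \in `[a, b]%R & f b - f a = df c * (b - a).
  apply: MVT_segment => //; apply: continuous_subspaceT => x.
  exact/differentiable_continuous/derivable1_diffP.
by rewrite in_itv/=; exists c.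
Qed.

(** An integration by parts in which [G] is never differentiated: the shift is
    moved from [G] onto the smooth factor [phi]. The piece of the half-line lost
    in the process produces the boundary term [phi 0 * G 0], up to the
    oscillation [w] of [G] there. *)
Lemma laplace_shift phi dphi ddphi G C M (k w : R) :
  exp_bounded phi -> exp_bounded dphi ->
  (forall r, is_derive r 1 phi (dphi r)) ->
  (forall r, is_derive r 1 dphi (ddphi r)) ->
  (forall r, `|phi r| <= C) -> (forall r, `|dphi r| <= C) ->
  (forall r, `|ddphi r| <= C * expR (- `|r|)) ->
  continuous G -> (forall r, `|G r| <= M) ->
  0 < k <= 1 -> (forall r, 0 <= r <= k -> `|G r - G 0| <= w) ->
  `|(laplace phi (fun r => G (r + k)) - laplace phi G) / k
    + (phi 0 * G 0 + laplace dphi G)| <=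
  (C * expR 1 * M * exp_mass + C * M) * k + C * w.
Proof.
move=> bphi bdphi dp ddp pC dpC ddpC cG GM /andP[k0 k1] Gw.
have C0 : 0 <= C by exact: le_trans (normr_ge0 _) (pC 0).
have M0 : 0 <= M by exact: le_trans (normr_ge0 _) (GM 0).
have cphi := exp_bounded_continuous bphi.
have mG : measurable_fun setT G by exact: continuous_measurable_fun.
have mGH : measurable_fun H G by exact: measurable_funTS.
have cphik : continuous (fun r => phi (r - k)).
  move=> r; apply: continuous_comp; last exact: cphi.
  by apply: continuousB; [exact: cvg_id|exact: cvg_cst].
have bphik : exp_bounded (fun r => phi (r - k)).
  split=> //; have [_ [C' C'0 pC']] := bphi; exists (C' * expR 1); first by rewrite mulr_ge0// expR_ge0.
  move=> r; rewrite (le_trans (pC' _))// -mulrA ler_wpM2l// -expRD ler_expR.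
  have : `|r| <= `|r - k| + `|k| by rewrite -{1}(subrK k r) ler_normD.
  by rewrite (gtr0_norm k0); lra.
have iG := integrable_laplace bphik mGH (fun r _ => GM r).
have mg : measurable_fun setT (fun r => phi (r - k) * G r).
  by apply: measurable_funM => //; exact: continuous_measurable_fun.
have mGk : measurable_fun setT (fun r => G (r + k)).
  apply: continuous_measurable_fun => r; apply: continuous_comp; last exact: cG.
  by apply: continuousD; [exact: cvg_id|exact: cvg_cst].
have E1 : laplace phi (fun r => G (r + k)) =
    \int[mu]_(r in `]k, +oo[) (phi (r - k) * G r).
  rewrite -Rintegral_shift//.
    by apply: eq_Rintegral => r _; rewrite addrK.
  under [X in mu.-integrable _ X]eq_fun do rewrite addrK.
  by apply: (integrable_laplace (M := M)) => //; exact: measurable_funTS.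
have E2 : laplace phi (fun r => G (r + k)) =
    laplace (fun r => phi (r - k)) G - \int[mu]_(r in `]0, k]) (phi (r - k) * G r).
  rewrite E1 /laplace.
  have U : H = `]0, k]%classic `|` `]k, +oo[%classic.
    by rewrite -itv_bndbnd_setU// bnd_simp ltW.
  rewrite [in X in _ = X - _]U Rintegral_setU//; first by rewrite addrC addKr.
    by rewrite -U.
  apply/disj_setPS => r [/=]; rewrite !in_itv/= andbT => /andP[_ rk] kr.
  by have := le_lt_trans rk kr; rewrite ltxx.
(* On the layer [0, k] both factors are close to their values at [0]. *)
have T2 : `|(\int[mu]_(r in `]0, k]) (phi (r - k) * G r)) / k - phi 0 * G 0| <= C * M * k + C * w.
  have mI : mu `]0, k] = k%:E by rewrite lebesgue_measure_itv/= lte_fin k0 oppr0 adde0.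
  have icst (c : R) : mu.-integrable `]0, k] (fun=> c%:E).
    apply: measurable_bounded_integrable => //; first by suff : (mu `]0%R, k] < +oo)%E by []; rewrite mI ltry.
    by exists `|c|; split; [exact: num_real|move=> x cx r _; exact: ltW].
  have cstE (c : R) : \int[mu]_(r in `]0, k]) c = c * k.
    by rewrite /Rintegral integral_cst//= mI.
  have ig : mu.-integrable `]0, k] (fun r => (phi (r - k) * G r)%:E).
    apply: integrableS iG => //.
    by apply: subset_itvl; rewrite bnd_simp.
  have -> : (\int[mu]_(r in `]0, k]) (phi (r - k) * G r)) / k - phi 0 * G 0 =
      (\int[mu]_(r in `]0, k]) (phi (r - k) * G r - phi 0 * G 0)) / k.
    have -> : \int[mu]_(r in `]0, k]) (phi (r - k) * G r - phi 0 * G 0) =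
        \int[mu]_(r in `]0, k]) (phi (r - k) * G r) - phi 0 * G 0 * k.
      by rewrite -cstE RintegralB//; exact: icst.
    by field; rewrite gt_eqF.
  rewrite normrM normfV (gtr0_norm k0) ler_pdivrMr//.
  rewrite -[leRHS]cstE.
  apply: le_norm_Rintegral => //.
    by apply: measurable_funTS; apply: measurable_funB.
    exact: icst.
  move=> r /=; rewrite in_itv/= => /andP[r0 rk].
  have -> : phi (r - k) * G r - phi 0 * G 0 =
      (phi (r - k) - phi 0) * G r + phi 0 * (G r - G 0) by ring.
  rewrite (le_trans (ler_normD _ _))// !normrM lerD//; last first.
    by rewrite ler_pM// Gw// (ltW r0) rk.
  have rk0 : r - k <= 0 by lra.
  have [c _ E] := mean_value rk0 dp.
  have -> : C * M * k = C * k * M by ring.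
  rewrite ler_pM// distrC E normrM ler_pM// ler_norml; apply/andP; split; lra.
(* Elsewhere the difference quotient of [phi] is compared with its derivative. *)
pose q r := k^-1 * phi (r - k) + (- k^-1 * phi r + dphi r).
have bq1 := exp_bounded_lin (- k^-1) bphi bdphi.
have bq : exp_bounded q := exp_bounded_lin k^-1 bphik bq1.
have T1 : `|laplace q G| <= C * expR 1 * k * M * exp_mass.
  apply: le_laplace => //; first by rewrite !mulr_ge0// ?expR_ge0 ?ltW.
  move=> r r0.
  have [c /andP[c1 c2] Ec] : exists2 c, r - k <= c <= r & phi r - phi (r - k) = dphi c * (r - (r - k)).
    by apply: mean_value => //; lra.
  have [c' /andP[c'1 c'2] Ec'] := mean_value c2 ddp.
  have -> : q r = ddphi c' * (r - c).
    rewrite -Ec' /q -[dphi c](mulfK (lt0r_neq0 k0)).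
    have -> : dphi c * k = phi r - phi (r - k) by rewrite Ec; ring.
    by field; rewrite gt_eqF.
  have -> : C * expR 1 * k * expR (- r) = C * expR (1 - r) * k by rewrite expRD; ring.
  rewrite normrM ler_pM//; last by rewrite ger0_norm; lra.
  rewrite (le_trans (ddpC _))// ler_wpM2l// ler_expR.
  have : c' <= `|c'| by exact: ler_norm.
  lra.
have L : laplace q G =
    laplace dphi G + k^-1 * (laplace (fun r => phi (r - k)) G - laplace phi G).
  rewrite /q (laplace_lin _ bphik bq1 mGH (fun r _ => GM r)).
  by rewrite (laplace_lin _ bphi bdphi mGH (fun r _ => GM r)); ring.
have -> : (laplace phi (fun r => G (r + k)) - laplace phi G) / k
    + (phi 0 * G 0 + laplace dphi G) =
  laplace q G -
  ((\int[mu]_(r in `]0, k]) (phi (r - k) * G r)) / k - phi 0 * G 0).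
  by rewrite L E2; ring.
apply: le_trans (ler_normB _ _) _; apply: le_trans (lerD T1 T2) _.
by rewrite le_eqVlt; apply/orP; left; apply/eqP; ring.
Qed.

End laplace.

(** * Laplace averages of the semigroup and the generator *)

Section generator_theory.
Context {R : realType} {disp : measure_display} {T : measurableType disp}.
Variable P : probability T R.
Context {d : nat} {F : R -> set (set T)} {X : 'rV[R]_d -> R -> T -> 'rV[R]_d}.
Hypotheses (hF : filtration F) (hX : continuous_markov_process P F X).
Local Notation V := 'rV[R]_d.
Local Notation S := (semigroup P X).
Local Notation mu := (@lebesgue_measure R).
Local Notation H := (`]0, +oo[%classic : set R).
Implicit Types (f g : V -> R) (x y : V) (s t r h : R) (phi : R -> R).

(** The domain together with the value of the generator, which its definition as
    a limit does not exhibit. *)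
Definition has_generator f g : Prop :=
  forall e : R, 0 < e -> \forall h \near 0^'+, forall x,
    `|(S h f x - f x) / h - g x| < e.

Lemma has_generator_domain f g : bounded_borel f -> has_generator f g ->
  in_domain S f.
Proof.
by move=> [bf fM] fg; split => //; [exact/bounded_funP|exists g].
Qed.

Lemma has_generatorE f g : has_generator f g -> generator S f = g.
Proof.
move=> fg; apply/funext => x; apply: cvg_lim => //.
apply/cvgrPdist_lt => e e0; near=> h; rewrite distrC.
suff : forall y, `|(S h f y - f y) / h - g y| < e by apply.
by near: h; exact: fg.
Unshelve. all: by end_near. Qed.

Lemma in_domain_has_generator f : in_domain S f -> has_generator f (generator S f).
Proof. by move=> [_ _ [g fg]]; rewrite (has_generatorE fg). Qed.

Lemma has_generator_lin a f g f' g' : bounded_borel f -> bounded_borel f' ->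
  has_generator f g -> has_generator f' g' ->
  has_generator (fun x => a * f x + f' x) (fun x => a * g x + g' x).
Proof.
move=> bf bf' fg fg' e e0.
have a0 : 0 < `|a| + 1 by rewrite ltr_wpDl.
have e1 : 0 < e / 2 / (`|a| + 1) by rewrite !divr_gt0.
have e2 : 0 < e / 2 by rewrite divr_gt0.
near=> h => x.
have h0 : 0 < h by near: h; exact: nbhs_right_gt.
rewrite (semigroup_lin hF hX)// ?ltW//.
have -> : (a * S h f x + S h f' x - (a * f x + f' x)) / h - (a * g x + g' x) =
  a * ((S h f x - f x) / h - g x) + ((S h f' x - f' x) / h - g' x) by ring.
rewrite (le_lt_trans (ler_normD _ _))// [ltRHS](splitr e) ler_ltD//.
  rewrite normrM.
  have : `|(S h f x - f x) / h - g x| <= e / 2 / (`|a| + 1).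
    apply: ltW; move: x; near: h; exact: fg.
  move=> /(ler_wpM2l (normr_ge0 a)) /le_trans; apply.
  rewrite mulrCA ler_piMr ?ltW// ltr_pdivrMr// mul1r ltrDl//.
by move: x; near: h; exact: fg'.
Unshelve. all: by end_near. Qed.

Lemma has_generator_scale a f g : bounded_borel f -> has_generator f g ->
  has_generator (fun x => a * f x) (fun x => a * g x).
Proof.
move=> bf fg.
have z : has_generator (fun=> 0) (fun=> 0).
  move=> e e0; apply: nearW => h x; rewrite semigroup_cst subrr mul0r subrr normr0//.
have := has_generator_lin a bf bounded_borel0 fg z.
by under eq_fun do rewrite addr0; under [X in has_generator _ X]eq_fun do rewrite addr0.
Qed.

(** For short times the difference quotients are close to a bounded function, for
    long times the difference is bounded. *)
Lemma semigroup_lipschitz f : in_domain S f ->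
  exists2 L : R, 0 <= L & forall s x, 0 <= s -> `|S s f x - f x| <= L * s.
Proof.
move=> df; have := in_domain_has_generator df.
case: df => bf /bounded_funP fM _; have [M fMM] := fM.
set g := generator S f => fg.
have M0 : 0 <= M by exact: le_trans (normr_ge0 _) (fMM 0).
have [e /= e0 He] := fg 1 ltr01.
have He' h x : 0 < h -> h < e -> `|(S h f x - f x) / h - g x| < 1.
  move=> h0 he; apply: He => //=; rewrite sub0r normrN gtr0_norm//.
have e20 : 0 < e / 2 by rewrite divr_gt0.
have SM s x : 0 <= s -> `|S s f x - f x| <= 2 * M.
  move=> s0; rewrite mulr_natl mulr2n (le_trans (ler_normB _ _))// lerD//.
  by apply: (semigroup_le hF hX).
have gM x : `|g x| <= 2 * M / (e / 2) + 1.
  have := He' (e / 2) x e20; rewrite ltr_pdivrMr// ltr_pMr// ltr1n => /(_ isT) h1.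
  have h2 : `|(S (e / 2) f x - f x) / (e / 2)| <= 2 * M / (e / 2).
    by rewrite normrM (gtr0_norm (x := (e / 2)^-1)) ?invr_gt0// ler_pM2r ?invr_gt0// SM// ltW.
  have -> : g x = (S (e / 2) f x - f x) / (e / 2) - ((S (e / 2) f x - f x) / (e / 2) - g x) by ring.
  by rewrite (le_trans (ler_normB _ _))// lerD// ltW.
exists (2 * M / (e / 2) + 2); first by rewrite addr_ge0// divr_ge0 ?mulr_ge0// ltW.
move=> s x; rewrite le_eqVlt => /predU1P[<-|s0].
  by rewrite (semigroup0 hX) subrr normr0 mulr0.
have [se|es] := ltP s e.
  have h1 := ltW (He' s x s0 se).
  have h2 : `|(S s f x - f x) / s| <= 2 * M / (e / 2) + 2.
    have -> : (S s f x - f x) / s = ((S s f x - f x) / s - g x) + g x by ring.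
    rewrite (le_trans (ler_normD _ _))//; have := lerD h1 (gM x); lra.
  by move: h2; rewrite normrM normfV (gtr0_norm s0) ler_pdivrMr.
rewrite (le_trans (SM s x (ltW s0)))//.
have : 2 * M <= 2 * M / (e / 2) * s.
  rewrite mulrAC ler_pdivlMr// ler_wpM2l ?mulr_ge0// (le_trans _ es)//.
  lra.
by move/le_trans; apply; apply: ler_wpM2r; [exact: ltW|rewrite lerDl].
Qed.

Lemma semigroup_sum n (c : nat -> R) (g : nat -> V -> R) h : 0 <= h ->
  (forall k, bounded_borel (g k)) ->
  bounded_borel (fun y => \sum_(k < n) (c k * g k y)) /\
  forall x, S h (fun y => \sum_(k < n) (c k * g k y)) x =
    \sum_(k < n) (c k * S h (g k) x).
Proof.
move=> h0 bg; elim: n => [|n [IH1 IH2]].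
  split; first by under eq_fun do rewrite big_ord0; exact: bounded_borel0.
  by move=> x; under eq_fun do rewrite big_ord0; rewrite semigroup_cst big_ord0.
have E : (fun y => \sum_(k < n.+1) (c k * g k y)) =
    (fun y => c n * g n y + \sum_(k < n) (c k * g k y)).
  by apply/funext => y; rewrite big_ord_recr addrC.
rewrite E; split; first exact: bounded_borel_lin.
by move=> x; rewrite (semigroup_lin hF hX)// IH2 big_ord_recr addrC.
Qed.

Variables (f : V -> R) (eps : R).
Hypotheses (cf : continuous f) (fb : bounded_fun f) (eps0 : 0 < eps).

Definition average phi x : R := laplace phi (fun r => S `|eps * r| f x).

Let bf : bounded_borel f := bounded_borel_continuous cf fb.

Let cS h x : continuous (fun r => S `|eps * r + h| f x).
Proof.
have /bounded_funP fM := fb.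
move=> r; apply: (@continuous_comp _ _ _ (fun r => eps * r + h) (fun s => S `|s| f x)).
  by apply: cvgD; [apply: cvgM; [exact: cvg_cst|exact: cvg_id]|exact: cvg_cst].
exact: (continuous_semigroup hF hX).
Qed.

Lemma continuous_average_time x : continuous (fun r => S `|eps * r| f x).
Proof. by have := @cS 0 x; under eq_fun do rewrite addr0. Qed.

Lemma average_time_le M x r : (forall y, `|f y| <= M) -> `|S `|eps * r| f x| <= M.
Proof. by move=> fM; apply: (semigroup_le hF hX) => //; case: bf. Qed.

Let weight phi m k : R := \int[mu]_(r in H) ((grid_index m r == k)%:R * phi r).

Let average_step phi h x M : exp_bounded phi -> (forall y, `|f y| <= M) ->
  let v m := \sum_(k < m.+1 ^ 2) (weight phi m k * S `|eps * grid_point m k + h| f x) in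
  v m @[m --> \oo] --> laplace phi (fun r => S `|eps * r + h| f x) /\
  forall m, `|v m| <= \int[mu]_(r in H) (`|phi r| * M).
Proof.
move=> bphi fM v.
have mphi : measurable_fun H phi.
  apply: measurable_funTS; apply: continuous_measurable_fun; exact: exp_bounded_continuous.
have iphi : mu.-integrable H (EFin \o phi).
  have : mu.-integrable H (fun r => (phi r * 1)%:E).
    by apply: (integrable_laplace (M := 1)) => // r _; rewrite normr1.
  by apply: eq_integrable => // r _; rewrite /= mulr1.
have H0 r : H r -> 0 <= r by rewrite /= in_itv/= andbT => /ltW.
have mid : measurable_fun H (id : R -> R) by exact: measurable_id.
pose G s r := phi r * S `|eps * s + h| f x.
have mG s : 0 <= s -> measurable_fun H (G s) by move=> _; apply: measurable_funM.
have cG r : H r -> continuous (G ^~ r).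
  by move=> _ s; apply: cvgM; [exact: cvg_cst|exact: cS].
have ig : mu.-integrable H (EFin \o (fun r => `|phi r| * M)).
  by have := integrableZr _ M (integrable_norm iphi); apply.
have Gg s r : 0 <= s -> H r -> `|G s r| <= `|phi r| * M.
  move=> s0 _; rewrite normrM ler_wpM2l//.
  by apply: (semigroup_le hF hX) => //; case: bf.
have vE m : v m = \sum_(k < m.+1 ^ 2) \int[mu]_(w in H)
    ((grid_index m w == k)%:R * G (grid_point m k) w).
  apply: eq_bigr => k _; rewrite /weight -RintegralZr//.
    by apply: eq_Rintegral => r _; rewrite /G mulrA.
  apply: (@integrable_dominated _ _ _ mu H _ _ (fun r => `|phi r|)) => //.
  - by apply: measurable_funM => //; exact: measurable_grid_index.
  - exact: integrable_norm.
  - by move=> r _; case: eqP => _; rewrite ?mul1r// mul0r normr0.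
split.
  under eq_fun do rewrite vE.
  by apply: (@Rintegral_random_time R _ _ mu H id G _ mid H0 mG cG _ ig Gg).
move=> m; rewrite vE.
by apply: (@le_Rintegral_random_time R _ _ mu H id G _ mid H0 mG _ ig Gg).
Qed.

Lemma bounded_borel_average phi : exp_bounded phi -> bounded_borel (average phi).
Proof.
move=> bphi; have /bounded_funP[M fM] := fb; split.
  pose v m x := \sum_(k < m.+1 ^ 2) (weight phi m k * S `|eps * grid_point m k| f x).
  apply: (@borel_fun_cvg _ _ v).
    move=> m; apply: (semigroup_sum (m.+1 ^ 2) (weight phi m)
      (g := fun k => S `|eps * grid_point m k| f) (lexx 0) _).1.1 => k.
    exact: (bounded_borel_semigroup hF hX).
  move=> x; have [+ _] := average_step 0 x bphi fM; rewrite /average /v.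
  have E r : S `|eps * r + 0| f x = S `|eps * r| f x by rewrite addr0.
  by under eq_fun do under eq_bigr do rewrite E; under [fun r => S _ _ _]eq_fun do rewrite E.
have M0 : 0 <= M by exact: le_trans (normr_ge0 _) (fM 0).
have [_ [C C0 phiC]] := bphi.
exists (C * M * exp_mass) => x; apply: le_laplace => //.
- apply: measurable_funTS; apply: continuous_measurable_fun; exact: continuous_average_time.
- by move=> r r0; rewrite (le_trans (phiC r))// gtr0_norm.
- by move=> r _; exact: average_time_le.
Qed.

(** The semigroup passes under the integral because the average is a bounded
    limit of finite combinations of the [S s f]. *)
Lemma semigroup_average phi h x : exp_bounded phi -> 0 <= h ->
  S h (average phi) x = laplace phi (fun r => S `|eps * r + h| f x).
Proof.
move=> bphi h0.
have /bounded_funP[M fM] := fb.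
have M0 : 0 <= M by exact: le_trans (normr_ge0 _) (fM 0).
pose v m x := \sum_(k < m.+1 ^ 2) (weight phi m k * S `|eps * grid_point m k| f x).
have bS m k : bounded_borel (S `|eps * grid_point m k| f).
  exact: (bounded_borel_semigroup hF hX).
have hv m := semigroup_sum (m.+1 ^ 2) (weight phi m) h0 (bS m).
have vS m y : S h (v m) y =
    \sum_(k < m.+1 ^ 2) (weight phi m k * S `|eps * grid_point m k + h| f y).
  rewrite (hv m).2; apply: eq_bigr => k _; rewrite -(semigroupD hF hX)//.
  have p0 : 0 <= eps * grid_point m k by rewrite mulr_ge0 ?(ltW eps0)// grid_point_ge0.
  by rewrite (ger0_norm p0) addrC ger0_norm// addr_ge0.
have E r y : S `|eps * r + 0| f y = S `|eps * r| f y by rewrite addr0.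
have cv y : v m y @[m --> \oo] --> average phi y.
  have [+ _] := average_step 0 y bphi fM; rewrite /average /v.
  by under eq_fun do under eq_bigr do rewrite E; under [fun r => S _ _ _]eq_fun do rewrite E.
have vM m y : `|v m y| <= \int[mu]_(r in H) (`|phi r| * M).
  have [_ /(_ m)] := average_step 0 y bphi fM.
  by under eq_bigr do rewrite E.
have c1 : S h (v m) x @[m --> \oo] --> S h (average phi) x.
  under eq_fun do rewrite semigroupE; rewrite semigroupE.
  apply: (@Rintegral_dominated_cvg _ _ _ P setT measurableT _ _
    (cst (\int[mu]_(r in H) (`|phi r| * M)))).
  - by move=> m; apply: (measurable_markov hF hX) => //; case: (hv m) => -[].
  - by move=> w _; exact: cv.
  - by apply: finite_measure_integrable_cst; rewrite ?probability_setT ?ltry.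
  - by move=> m w _; exact: vM.
have [c2 _] := average_step h x bphi fM.
apply: (cvg_unique _ c1) => //=.
by under eq_fun do rewrite vS.
Qed.

(** [S h] shifts the time parameter of the average by [h / eps], so the difference
    quotient is that of [laplace_shift]. The function [f] is only involved through
    its Lipschitz estimate at time [0], which makes the convergence uniform. *)
Lemma has_generator_average phi dphi ddphi :
  exp_bounded phi -> exp_bounded dphi -> exp_bounded ddphi ->
  (forall r, is_derive r 1 phi (dphi r)) ->
  (forall r, is_derive r 1 dphi (ddphi r)) ->
  in_domain S f ->
  has_generator (average phi)
    (fun x => - eps^-1 * (phi 0 * f x + average dphi x)).
Proof.
move=> bphi bdphi bddphi dp ddp /semigroup_lipschitz[L L0 fL] e e0.
have /bounded_funP[M fM] := fb.
have M0 : 0 <= M by exact: le_trans (normr_ge0 _) (fM 0).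
have [_ [C1 C10 h1]] := bphi; have [_ [C2 C20 h2]] := bdphi; have [_ [C3 C30 h3]] := bddphi.
pose C := C1 + C2 + C3.
have C0 : 0 <= C by rewrite /C !addr_ge0.
have e1 r : expR (- `|r|) <= 1 by rewrite -[leRHS]expR0 ler_expR oppr_le0.
have pC r : `|phi r| <= C.
  by rewrite (le_trans (h1 r))// (le_trans (ler_wpM2l C10 (e1 r)))// /C mulr1 -addrA lerDl addr_ge0.
have dpC r : `|dphi r| <= C.
  rewrite (le_trans (h2 r))// (le_trans (ler_wpM2l C20 (e1 r)))// /C mulr1.
  by rewrite addrAC lerDr addr_ge0.
have ddpC r : `|ddphi r| <= C * expR (- `|r|).
  by rewrite (le_trans (h3 r))// ler_wpM2r ?expR_ge0// /C lerDr addr_ge0.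
pose K := (C * expR 1 * M * exp_mass + C * M + C * (L * eps)) / eps.
have K0 : 0 <= K.
  have em := @exp_mass_ge0 R.
  by rewrite /K divr_ge0 ?(ltW eps0)// !addr_ge0// !mulr_ge0// ?expR_ge0// ltW.
have K1 : 0 < K + 1 by rewrite ltr_wpDl.
near=> h => x.
have h0 : 0 < h by near: h; exact: nbhs_right_gt.
have heps : h <= eps by apply: ltW; near: h; exact: nbhs_right_lt.
have hK : h < e * eps / (K + 1) by near: h; apply: nbhs_right_lt; rewrite divr_gt0// mulr_gt0.
pose k := h / eps.
have kh : h = k * eps by rewrite /k divfK// gt_eqF.
have k0 : 0 < k by rewrite divr_gt0.
have k1 : k <= 1 by rewrite ler_pdivrMr// mul1r.
rewrite semigroup_average ?(ltW h0)//.
have -> : (fun r => S `|eps * r + h| f x) = (fun r => S `|eps * (r + k)| f x).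
  by apply/funext => r; congr (S `|_| f x); rewrite kh; ring.
have Gw r : 0 <= r <= k -> `|S `|eps * r| f x - S `|eps * 0| f x| <= L * (eps * k).
  move=> /andP[r0 rk]; rewrite mulr0 normr0 (semigroup0 hX) (le_trans (fL _ _ _))//.
  by rewrite ler_wpM2l// ger0_norm ?mulr_ge0 ?(ltW eps0)// ler_wpM2l// ltW.
have kk : 0 < k <= 1 by rewrite k0 k1.
have := laplace_shift (G := fun r => S `|eps * r| f x) bphi bdphi dp ddp pC dpC ddpC
  (continuous_average_time (x := x)) (fun r => average_time_le x r fM) kk Gw.
rewrite mulr0 normr0 (semigroup0 hX) -/(average phi x) -/(average dphi x).
set A := laplace phi _ => HA.
have -> : (A - average phi x) / h - - eps^-1 * (phi 0 * f x + average dphi x) =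
    eps^-1 * ((A - average phi x) / k + (phi 0 * f x + average dphi x)).
  by rewrite kh; field; rewrite !gt_eqF.
rewrite normrM gtr0_norm ?invr_gt0//.
apply: (@le_lt_trans _ _ (K * k)).
  have -> : K * k = eps^-1 * ((C * expR 1 * M * exp_mass + C * M) * k + C * (L * (eps * k))).
    by rewrite /K; field; rewrite gt_eqF.
  by rewrite ler_pM2l ?invr_gt0.
apply: (@le_lt_trans _ _ ((K + 1) * k)); first by rewrite ler_pM2r// lerDl.
rewrite /k mulrA ltr_pdivrMr// mulrC -ltr_pdivlMr//.
Unshelve. all: by end_near. Qed.

End generator_theory.

(** * Gaussian weights *)

Section derivative_criterion.
Context {R : realType} {V : normedModType R}.
Implicit Types (g : V -> R) (x v : V).

Lemma is_derive_dist g x v l :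
  (forall e : R, 0 < e -> exists2 delta : R, 0 < delta &
    forall k, `|k| < delta -> `|g (x + k *: v) - g x - k * l| <= e * `|k|) ->
  is_derive x v g l.
Proof.
move=> H.
have cv : h^-1 *: (g (h *: v + x) - g x) @[h --> 0^'] --> l.
  apply/cvgrPdist_le => e e0; have [delta d0 Hd] := H e e0; near=> h.
  have h0 : h != 0 by near: h; exact: nbhs_dnbhs_neq.
  have hd : `|h| < delta by near: h; apply: dnbhs0_lt.
  have -> : l - h^-1 *: (g (h *: v + x) - g x) = - h^-1 * (g (x + h *: v) - g x - h * l).
    rewrite /GRing.scale/= (addrC x); field => //.
  by rewrite normrM normrN normfV mulrC ler_pdivrMr ?normr_gt0//; exact: Hd.
have dv : derivable g x v by apply/cvg_ex; exists l.
by apply: DeriveDef => //; apply: cvg_lim.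
Unshelve. all: by end_near. Qed.

End derivative_criterion.

Section gaussian_weights.
Context {R : realType}.
Implicit Types (a b c r k : R) (p q : {poly R}).

(** The derivatives of [exp(-a r - b r^2)] in [r], and the derivative in [b],
    are polynomial multiples of it. *)
Definition gauss_weight a b q r : R := q.[r] * expR (- (a * r) - b * r ^+ 2).

Definition dgauss a b q : {poly R} := q^`() - (a%:P + (2 * b) *: 'X) * q.

Lemma is_derive_gauss_weight a b q r :
  is_derive r 1 (gauss_weight a b q) (gauss_weight a b (dgauss a b q) r).
Proof.
have H : is_derive r 1 (fun r => - (a * r) - b * r ^+ 2) (- a - 2 * b * r).
  have -> : (fun r => - (a * r) - b * r ^+ 2) = horner (- (a *: 'X) - b *: 'X^2).
    by apply/funext => z; rewrite !(hornerD, hornerN, hornerM, hornerZ, hornerX, hornerC, hornerXn).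
  suff -> : - a - 2 * b * r = (- (a *: 'X) - b *: 'X^2)^`().[r] by exact: is_derive_poly.
  rewrite !(poly.derivE, hornerE) /=; ring.
have D := is_deriveM (is_derive_poly q r)
  (@is_derive1_comp _ expR (fun r => - (a * r) - b * r ^+ 2) r _ _ (is_derive_expR _) H).
have -> : gauss_weight a b (dgauss a b q) r =
  q.[r] * (expR (- (a * r) - b * r ^+ 2) * (- a - 2 * b * r)) +
  expR (- (a * r) - b * r ^+ 2) * q^`().[r]; last exact: D.
rewrite /gauss_weight /dgauss !(hornerD, hornerN, hornerM, hornerZ, hornerX, hornerC, hornerXn); ring.
Qed.

Lemma continuous_gauss_weight a b q : continuous (gauss_weight a b q).
Proof.
move=> r; apply/differentiable_continuous/derivable1_diffP.
by have [] := is_derive_gauss_weight a b q r.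
Qed.

Lemma poly_subexponential q (delta : R) : 0 < delta ->
  exists2 C, 0 <= C & forall r, `|q.[r]| <= C * expR (delta * `|r|).
Proof.
elim/poly_ind: q delta => [|q c IH] delta d0.
  by exists 0 => // r; rewrite horner0 normr0 mul0r.
have d20 : 0 < delta / 2 by rewrite divr_gt0.
have [C C0 HC] := IH _ d20.
exists (C * (2 / delta) + `|c|) => [|r].
  by rewrite addr_ge0// mulr_ge0// divr_ge0// ltW.
rewrite hornerMXaddC (le_trans (ler_normD _ _))// mulrDl lerD//; last first.
  by rewrite ler_peMr// -[leLHS]expR0 ler_expR mulr_ge0// ltW.
rewrite normrM.
have -> : expR (delta * `|r|) = expR (delta / 2 * `|r|) * expR (delta / 2 * `|r|).
  by rewrite -expRD; congr expR; field.
rewrite [leRHS](_ : _ =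
  (C * expR (delta / 2 * `|r|)) * (2 / delta * expR (delta / 2 * `|r|))); last by ring.
rewrite ler_pM//.
have e1 := expR_ge1Dx (delta / 2 * `|r|).
have {1}-> : `|r| = 2 / delta * (delta / 2 * `|r|) by field; rewrite gt_eqF.
by rewrite ler_wpM2l ?divr_ge0 ?(ltW d0)// (le_trans _ e1)// lerDr.
Qed.

(** Uniformity in [b'] permits differentiation in [b] under the integral. *)
Lemma gauss_weight_le a b q : 0 < b ->
  exists2 C, 0 <= C & forall b' r, b <= b' ->
    `|gauss_weight a b' q r| <= C * expR (- `|r|).
Proof.
move=> b0; have [C C0 HC] := poly_subexponential q ltr01.
exists (C * expR ((`|a| + 2) ^+ 2 / (4 * b))) => [|b' r bb']; first by rewrite mulr_ge0// expR_ge0.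
rewrite /gauss_weight normrM (le_trans (ler_pM _ _ (HC r) (lexx _)))//.
rewrite ger0_norm ?expR_ge0// -!mulrA ler_wpM2l// -!expRD ler_expR mul1r.
have h1 : b * `|r| ^+ 2 <= b' * r ^+ 2 by rewrite real_normK ?num_real// ler_wpM2r// sqr_ge0.
have h2 : - (a * r) <= `|a| * `|r| by rewrite -normrM (le_trans (ler_norm _))// normrN.
have h3 : 0 <= b * (`|r| - (`|a| + 2) / (2 * b)) ^+ 2 by rewrite mulr_ge0 ?sqr_ge0// ltW.
have h4 : b * (`|r| - (`|a| + 2) / (2 * b)) ^+ 2 =
   b * `|r| ^+ 2 - (`|a| + 2) * `|r| + (`|a| + 2) ^+ 2 / (4 * b) by field; rewrite gt_eqF.
rewrite h4 in h3; lra.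
Qed.

Lemma exp_bounded_gauss a b q : 0 < b -> exp_bounded (gauss_weight a b q).
Proof.
move=> b0; split; first exact: continuous_gauss_weight.
by have [C C0 HC] := gauss_weight_le a q b0; exists C => // r; exact: HC.
Qed.

Lemma mean_value_dist (f df : R -> R) (x y : R) :
  (forall z : R, is_derive z 1 f (df z)) ->
  exists2 c, `|c - x| <= `|y - x| & f y - f x = df c * (y - x).
Proof.
move=> fdf; have [xy|yx] := leP x y.
  have [c /andP[xc cy] E] := mean_value xy fdf; exists c => //.
  by rewrite !ger0_norm ?subr_ge0// lerD2r.
have [c /andP[yc cx] E] := mean_value (ltW yx) fdf; exists c.
  rewrite ler0_norm ?subr_le0// ler0_norm ?subr_le0 ?(ltW yx)//; lra.
by rewrite -opprB E; ring.
Qed.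

Lemma taylor2 (f df ddf : R -> R) (x y M : R) :
  (forall z : R, is_derive z 1 f (df z)) ->
  (forall z : R, is_derive z 1 df (ddf z)) ->
  (forall z, `|z - x| <= `|y - x| -> `|ddf z| <= M) ->
  `|f y - f x - df x * (y - x)| <= M * (y - x) ^+ 2.
Proof.
move=> fdf dfddf ddfM.
have [c cx E] := mean_value_dist x y fdf.
have [c' c'x E'] := mean_value_dist x c dfddf.
have -> : f y - f x - df x * (y - x) = ddf c' * (c - x) * (y - x) by rewrite E -E'; ring.
rewrite !normrM -(@real_normK _ (y - x)) ?num_real// expr2 mulrA ler_wpM2r//.
by rewrite ler_pM// ddfM// (le_trans c'x).
Qed.

Lemma is_derive_quadratic (f : R -> R) (x l C delta : R) : 0 < delta ->
  (forall k, `|k| <= delta -> `|f (x + k) - f x - k * l| <= C * k ^+ 2) ->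
  is_derive x 1 f l.
Proof.
move=> d0 H; apply: is_derive_dist => e e0.
have C1 : 0 < `|C| + 1 by rewrite ltr_wpDl.
exists (Num.min delta (e / (`|C| + 1))) => [|k]; first by rewrite lt_min d0 divr_gt0.
rewrite lt_min => /andP[kd ke]; rewrite [k *: 1]mulr1.
apply: le_trans (H k (ltW kd)) _; rewrite -(real_normK (num_real k)) expr2 mulrA ler_wpM2r//.
apply: le_trans (ler_wpM2r (normr_ge0 k) (ler_norm C)) _.
rewrite ltr_pdivlMr// mulrDr mulr1 in ke.
by rewrite mulrC (le_trans _ (ltW ke))// lerDl.
Qed.

(** Differentiation under the integral sign: the second derivative in [b] has
    weight ['X^4], which is dominated uniformly on [[b / 2, +oo[]. *)
Lemma is_derive_laplace_gauss a b (G : R -> R) (M : R) : 0 < b ->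
  continuous G -> (forall r, `|G r| <= M) ->
  is_derive b 1 (fun b => laplace (gauss_weight a b 1) G)
    (- laplace (gauss_weight a b 'X^2) G).
Proof.
move=> b0 cG GM; have b20 : 0 < b / 2 by rewrite divr_gt0.
have M0 : 0 <= M by exact: le_trans (normr_ge0 _) (GM 0).
have [C C0 HC] := gauss_weight_le a 'X^4 b20.
have mG : measurable_fun (`]0, +oo[%classic : set R) G.
  by apply: measurable_funTS; exact: continuous_measurable_fun.
apply: (@is_derive_quadratic _ b _ (C * M * @exp_mass R) (b / 2)) => // k kb.
have kb' : - (b / 2) <= k by move: kb; rewrite ler_norml => /andP[].
have bk0 : 0 < b + k by lra.
have w1 := exp_bounded_gauss a 1 bk0.
have w2 := exp_bounded_gauss a 1 b0.
have w3 := exp_bounded_gauss a 'X^2 b0.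
have w3' := exp_bounded_scale k w3.
have -> : laplace (gauss_weight a (b + k) 1) G - laplace (gauss_weight a b 1) G -
    k * - laplace (gauss_weight a b 'X^2) G =
  laplace (fun r => 1 * gauss_weight a (b + k) 1 r +
     ((-1) * gauss_weight a b 1 r + k * gauss_weight a b 'X^2 r)) G.
  have w23 := exp_bounded_lin (-1) w2 w3'.
  rewrite (laplace_lin _ w1 w23 mG (fun r _ => GM r)).
  rewrite (laplace_lin _ w2 w3' mG (fun r _ => GM r)).
  by rewrite (laplace_scale _ w3 mG (fun r _ => GM r)) mul1r mulN1r mulrN opprK addrA.
rewrite mulrAC (mulrAC C); apply: le_laplace => //.
- exact: exp_bounded_lin w1 (exp_bounded_lin (-1) w2 w3').
- by rewrite mulr_ge0// sqr_ge0.
- move=> r r0.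
  pose g q z := gauss_weight a z q r.
  have gE q (z : R) : is_derive z 1 (g q) (g (- 'X^2 * q) z).
    have H : is_derive z 1 (fun z => - (a * r) - z * r ^+ 2) (- r ^+ 2).
      have -> : (fun z => - (a * r) - z * r ^+ 2) = horner ((- (a * r))%:P - r ^+ 2 *: 'X).
        by apply/funext => y; rewrite !(hornerD, hornerN, hornerM, hornerZ, hornerX, hornerC, hornerXn); ring.
      suff -> : - r ^+ 2 = ((- (a * r))%:P - r ^+ 2 *: 'X)^`().[z] by exact: is_derive_poly.
      rewrite !(poly.derivE, hornerE) /=; ring.
    have D := is_deriveZ q.[r] (@is_derive1_comp _ expR (fun z : R => - (a * r) - z * r ^+ 2) z _ _ (is_derive_expR _) H).
    have -> : g (- 'X^2 * q) z = q.[r] * (expR (- (a * r) - z * r ^+ 2) * - r ^+ 2); last exact: D.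
    rewrite /g /gauss_weight !(hornerD, hornerN, hornerM, hornerZ, hornerX, hornerC, hornerXn); ring.
  have T : `|g 1 (b + k) - g 1 b - g (- 'X^2 * 1) b * (b + k - b)| <=
      C * expR (- `|r|) * (b + k - b) ^+ 2.
    apply: taylor2 (gE 1) (gE (- 'X^2 * 1)) _ => z; rewrite [b + k - b]addrC addKr => zk.
    have bz : b / 2 <= z.
      have : `|z - b| <= b / 2 by exact: le_trans zk kb.
      rewrite ler_norml; lra.
    have -> : - 'X^2 * (- 'X^2 * 1) = 'X^4 :> {poly R} by rewrite mulr1 mulrNN -exprD.
    exact: HC.
  have bk : b + k - b = k by ring.
  rewrite (gtr0_norm r0) bk in T; rewrite mulrAC; apply: le_trans T.
  rewrite le_eqVlt; apply/orP; left; apply/eqP; congr `|_|.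
  rewrite /g /gauss_weight !(hornerD, hornerN, hornerM, hornerZ, hornerX, hornerC, hornerXn); ring.
Qed.

End gaussian_weights.

(** * Law of the Brownian motion and of the time-changed process *)

Section density.
Context {R : realType} {disp : measure_display} {T : measurableType disp}.
Variable P : probability T R.
Local Notation mu := (@lebesgue_measure R).
Implicit Types (g : R -> R) (y : R).

Definition has_density (Z : T -> R) (p : R -> R) : Prop :=
  [/\ measurable_fun setT Z, mu.-integrable setT (EFin \o p), forall y, 0 <= p y &
    forall A, measurable A -> P (Z @^-1` A) = (\int[mu]_(y in A) (p y)%:E)%E].

Lemma density_expectation (Z : T -> R) (p : R -> R) g :
  has_density Z p -> bounded_borel g ->
  \int[P]_w g (Z w) = \int[mu]_y (g y * p y).
Proof.
move=> [mZ ip p0 ZA] bg.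
have bZ A : borel A -> measurable (Z @^-1` A).
  by move=> /borel_setR mA; rewrite -[_ @^-1` _]setTI; exact: mZ.
have mp : measurable_fun setT p by apply/measurable_EFinP; case/integrableP : ip.
have igp g' : bounded_borel g' -> mu.-integrable setT (EFin \o (fun y => g' y * p y)).
  move=> [/(measurable_comp_borel (T := R) (Z := id)) mg' [M g'M]].
  have ipM : mu.-integrable setT (EFin \o (fun y => M * p y)).
    by have := integrableZl measurableT M ip; apply.
  apply: (@integrable_dominated _ _ _ mu setT _ _ (fun y => M * p y)) => //.
    apply: measurable_funM => //; apply: mg' => A bA.
    by apply/borel_setR.
  by move=> y _; rewrite normrM (ger0_norm (p0 y)) ler_wpM2r.
have igZ g' : bounded_borel g' -> P.-integrable setT (EFin \o (fun w => g' (Z w))).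
  by move=> [bg' [M g'M]]; apply: (@integrable_bounded _ _ _ _ _ M) => //; exact: measurable_comp_borel.
move: g bg; apply: bounded_borel_ind => [A bA|a f g bf bg Hf Hg|f bf H].
- have mA : measurable A by apply/borel_setR.
  have -> : \int[P]_w \1_A (Z w) = fine (P (Z @^-1` A)).
    by rewrite -Rintegral_indic_prob//; exact: bZ.
  rewrite ZA// /Rintegral; congr fine; rewrite [LHS]integral_mkcond.
  apply: eq_integral => y _; rewrite /patch indicE.
  by case: ifP => yA; rewrite ?mul1r ?mul0r.
- rewrite RintegralD//; last 2 first.
  + have := integrableZl measurableT a (igZ _ bf); exact.
  + exact: igZ.
  rewrite RintegralZl//; last exact: igZ.
  rewrite Hf Hg -RintegralZl//; last exact: igp.
  rewrite -RintegralD//.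
  + by apply: eq_Rintegral => y _; rewrite mulrDl mulrA.
  + have := integrableZl measurableT a (igp _ bf); exact.
  + exact: igp.
- apply/eqP; rewrite -subr_eq0 -normr_le0; apply/ler_addgt0Pr => e e0; rewrite add0r.
  pose K := 1 + \int[mu]_y p y.
  have K0 : 0 < K by rewrite ltr_pwDl// Rintegral_ge0.
  have [g [bg Hg fg]] := H (e / K) (divr_gt0 e0 K0).
  have -> : \int[P]_w f (Z w) - \int[mu]_y (f y * p y) =
      \int[P]_w (f (Z w) - g (Z w)) - \int[mu]_y (f y * p y - g y * p y).
    by rewrite !RintegralB// ?Hg; [ring|exact: igp|exact: igp|exact: igZ|exact: igZ].
  have mfg : measurable_fun setT (fun w => f (Z w) - g (Z w)).
    by apply: measurable_funB; apply: measurable_comp_borel => //; [case: bf|case: bg].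
  apply: le_trans (ler_normB _ _) _.
  have -> : e = e / K + e / K * \int[mu]_y p y.
    rewrite -[X in X + _]mulr1 -mulrDr -/K; field; rewrite gt_eqF//.
  apply: lerD; first by apply: le_norm_expectation.
  rewrite -RintegralZl//; apply: le_norm_Rintegral => //.
  + apply: measurable_funB.
      by apply/measurable_EFinP; case/integrableP : (igp _ bf).
    by apply/measurable_EFinP; case/integrableP : (igp _ bg).
  + have := integrableZl measurableT (e / K) ip; exact.
  + by move=> y _; rewrite -mulrBl normrM (ger0_norm (p0 y)) ler_wpM2r.
Qed.

Lemma even_density_expectation (Z : T -> R) (p g : R -> R) M :
  has_density Z p -> continuous p -> (forall y, p (- y) = p y) ->
  continuous g -> (forall y, `|g y| <= M) ->
  \int[P]_w g `|Z w| = laplace (fun r => 2 * p r) g.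
Proof.
move=> Zp cp pN cg gM; have [mZ ip p0 ZA] := Zp.
have cgn : continuous (fun y => g `|y|).
  by move=> y; apply: continuous_comp; [exact: norm_continuous|exact: cg].
have bgn : bounded_borel (fun y => g `|y|).
  by split; [exact: continuous_borel_fun|exists M].
rewrite (density_expectation Zp bgn) /laplace.
have M0 : 0 <= M by exact: le_trans (normr_ge0 _) (gM 0).
have mg : measurable_fun setT (fun y => g `|y|) by exact: continuous_measurable_fun.
have mp : measurable_fun setT p by exact: continuous_measurable_fun.
have ih (h : R -> R) N : measurable_fun setT h -> (forall y, `|h y| <= N) ->
    mu.-integrable setT (EFin \o (fun y => h y * p y)).
  move=> mh hN.
  have ipN : mu.-integrable setT (EFin \o (fun y => N * p y)).
    by have := integrableZl measurableT N ip; apply.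
  apply: (@integrable_dominated _ _ _ mu setT _ _ (fun y => N * p y)) => //.
    exact: measurable_funM.
  by move=> y _; rewrite normrM (ger0_norm (p0 y)) ler_wpM2r.
have sub (D : set R) (h : R -> R) : measurable D ->
    mu.-integrable setT (EFin \o h) -> mu.-integrable D (EFin \o h).
  by move=> mD; apply: integrableS => //; exact: subsetT.
have sym (h : R -> R) N : continuous h -> (forall y, h (- y) = h y) ->
    (forall y, 0 <= h y <= N) ->
    \int[mu]_y (h y * p y) = 2 * \int[mu]_(y in `]0, +oo[) (h y * p y).
  move=> ch hev hN.
  have hN' y : `|h y| <= N by have /andP[h0 h1] := hN y; rewrite ger0_norm.
  have mh : measurable_fun setT h by exact: continuous_measurable_fun.
  have iS := sub _ _ (measurable_itv `[0, +oo[) (ih h N mh hN').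
  have -> : \int[mu]_(y in `]0, +oo[) (h y * p y) = \int[mu]_(y in `[0, +oo[) (h y * p y).
    rewrite Rintegral_itv_obnd_cbnd//.
    exact: (sub _ _ (measurable_itv `]0, +oo[) (ih h N mh hN')).
  rewrite /Rintegral (@ge0_symfun_integralT _ (fun y => h y * p y)).
  + rewrite -set_itvcy fineM//; exact: integrable_fin_num.
  + by move=> y; rewrite mulr_ge0//; case/andP: (hN y).
  + by move=> y; apply: cvgM; [exact: ch|exact: cp].
  + by move=> y /=; rewrite hev pN.
have iM : mu.-integrable setT (EFin \o (fun y => M * p y)).
  by have := integrableZl measurableT M ip; apply.
have iMH := sub _ _ (measurable_itv `]0, +oo[) iM.
have ig := ih _ M mg (fun y => gM _).
have igH := sub _ _ (measurable_itv `]0, +oo[) ig.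
(* [sym] is for nonnegative functions, hence the shift by the constant [M] *)
have S1 := @sym (fun y => g `|y| + M) (M + M) _ _ _.
have S2 := @sym (fun=> M) M _ _ _.
have -> : \int[mu]_y (g `|y| * p y) =
    \int[mu]_y ((g `|y| + M) * p y) - \int[mu]_y (M * p y).
  rewrite -RintegralB//; first by apply: eq_Rintegral => y _; ring.
  apply: (ih (fun y => g `|y| + M) (M + M)); first exact: measurable_funD.
  by move=> y; rewrite (le_trans (ler_normD _ _))// lerD// ger0_norm.
rewrite S1 ?S2; last 6 first.
- by move=> y; exact: cvg_cst.
- by [].
- by move=> _; rewrite M0 lexx.
- by move=> y; apply: cvgD; [exact: cgn|exact: cvg_cst].
- by move=> y; rewrite normrN.
- by move=> y; have := gM `|y|; rewrite ler_norml => /andP[g1 g2]; rewrite -lerBlDr sub0r g1 lerD2r.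
rewrite -mulrBr -RintegralB//.
- rewrite -RintegralZl//.
    apply: eq_Rintegral => y /set_mem/=; rewrite in_itv/= andbT => y0.
    by rewrite gtr0_norm//; ring.
  apply: eq_integrable igH => // y _; rewrite /=; congr EFin; ring.
- apply: (sub _ (fun y => (g `|y| + M) * p y) (measurable_itv `]0, +oo[)).
  apply: (ih (fun y => g `|y| + M) (M + M)); first exact: measurable_funD.
  by move=> y; rewrite (le_trans (ler_normD _ _))// lerD// ger0_norm.
Qed.

End density.

Section brownian.
Context {R : realType} {disp : measure_display} {T : measurableType disp}.
Variable P : probability T R.
Context {F : R -> set (set T)} {B : R -> T -> R}.
Hypotheses (hF : filtration F) (hB : brownian_motion P F 0 B).
Implicit Types (t : R) (g : R -> R).

Lemma measurable_brownian t : 0 <= t -> measurable_fun setT (B t).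
Proof.
move=> t0 _ A mA; rewrite setTI.
case: hF hB => _ Fm _ [Ba _ _ _]; apply: (Fm t t0); apply: Ba => //.
by apply/borel_setR.
Qed.

Lemma sigma_process_brownian : sigma_process B `<=` measurable.
Proof.
apply: smallest_sub; first exact: sigma_algebra_measurable.
move=> _ [t [A [t0 bA ->]]]; rewrite -[_ @^-1` _]setTI.
by apply: measurable_brownian => //; apply/borel_setR.
Qed.

Lemma brownian_density t : 0 < t ->
  has_density P (B t) (normal_pdf 0 (Num.sqrt t)).
Proof.
move=> t0; split.
- by apply: measurable_brownian; exact: ltW.
- exact: integrable_normal_pdf.
- by move=> y; exact: normal_pdf_ge0.
- move=> A mA; case: hF hB => Fs _ _ [_ _ B0 Bi].
  have FT : F 0 setT.
    by case: (Fs 0 (lexx _)) => F0 FC _; have := FC _ F0; rewrite setD0.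
  have bA : borel A by apply/borel_setR.
  have := Bi 0 t setT A (lexx 0) t0 FT bA.
  rewrite setTI probability_setT mul1e subr0 => H.
  rewrite -[RHS]/(normal_prob 0 (Num.sqrt t) A) -H; congr (P _).
  by apply/seteqP; split=> w /=; rewrite B0 subr0.
Qed.

(** For [a = 0] this is the density of the reflected Brownian motion at time [t],
    twice the heat kernel on the half-line; [a] is the rate of the damping. *)
Definition heat_weight a t : R -> R :=
  gauss_weight a (2 * t)^-1 ((2 / Num.sqrt (2 * pi * t))%:P).

Lemma brownian_abs_expectation t g M : 0 < t -> continuous g ->
  (forall y, `|g y| <= M) ->
  \int[P]_w g `|B t w| = laplace (heat_weight 0 t) g.
Proof.
move=> t0 cg gM; have st0 : 0 < Num.sqrt t by rewrite sqrtr_gt0.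
have st : Num.sqrt t != 0 by rewrite gt_eqF.
rewrite (even_density_expectation (brownian_density t0) _ _ cg gM).
- congr (laplace _ g); apply/funext => r; rewrite normal_pdfE//.
  rewrite /heat_weight /gauss_weight hornerC mul0r oppr0 sub0r.
  rewrite /normal_peak /normal_fun sqr_sqrtr ?ltW// subr0 mulrA; congr (2 / Num.sqrt _ * expR _).
    by rewrite -mulr_natl; ring.
  by rewrite mulNr -mulr_natl mulrC.
- exact: continuous_normal_pdf.
- by move=> y; rewrite normal_pdfE// /normal_fun !subr0 sqrrN.
Qed.

End brownian.

Section time_change.
Context {R : realType} {disp : measure_display} {T : measurableType disp}.
Variable P : probability T R.
Local Open Scope ereal_scope.

Lemma countable_partition {I : countType} (N : T -> I) (Q : set T) :
  (forall i, measurable (Q `&` [set w | N w = i])) ->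
  [/\ measurable Q,
      forall n, measurable (Q `&` [set w | pickle (N w) = n]) &
      P Q = \sum_(0 <= n <oo) P (Q `&` [set w | pickle (N w) = n])].
Proof.
move=> mQN.
have mQ n : measurable (Q `&` [set w | pickle (N w) = n]).
  have [[i <-]|no] := pselect (exists i : I, pickle i = n).
    suff -> : [set w | pickle (N w) = pickle i] = [set w | N w = i] by [].
    by apply/seteqP; split=> w /=; [exact: (pcan_inj pickleK)|move->].
  suff -> : Q `&` [set w | pickle (N w) = n] = set0 by [].
  by rewrite -subset0 => w [_ /= Nn]; apply: no; exists (N w).
have QE : Q = \bigcup_n (Q `&` [set w | pickle (N w) = n]).
  by apply/seteqP; split=> w; [move=> Qw; exists (pickle (N w))|move=> [n _ []]].
split => //; first by rewrite QE; exact: bigcup_measurable.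
rewrite {1}QE measure_bigcup//.
- by apply: eq_eseriesl => n; rewrite in_setT.
- apply/trivIsetP => i j _ _ ij; rewrite -subset0 => w [] [_ /= ei] [_ /= ej].
  by move: ij; rewrite -ei -ej eqxx.
Qed.

Lemma measurable_partition {I : countType} (N : T -> I) (Q : set T) :
  (forall i, measurable (Q `&` [set w | N w = i])) -> measurable Q.
Proof. by move=> /countable_partition[]. Qed.

(** A proportionality that holds conditionally on each value of a discrete random
    variable holds unconditionally. *)
Lemma partition_probability {I : countType} (N : T -> I) (Q1 Q2 : set T) (c : \bar R) :
  0 <= c -> c \is a fin_num ->
  (forall i, measurable (Q1 `&` [set w | N w = i])) ->
  (forall i, measurable (Q2 `&` [set w | N w = i])) ->
  (forall i, P (Q1 `&` [set w | N w = i]) = c * P (Q2 `&` [set w | N w = i])) ->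
  P Q1 = c * P Q2.
Proof.
move=> c0 cfin m1 m2 H.
have [_ _ ->] := countable_partition m1; have [_ _ ->] := countable_partition m2.
rewrite -(fineK cfin) -nneseriesZl//; apply: eq_eseriesr => n _; rewrite fineK//.
have [[i <-]|no] := pselect (exists i : I, pickle i = n).
  have -> : [set w | pickle (N w) = pickle i] = [set w | N w = i].
    by apply/seteqP; split=> w /=; [exact: (pcan_inj pickleK)|move->].
  exact: H.
have -> : [set w | pickle (N w) = n] = set0.
  by rewrite -subset0 => w /= Nn; apply: no; exists (N w).
by rewrite !setI0 measure0 mule0.
Qed.

Local Close Scope ereal_scope.

Lemma indep_expectation {V : ptopologicalType} (Z Z' : T -> V) (D : set T) (g : V -> R) :
  (forall A, borel A -> measurable (Z @^-1` A)) ->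
  (forall A, borel A -> measurable (Z' @^-1` A)) -> measurable D ->
  (forall A, borel A -> P (Z @^-1` A `&` D) = (P (Z' @^-1` A) * P D)%E) ->
  bounded_borel g ->
  \int[P]_w (\1_D w * g (Z w)) = fine (P D) * \int[P]_w g (Z' w).
Proof.
move=> mZ mZ' mD H bg.
have D1 w : `|\1_D w : R| <= 1 by rewrite indicE; case: (_ \in _); rewrite ?normr1 ?normr0.
have mD1 : measurable_fun setT (\1_D : T -> R) by exact: measurable_indic.
have iZ g' : bounded_borel g' -> P.-integrable setT (EFin \o (fun w => \1_D w * g' (Z w))).
  move=> [bg' [M g'M]]; apply: (@integrable_bounded _ _ _ _ _ M).
    by apply: measurable_funM => //; exact: measurable_comp_borel.
  by move=> w; rewrite normrM -[leRHS]mul1r ler_pM.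
have iZ' g' : bounded_borel g' -> P.-integrable setT (EFin \o (fun w => g' (Z' w))).
  by move=> [bg' [M g'M]]; apply: (@integrable_bounded _ _ _ _ _ M) => //; exact: measurable_comp_borel.
move: g bg; apply: bounded_borel_ind => [A bA|a f g bf bg Hf Hg|f bf Hf].
- have -> : \int[P]_w (\1_D w * \1_A (Z w)) = fine (P (Z @^-1` A `&` D)).
    rewrite -Rintegral_indic_prob; last by apply: measurableI => //; exact: mZ.
    by apply: eq_Rintegral => w _; rewrite setIC indicI.
  have -> : \int[P]_w \1_A (Z' w) = fine (P (Z' @^-1` A)).
    by rewrite -Rintegral_indic_prob//; exact: mZ'.
  by rewrite H// fineM ?fin_num_measure//; [rewrite mulrC|exact: mZ'].
- rewrite (RintegralD _ _ (iZ' _ bg))//; last first.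
    by have := integrableZl measurableT a (iZ' _ bf); exact.
  rewrite RintegralZl//; last exact: iZ'.
  rewrite mulrDr mulrCA -Hf -Hg -RintegralZl//; last exact: iZ.
  rewrite -RintegralD//.
  + by apply: eq_Rintegral => w _; ring.
  + by have := integrableZl measurableT a (iZ _ bf); exact.
  + exact: iZ.
- apply/eqP; rewrite -subr_eq0 -normr_le0; apply/ler_addgt0Pr => e e0; rewrite add0r.
  have e20 : 0 < e / 2 by rewrite divr_gt0.
  have [g [bg Hg fg]] := Hf _ e20.
  have -> : \int[P]_w (\1_D w * f (Z w)) - fine (P D) * \int[P]_w f (Z' w) =
      \int[P]_w (\1_D w * f (Z w) - \1_D w * g (Z w)) -
      fine (P D) * \int[P]_w (f (Z' w) - g (Z' w)).
    rewrite (RintegralB measurableT (iZ _ bf) (iZ _ bg)).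
    by rewrite (RintegralB measurableT (iZ' _ bf) (iZ' _ bg)) Hg; ring.
  apply: le_trans (ler_normB _ _) _; rewrite [leRHS](splitr e); apply: lerD.
    apply: le_norm_expectation.
      by apply: measurable_funB; apply: measurable_funM => //; apply: measurable_comp_borel => //; [case: bf|case: bg].
    by move=> w; rewrite -mulrBr normrM -[leRHS]mul1r ler_pM.
  rewrite normrM -[leRHS]mul1r; apply: ler_pM => //.
    rewrite ger0_norm ?fine_ge0// -[leRHS]/(fine 1%:E) fine_le ?fin_num_measure//.
    exact: probability_le1.
  apply: le_norm_expectation => //.
  by apply: measurable_funB; apply: measurable_comp_borel => //; [case: bf|case: bg].
Qed.

Variables (V : ptopologicalType) (B : R -> T -> R) (Z X : R -> T -> V) (f : V -> R)
  (h : R -> R) (eps : R).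
Hypotheses (mB : forall s, 0 <= s -> measurable_fun setT (B s))
  (mZ : forall s A, 0 <= s -> borel A -> measurable (Z s @^-1` A))
  (mX : forall s A, 0 <= s -> borel A -> measurable (X s @^-1` A))
  (cZ : continuous_paths Z) (cX : continuous_paths X)
  (cf : continuous f) (fM : exists M : R, forall y, `|f y| <= M)
  (ch : continuous h) (hM : exists M : R, forall y, `|h y| <= M)
  (ZB : forall s A D, 0 <= s -> borel A -> sigma_process B D ->
    P (Z s @^-1` A `&` D) = (P (X s @^-1` A) * P D)%E).

Lemma sigma_grid_index t m k : 0 <= t ->
  sigma_process B [set w | grid_index m `|B t w| = k].
Proof.
move=> t0; apply: sub_gen_smallest.
exists t, [set y | grid_index m `|y| = k]; split => //.
by apply/borel_setR; exact: measurable_grid_cell.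
Qed.

(** Independence gives a product rule at each deterministic time only. It applies
    on every cell of a grid for the clock [eps * |B t|], and continuity of the
    paths allows the mesh to tend to [0]. *)
Lemma time_change_expectation t : 0 <= t ->
  \int[P]_w (h `|B t w| * f (Z `|eps * `|B t w| | w)) =
  \int[P]_w (h `|B t w| * \int[P]_v f (X `|eps * `|B t w| | v)).
Proof.
move=> t0; have [M fMM] := fM; have [N hN] := hM.
have bf : bounded_borel f by split => //; exact: continuous_borel_fun.
have mabs : measurable_fun setT (fun w => `|B t w|).
  by apply: measurableT_comp => //; exact: mB.
have cpath (Y : R -> T -> V) w : continuous_paths Y -> continuous (fun s => f (Y `|eps * s| w)).
  move=> cY s; apply: (@continuous_comp _ _ _ (fun s => Y `|eps * s| w) f); last exact: cf.
  apply: (@continuous_comp _ _ _ (fun s => eps * s) (fun s => Y `|s| w)).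
    by apply: cvgM; [exact: cvg_cst|exact: cvg_id].
  exact: (continuous_abs_halfline (cY w)).
have cS : continuous (fun s => \int[P]_v f (X `|eps * s| v)).
  apply: (@continuous_expectation _ _ _ P (fun s v => f (X `|eps * s| v)) M) => //.
  - by move=> s; apply: measurable_comp_borel => [A bA|]; [exact: mX|case: bf].
  - by move=> w; exact: cpath.
have SM s : `|\int[P]_v f (X `|eps * s| v)| <= M.
  apply: le_norm_expectation => //.
  by apply: measurable_comp_borel => [A bA|]; [exact: mX|case: bf].
have icst : P.-integrable setT (EFin \o cst (N * M)).
  by apply: finite_measure_integrable_cst; rewrite ?probability_setT ?ltry.
have mZf s : measurable_fun setT (fun w => f (Z `|eps * s| w)).
  by apply: measurable_comp_borel => [A bA|]; [exact: mZ|case: bf].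
pose G1 s w := h s * f (Z `|eps * s| w).
pose G2 s (w : T) := h s * \int[P]_v f (X `|eps * s| v).
have c1 : \sum_(k < m.+1 ^ 2) \int[P]_w ((grid_index m `|B t w| == k)%:R * G1 (grid_point m k) w)
    @[m --> \oo] --> \int[P]_w G1 `|B t w| w.
  apply: (@Rintegral_random_time R _ _ P setT (fun w => `|B t w|) G1 _ mabs _ _ _ (cst (N * M))) => //.
  - by move=> s _; apply: measurable_funM.
  - by move=> w _ s; apply: cvgM; [exact: ch|exact: cpath].
  - by move=> s w _ _; rewrite normrM ler_pM.
have c2 : \sum_(k < m.+1 ^ 2) \int[P]_w ((grid_index m `|B t w| == k)%:R * G2 (grid_point m k) w)
    @[m --> \oo] --> \int[P]_w G2 `|B t w| w.
  apply: (@Rintegral_random_time R _ _ P setT (fun w => `|B t w|) G2 _ mabs _ _ _ (cst (N * M))) => //.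
  - by move=> s _; exact: measurable_cst.
  - by move=> w _ s; apply: cvgM; [exact: ch|exact: cS].
  - by move=> s w _ _; rewrite normrM ler_pM.
apply: (cvg_unique _ c1) => //=; apply: cvg_trans c2; apply: near_eq_cvg.
apply: nearW => m; apply: eq_bigr => k _.
pose D := [set w | grid_index m `|B t w| = k].
have sD : sigma_process B D by exact: sigma_grid_index.
have mD : measurable D.
  suff : sigma_process B `<=` measurable by apply.
  apply: smallest_sub; first exact: sigma_algebra_measurable.
  move=> _ [r [A [r0 bA ->]]]; rewrite -[_ @^-1` _]setTI.
  by apply: mB => //; apply/borel_setR.
have ind w : (grid_index m `|B t w| == k)%:R = \1_D w :> R.
  rewrite indicE; congr (nat_of_bool _)%:R.
  by apply/eqP/idP => [/mem_set|/set_mem].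
set s := grid_point m k.
have s0 : 0 <= `|eps * s| by [].
have iZ : P.-integrable setT (EFin \o (fun w => \1_D w * f (Z `|eps * s| w))).
  apply: (@integrable_bounded _ _ _ _ _ M).
    by apply: measurable_funM => //; exact: measurable_indic.
  move=> w; rewrite indicE; case: (_ \in _); rewrite ?mul1r// mul0r normr0.
  exact: le_trans (fMM (Z 0 w)).
have E1 : \int[P]_w ((grid_index m `|B t w| == k)%:R * G1 s w) =
    h s * \int[P]_w (\1_D w * f (Z `|eps * s| w)).
  by rewrite -RintegralZl//; apply: eq_Rintegral => w _; rewrite ind /G1 mulrCA.
have iD : P.-integrable setT (EFin \o (\1_D : T -> R)).
  by apply: integrable_indic; rewrite ?(le_lt_trans (probability_le1 _ _)) ?ltry.
have E2 : \int[P]_w ((grid_index m `|B t w| == k)%:R * G2 s w) =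
    (h s * \int[P]_v f (X `|eps * s| v)) * fine (P D).
  rewrite -Rintegral_indic_prob// -RintegralZl//.
  by apply: eq_Rintegral => w _; rewrite ind /G2 mulrC.
rewrite E2 E1.
have := @indep_expectation V (Z `|eps * s|) (X `|eps * s|) D f _ _ mD _ bf.
move=> ->; first ring.
- by move=> A bA; exact: mZ.
- by move=> A bA; exact: mX.
- by move=> A bA; exact: ZB.
Qed.

End time_change.

Section excursion_representation.
Context {R : realType} {disp : measure_display} {T : measurableType disp}.
Variable P : probability T R.
Context {d : nat} {X : 'rV[R]_d -> R -> T -> 'rV[R]_d} {B : R -> T -> R} {eps : R}.
Hypothesis sB : sigma_process B `<=` measurable.
Local Notation V := 'rV[R]_d.

Lemma copy_measurable x (Z : R -> T -> V) s A : is_copy P X x Z -> 0 <= s ->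
  borel A -> measurable (Z s @^-1` A).
Proof. by move=> [[Za _] _] s0 bA; exact: Za. Qed.

Lemma copy_law x (Z : R -> T -> V) s A : is_copy P X x Z -> 0 <= s ->
  borel A -> P (Z s @^-1` A) = P (X x s @^-1` A).
Proof.
move=> [_ [/(_ 1%N (fun=> s) (fun=> A)) H _]] s0 bA.
have E (Y : R -> T -> V) : [set w | forall i : 'I_1, A (Y s w)] = Y s @^-1` A.
  by apply/seteqP; split=> w //=; apply; exact: ord0.
by rewrite -!E H.
Qed.

Lemma sigma_processI (Y : R -> T -> R) (A C : set T) : sigma_process Y A -> sigma_process Y C ->
  sigma_process Y (A `&` C).
Proof. exact: (@measurableI _ (g_sigma_algebraType _)). Qed.

(** Whichever way the copy in use at time [t] is selected, it is a fresh copy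
    of the outer process, independent of the Brownian motion: given the number of
    the current excursion and the index drawn for it, the selected process is one
    fixed copy, whose law does not depend on the selection. *)
Lemma excursion_process_copy Y x t : 0 <= t ->
  (exists2 k : nat, (0 < k)%N & k_excursion_process P X B eps k Y) \/
    excursion_process P X B eps Y ->
  exists Z : R -> T -> V,
  [/\ forall s A, 0 <= s -> borel A -> measurable (Z s @^-1` A),
      continuous_paths Z, forall w, Z 0 w = x,
      forall s A D, 0 <= s -> borel A -> sigma_process B D ->
        P (Z s @^-1` A `&` D) = (P (X x s @^-1` A) * P D)%E &
      forall w, Y x t w = Z (eps * `|B t w|) w].
Proof.
move=> t0 [[k k0 [Z [K [e [Zc Ku [em _] ind YE]]]]]|[Z [e [Zc [em _] ind YE]]]].
- have se n : sigma_process B [set w | e t w = n] by exact: em.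
  have me n : measurable [set w | e t w = n] by exact: sB.
  have mK n (j : 'I_k) : measurable [set w | K n w = j] by case: (Ku n j).
  have mZ s A j : 0 <= s -> borel A -> measurable (Z j x s @^-1` A).
    by move=> s0 bA; exact: copy_measurable (Zc j x) _ _.
  pose W s w := Z (K (e t w) w) x s w.
  have WE s A D n j : W s @^-1` A `&` D `&` [set w | e t w = n] `&` [set w | K n w = j] =
      Z j x s @^-1` A `&` (D `&` [set w | e t w = n] `&` [set w | K n w = j]).
    apply/seteqP; split=> w /=.
      by move=> [[[WA Dw] en] Kj]; move: WA; rewrite /W en Kj.
    by move=> [ZA [[Dw en] Kj]]; rewrite /W en Kj.
  have mWD s A D n : 0 <= s -> borel A -> measurable D ->
      measurable (W s @^-1` A `&` D `&` [set w | e t w = n]).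
    move=> s0 bA mD; apply: (measurable_partition P (N := K n)) => j.
     rewrite WE; apply: measurableI; first exact: mZ.
    by apply: measurableI => //; exact: measurableI.
  have mW s A D : 0 <= s -> borel A -> measurable D -> measurable (W s @^-1` A `&` D).
    by move=> s0 bA mD; apply: (measurable_partition P (N := e t)) => n; exact: mWD.
  exists W; split => //.
  + by move=> s A s0 bA; rewrite -[_ @^-1` _]setIT; exact: mW.
  + by move=> w; have [[_ cZ] _] := Zc (K (e t w) w) x; exact: cZ.
  + by move=> w; have [_ [_ Z0]] := Zc (K (e t w) w) x; exact: Z0.
  + move=> s A D s0 bA sD; have mD := sB sD.
    have mXA : P (X x s @^-1` A) \is a fin_num.
      have [i] : exists i : 'I_k, True by exists (Ordinal k0).
      by rewrite -(copy_law (Zc i x) s0 bA) fin_num_measure//; exact: mZ.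
    have cX0 : (0 <= P (X x s @^-1` A))%E by exact: measure_ge0.
    apply: (partition_probability (N := e t)) => //.
    * by move=> n; exact: mWD.
    * by move=> n; exact: measurableI.
    move=> n; apply: (partition_probability (N := K n)) => //.
    * move=> j; rewrite WE; apply: measurableI; first exact: mZ.
      by apply: measurableI => //; exact: measurableI.
    * by move=> j; apply: measurableI => //; exact: measurableI.
    move=> j; rewrite WE.
    have sDe : sigma_process B (D `&` [set w | e t w = n]) by exact: sigma_processI.
    have sC : sigma_process (Z j x) (Z j x s @^-1` A).
      by apply: sub_gen_smallest; exists s, A.
    have sK : sigma_variable (K n) [set w | K n w = j] by exists [set j].
    pose E (i : option ('I_k + nat)) := match i with
      | None => D `&` [set w | e t w = n]
      | Some (inl j') => Z j x s @^-1` A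
      | Some (inr _) => [set w | K n w = j] end.
    have := ind x [:: Some (inl j); None; Some (inr n)] E isT.
    rewrite !big_cons !big_nil /= !setIT !mule1 => ->; last first.
      by move=> i; rewrite !inE => /or3P[] /eqP ->.
    have := ind x [:: None; Some (inr n)] E isT.
    rewrite !big_cons !big_nil /= !setIT !mule1 => ->; last first.
      by move=> i; rewrite !inE => /orP[] /eqP ->.
    by rewrite (copy_law (Zc j x)).
- have se n : sigma_process B [set w | e t w = n] by exact: em.
  have me n : measurable [set w | e t w = n] by exact: sB.
  have mZ s A j : 0 <= s -> borel A -> measurable (Z j x s @^-1` A).
    by move=> s0 bA; exact: copy_measurable (Zc j x) _ _.
  pose W s w := Z (e t w) x s w.
  have WE s A D n : W s @^-1` A `&` D `&` [set w | e t w = n] =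
      Z n x s @^-1` A `&` (D `&` [set w | e t w = n]).
    apply/seteqP; split=> w /=; first by move=> [[WA Dw] en]; move: WA; rewrite /W en.
    by move=> [ZA [Dw en]]; rewrite /W en.
  have mWD s A D n : 0 <= s -> borel A -> measurable D ->
      measurable (W s @^-1` A `&` D `&` [set w | e t w = n]).
    by move=> s0 bA mD; rewrite WE; apply: measurableI; [exact: mZ|exact: measurableI].
  exists W; split => //.
  + move=> s A s0 bA; rewrite -[_ @^-1` _]setIT.
    by apply: (measurable_partition P (N := e t)) => n; exact: mWD.
  + by move=> w; have [[_ cZ] _] := Zc (e t w) x; exact: cZ.
  + by move=> w; have [_ [_ Z0]] := Zc (e t w) x; exact: Z0.
  + move=> s A D s0 bA sD; have mD := sB sD.
    have mXA : P (X x s @^-1` A) \is a fin_num.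
      by rewrite -(copy_law (Zc 0%N x) s0 bA) fin_num_measure//; exact: mZ.
    have cX0 : (0 <= P (X x s @^-1` A))%E by exact: measure_ge0.
    apply: (partition_probability (N := e t)) => //.
    * by move=> n; exact: mWD.
    * by move=> n; exact: measurableI.
    move=> n; rewrite WE.
    have sDe : sigma_process B (D `&` [set w | e t w = n]) by exact: sigma_processI.
    have sC : sigma_process (Z n x) (Z n x s @^-1` A).
      by apply: sub_gen_smallest; exists s, A.
    pose E (i : option nat) := if i is Some _ then Z n x s @^-1` A else D `&` [set w | e t w = n].
    have := ind x [:: Some n; None] E isT.
    rewrite !big_cons !big_nil /= !setIT !mule1 => ->; last first.
      by move=> i; rewrite !inE => /orP[] /eqP ->.
    by rewrite (copy_law (Zc n x)).
Qed.

End excursion_representation.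

(** * The fourth order equation *)

Section moments.
Context {R : realType}.
Implicit Types (a b t : R) (G : R -> R).

(** The weights met below are quadratic polynomials times one Gaussian, so that
    every term of the equation reduces to three moments. *)
Lemma laplace_gauss_quadratic a b (k0 k1 k2 : R) (q : {poly R}) G M : 0 < b ->
  continuous G -> (forall r, `|G r| <= M) ->
  (forall r, q.[r] = k2 * r ^+ 2 + (k1 * r + k0)) ->
  laplace (gauss_weight a b q) G = k2 * laplace (gauss_weight a b 'X^2) G +
    (k1 * laplace (gauss_weight a b 'X) G + k0 * laplace (gauss_weight a b 1) G).
Proof.
move=> b0 cG GM Hq.
have mG : measurable_fun (`]0, +oo[%classic : set R) G.
  by apply: measurable_funTS; exact: continuous_measurable_fun.
have GM' r : 0 < r -> `|G r| <= M by [].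
have e p := exp_bounded_gauss a p b0.
have e0 := exp_bounded_scale k0 (e 1).
have e1 := exp_bounded_lin k1 (e 'X) e0.
rewrite -(laplace_scale k0 (e 1) mG GM') -(laplace_lin k1 (e 'X) e0 mG GM') -(laplace_lin k2 (e 'X^2) e1 mG GM').
congr (laplace _ G); apply/funext => r.
rewrite /gauss_weight Hq !(hornerX, hornerC, hornerXn); ring.
Qed.

Lemma is_derive_mulc (c x : R) : is_derive x 1 (fun s : R => c * s) c.
Proof.
apply: (@is_derive_quadratic _ _ _ _ 0 1) => // k _.
have -> : c * (x + k) - c * x - k * c = 0 by ring.
by rewrite normr0 mul0r.
Qed.

Lemma is_derive_heat_peak t : 0 < t ->
  is_derive t 1 (fun s => 2 / Num.sqrt (2 * pi * s))
    (- (t * Num.sqrt (2 * pi * t))^-1).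
Proof.
move=> t0; have p0 : 0 < 2 * pi * t by rewrite !mulr_gt0// pi_gt0.
have s0 : Num.sqrt (2 * pi * t) != 0 by rewrite gt_eqF// sqrtr_gt0.
have D1 := is_derive_mulc (2 * pi) t.
have D2 := @is_derive1_comp _ Num.sqrt _ t _ _ (is_derive1_sqrt p0) D1.
have D3 := @is_deriveV _ (Num.sqrt \o (fun s => 2 * pi * s)) t _ 1 s0 D2.
have D4 := is_deriveZ 2 D3.
set r := Num.sqrt (2 * pi * t) in s0 *.
have rt : 2 * pi = r ^+ 2 / t.
  by rewrite /r sqr_sqrtr ?ltW//; field; rewrite gt_eqF.
have -> : - (t * r)^-1 = 2 *: (- r ^- 2 *: ((2 * r)^-1 * (2 * pi))).
  by rewrite rt /GRing.scale/=; field; rewrite s0 gt_eqF.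
exact: D4.
Qed.

Lemma is_derive_half_inv t : 0 < t ->
  is_derive t 1 (fun s => (2 * s)^-1) (- (2 * t ^+ 2)^-1).
Proof.
move=> t0; have p0 : 2 * t != 0 by rewrite gt_eqF// mulr_gt0.
have D1 := is_derive_mulc 2 t.
have D2 := @is_deriveV _ (fun s => 2 * s) t _ 1 p0 D1.
have -> : - (2 * t ^+ 2)^-1 = - (2 * t) ^- 2 *: (2 : R).
  by rewrite /GRing.scale/=; field; rewrite gt_eqF.
exact: D2.
Qed.

(** The weight depends on the time through its height and its width, whose
    variations contribute the moments of order 0 and 2. *)
Lemma is_derive_heat_laplace a t G M : 0 < t ->
  continuous G -> (forall r, `|G r| <= M) ->
  let I p := laplace (gauss_weight a (2 * t)^-1 p) G in
  is_derive t 1 (fun s => laplace (heat_weight a s) G)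
    ((t * Num.sqrt (2 * pi * t))^-1 * (I 'X^2 / t - I 1)).
Proof.
move=> t0 cG GM I; have b0 : 0 < (2 * t)^-1 by rewrite invr_gt0 mulr_gt0.
have s0 : Num.sqrt (2 * pi * t) != 0 by rewrite gt_eqF// sqrtr_gt0 !mulr_gt0// pi_gt0.
pose J b := laplace (gauss_weight a b 1) G.
have DJ := @is_derive1_comp _ J _ t _ _ (is_derive_laplace_gauss a b0 cG GM) (is_derive_half_inv t0).
have D := is_deriveM (is_derive_heat_peak t0) DJ.
have -> : (t * Num.sqrt (2 * pi * t))^-1 * (I 'X^2 / t - I 1) =
    (2 / Num.sqrt (2 * pi * t)) *: (- I 'X^2 * - (2 * t ^+ 2)^-1) +
      I 1 *: (- (t * Num.sqrt (2 * pi * t))^-1).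
  by rewrite /GRing.scale/=; field; rewrite s0 gt_eqF.
apply: near_eq_is_derive D; near=> s.
have s1 : 0 < s by near: s; by apply: open_nbhs_nbhs; split => //; exact: open_gt.
have bs0 : 0 < (2 * s)^-1 by rewrite invr_gt0 mulr_gt0.
rewrite /heat_weight (@laplace_gauss_quadratic a (2 * s)^-1 (2 / Num.sqrt (2 * pi * s)) 0 0 _ G M bs0 cG GM).
  by rewrite !mul0r !add0r.
by move=> r; rewrite hornerC; ring.
Unshelve. all: by end_near. Qed.

End moments.

Section generator_equation.
Context {R : realType} {disp : measure_display} {T : measurableType disp}.
Variable P : probability T R.
Context {d : nat} {F : R -> set (set T)} {X : 'rV[R]_d -> R -> T -> 'rV[R]_d}
  {B : R -> T -> R}.
Hypotheses (hF : filtration F) (hX : continuous_markov_process P F X)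
  (hB : brownian_motion P F 0 B).
Local Notation V := 'rV[R]_d.
Local Notation S := (semigroup P X).
Implicit Types (t r : R) (x : V).
Variables (f : V -> R) (eps : R) (Y : V -> R -> T -> V).
Hypotheses (cf : continuous f) (fb : bounded_fun f) (eps0 : 0 < eps)
  (fA : in_domain S f)
  (hY : (exists2 k : nat, (0 < k)%N & k_excursion_process P X B eps k Y) \/
          excursion_process P X B eps Y).
Local Notation u := (u_eps P B eps Y f).
Local Notation avg := (@average R disp T P d X f eps).
Local Notation weight := (heat_weight eps^-1).

Let damping (y : R) : R := expR (- (`|y| / eps)).

Let damping_le y : `|damping y| <= 1.
Proof. by rewrite ger0_norm ?expR_ge0// -[leRHS]expR0 ler_expR oppr_le0 divr_ge0// ltW. Qed.

Let continuous_damping : continuous damping.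
Proof.
move=> y; apply: (@continuous_comp _ _ _ (fun y => - (`|y| / eps)) expR); last exact: continuous_expR.
apply: cvgN; apply: cvgM; last exact: cvg_cst.
exact: norm_continuous.
Qed.

Lemma u_eps_expectation t x : 0 <= t ->
  u t x = \int[P]_w (damping `|B t w| * S `|eps * `|B t w| | f x).
Proof.
move=> t0; have /bounded_funP fM := fb.
have [Z [mZ cZ Z0 ZB YZ]] := excursion_process_copy (sigma_process_brownian hF hB) x t0 hY.
have := @time_change_expectation R disp T P _ B Z (X x) f damping eps
  (fun s s0 => measurable_brownian hF hB s0) mZ
  (fun s A => @markov_measurable _ _ _ _ _ _ _ hF hX x s A) cZ _ cf fM
  continuous_damping (ex_intro _ 1 damping_le) ZB t t0.
rewrite /u_eps unlock -/(Rintegral _ _ _) => H.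
transitivity (\int[P]_w (damping `|B t w| * f (Z `|eps * `|B t w| | w))).
  apply: eq_Rintegral => w _; rewrite YZ mulrC /damping normr_id.
  by rewrite (ger0_norm (x := eps * _))// mulr_ge0// ltW.
rewrite H; last by case: hX.
by apply: eq_Rintegral => w _; rewrite semigroupE.
Qed.

Lemma u_epsE t x : 0 < t -> u t x = avg (weight t) x.
Proof.
move=> t0; have /bounded_funP[M fM] := fb.
rewrite u_eps_expectation ?ltW//.
rewrite (brownian_abs_expectation hF hB (g := fun r => damping r * S `|eps * r| f x) (M := M) t0).
- apply: eq_Rintegral => r /set_mem/=; rewrite in_itv/= andbT => r0.
  rewrite mulrA; congr (_ * _); rewrite /heat_weight /gauss_weight /damping gtr0_norm//.
  have -> : expR (- (eps^-1 * r) - (2 * t)^-1 * r ^+ 2) =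
      expR (- (0 * r) - (2 * t)^-1 * r ^+ 2) * expR (- (r / eps)).
    by rewrite -expRD; congr expR; ring.
  by rewrite !hornerC; ring.
- move=> y; apply: cvgM; first exact: continuous_damping.
  exact: (continuous_average_time hF hX).
- move=> y; rewrite normrM -[leRHS]mul1r ler_pM//.
  exact: (average_time_le hF hX).
Qed.

Lemma u_eps0 x : u 0 x = f x.
Proof.
have [Z [_ _ Z0 _ YZ]] := excursion_process_copy (sigma_process_brownian hF hB) x (lexx 0) hY.
case: hB => _ _ B0 _; rewrite /u_eps unlock -/(Rintegral _ _ _) -[RHS](Rintegral_prob_cst P).
apply: eq_Rintegral => w _.
by rewrite YZ B0 normr0 mulr0 Z0 mul0r oppr0 expR0 mulr1.
Qed.

Let b t : R := (2 * t)^-1.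
Let q t n : {poly R} := iter n (dgauss eps^-1 (b t)) ((2 / Num.sqrt (2 * pi * t))%:P).
Let phi t n : R -> R := gauss_weight eps^-1 (b t) (q t n).

Let bphi t n : 0 < t -> exp_bounded (phi t n).
Proof. by move=> t0; apply: exp_bounded_gauss; rewrite invr_gt0 mulr_gt0. Qed.

Let dphi t n r : is_derive r 1 (phi t n) (phi t n.+1 r).
Proof. exact: is_derive_gauss_weight. Qed.

Let gen_phi t n : 0 < t -> has_generator P (X := X) (avg (phi t n))
  (fun x => - eps^-1 * (phi t n 0 * f x + avg (phi t n.+1) x)).
Proof.
move=> t0.
exact: (has_generator_average hF hX cf fb eps0 (bphi n t0) (bphi n.+1 t0)
  (bphi n.+2 t0) (dphi t n) (dphi t n.+1) fA).
Qed.

Let bf : bounded_borel f := bounded_borel_continuous cf fb.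

Let borel_phi t n : 0 < t -> bounded_borel (avg (phi t n)).
Proof. by move=> t0; apply: (bounded_borel_average hF hX) => //; exact: bphi. Qed.

Let uE t : 0 < t -> u t = avg (phi t 0).
Proof. by move=> t0; apply/funext => x; rewrite u_epsE. Qed.

(** One application of the generator costs one derivative of the weight and a
    multiple of [f]; since [f] is in the domain, it can be applied again. *)
Lemma u_eps_generator t : 0 < t ->
  generator S (u t) =
    (fun x => - eps^-1 * phi t 0 0 * f x + - eps^-1 * avg (phi t 1) x).
Proof.
move=> t0; rewrite (uE t0) (has_generatorE (gen_phi 0 t0)).
by apply/funext => x; rewrite mulrDr mulrA.
Qed.

Let gen2 t : 0 < t -> has_generator P (X := X) (generator S (u t))
  (fun x => - eps^-1 * phi t 0 0 * generator S f x +
    - eps^-1 * (- eps^-1 * (phi t 1 0 * f x + avg (phi t 2) x))).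
Proof.
move=> t0; rewrite u_eps_generator//; apply: (has_generator_lin hF hX) => //.
- by apply: bounded_borel_scale; exact: borel_phi.
- exact: in_domain_has_generator.
- by apply: (has_generator_scale hF hX); [exact: borel_phi|exact: gen_phi].
Qed.

Lemma bounded_borel_generator_u t : 0 < t -> bounded_borel (generator S (u t)).
Proof.
move=> t0; rewrite u_eps_generator//; apply: bounded_borel_lin => //.
by apply: bounded_borel_scale; exact: borel_phi.
Qed.

Lemma u_eps_domain t : 0 < t -> in_domain2 S (u t).
Proof.
move=> t0; split; last first.
  by apply: has_generator_domain (gen2 t0); exact: bounded_borel_generator_u.
by rewrite (uE t0); apply: has_generator_domain (gen_phi 0 t0); exact: borel_phi.
Qed.

(** Both sides are combinations of the moments of order 0, 1 and 2 of
    [r |-> S (eps * r) f x] against the same Gaussian, and the coefficients agree.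
    The terms in [f x] and [generator S f x] come from the boundary at [r = 0]. *)
Lemma u_eps_equation t x : 0 < t ->
  is_derive t 1 (u ^~ x)
    ((Num.sqrt (2 * pi * t))^-1 * (eps * generator S f x - eps^-1 * f x)
          + (2 * eps ^+ 2)^-1 * u t x
          - generator S (u t) x
          + eps ^+ 2 / 2 * generator2 S (u t) x).
Proof.
move=> t0; have /bounded_funP[M fM] := fb.
have s0 : Num.sqrt (2 * pi * t) != 0 by rewrite gt_eqF// sqrtr_gt0 !mulr_gt0// pi_gt0.
have bt0 : 0 < b t by rewrite invr_gt0 mulr_gt0.
have cG := continuous_average_time hF hX (eps := eps) cf fb (x := x).
have GM r : `|S `|eps * r| f x| <= M by exact: (average_time_le hF hX).
have D := is_derive_heat_laplace eps^-1 t0 cG GM.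
have E : (fun s => laplace (weight s) (fun r => S `|eps * r| f x)) t = u t x by rewrite u_epsE.
apply: (@near_eq_is_derive _ _ _ (fun s => laplace (weight s) (fun r => S `|eps * r| f x))).
  near=> s; rewrite u_epsE//; near: s; by apply: open_nbhs_nbhs; split => //; exact: open_gt.
apply: (is_derive_eq D).
rewrite /generator2 (has_generatorE (gen2 t0)) u_eps_generator// (uE t0) /average.
set G := fun r => S `|eps * r| f x.
set s := Num.sqrt (2 * pi * t).
have I0 := @laplace_gauss_quadratic R eps^-1 (b t) (2 / s) 0 0 (q t 0) G M bt0 cG GM.
have I1 := @laplace_gauss_quadratic R eps^-1 (b t) (- (eps^-1 * (2 / s)))
  (- (2 * b t * (2 / s))) 0 (q t 1) G M bt0 cG GM.
have I2 := @laplace_gauss_quadratic R eps^-1 (b t) ((eps^-1 ^+ 2 - 2 * b t) * (2 / s))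
  (4 * eps^-1 * b t * (2 / s)) (4 * b t ^+ 2 * (2 / s)) (q t 2) G M bt0 cG GM.
rewrite I0; last by move=> r; rewrite /q hornerC; ring.
rewrite I1; last first.
  move=> r; rewrite /q /= /dgauss.
  rewrite !(poly.derivE, hornerD, hornerN, hornerM, hornerZ, hornerX, hornerC) -/s; ring.
rewrite I2; last first.
  move=> r; rewrite /q /= /dgauss.
  rewrite !(poly.derivE, hornerD, hornerN, hornerM, hornerZ, hornerX, hornerC) -/s; ring.
have -> : phi t 0 0 = 2 / s.
  by rewrite /phi /gauss_weight /q hornerC !expr0n/= !mulr0 subr0 oppr0 expR0 mulr1.
have -> : phi t 1 0 = - (eps^-1 * (2 / s)).
  rewrite /phi /gauss_weight /q /= /dgauss expr0n/= !mulr0 subr0 oppr0 expR0 mulr1.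
  rewrite !(poly.derivE, hornerD, hornerN, hornerM, hornerZ, hornerX, hornerC) -/s; ring.
rewrite -/(b t).
set J0 := laplace (gauss_weight _ _ 1) G; set J1 := laplace (gauss_weight _ _ 'X) G.
set J2 := laplace (gauss_weight _ _ 'X^2) G.
rewrite /b; field.
by rewrite -/s s0 !gt_eqF.
Unshelve. all: by end_near. Qed.

(** Both [S (eps * r) f x - f x] and the damping defect are at most linear in [r]
    and bounded, uniformly in [x]; the modulus is the expectation of such a
    function of [B t]. *)
Lemma u_eps_near_initial : exists2 rho : R -> R,
  continuous rho /\ rho 0 = 0 & forall t x, 0 <= t -> `|u t x - f x| <= rho t.
Proof.
have /bounded_funP[M fM] := fb.
have M0 : 0 <= M by exact: le_trans (normr_ge0 _) (fM 0).
have [L L0 fL] := semigroup_lipschitz hF hX fA.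
pose K := L * eps + M / eps + 2 * M.
have K0 : 0 <= K by rewrite /K !addr_ge0// ?divr_ge0 ?mulr_ge0// ltW.
pose k (y : R) : R := K * (`|y| / (1 + `|y|)).
have ck : continuous k.
  move=> y; apply: cvgM; first exact: cvg_cst.
  apply: cvgM; first exact: norm_continuous.
  apply: cvgV; first by rewrite gt_eqF// ltr_pwDl.
  by apply: cvgD; [exact: cvg_cst|exact: norm_continuous].
have k1 y : `|k y| <= K.
  have y1 : 0 < 1 + `|y| by rewrite ltr_pwDl.
  rewrite /k normrM (ger0_norm K0) ler_piMr// normrM normr_id normfV (gtr0_norm y1).
  by rewrite ler_pdivrMr// mul1r lerDr.
have kbound t x w : `|damping `|B t w| * S `|eps * `|B t w| | f x - f x| <= k (B t w).
  set y := `|B t w|; have y0 : 0 <= y by exact: normr_ge0.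
  have y1 : 0 < 1 + y by rewrite ltr_pwDl.
  have SM : `|S `|eps * y| f x| <= M by exact: (average_time_le hF hX).
  have d1 := damping_le y.
  have h1 : `|damping y * S `|eps * y| f x - f x| <= 2 * M.
    rewrite (le_trans (ler_normB _ _))// mulr_natl mulr2n lerD//.
    by rewrite normrM -[leRHS]mul1r ler_pM.
  have h2 : `|damping y * S `|eps * y| f x - f x| <= (L * eps + M / eps) * y.
    have -> : damping y * S `|eps * y| f x - f x =
      (S `|eps * y| f x - f x) - (1 - damping y) * S `|eps * y| f x by ring.
    apply: (le_trans (ler_normB _ _)); rewrite [leRHS]mulrDl; apply: lerD.
      have := fL `|eps * y| x (normr_ge0 _); rewrite (ger0_norm (x := eps * y)) ?mulr_ge0 ?(ltW eps0)//.
      by rewrite mulrA.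
    rewrite normrM mulrC -mulrA ler_pM//.
    rewrite ger0_norm; last by rewrite subr_ge0 (le_trans (ler_norm _) d1).
    have := expR_ge1Dx (- (`|y| / eps)); rewrite -/(damping y) (ger0_norm y0) mulrC; lra.
  rewrite /k -/y mulrA ler_pdivlMr// mulrDr mulr1.
  have h3 : `|damping y * S `|eps * y| f x - f x| * y <= 2 * M * y by rewrite ler_wpM2r.
  rewrite /K; nra.
pose rho t := \int[P]_w k (B `|t| w).
have mk s : 0 <= s -> measurable_fun setT (fun w => k (B s w)).
  move=> s0; apply: measurableT_comp; first exact: continuous_measurable_fun.
  exact: (measurable_brownian hF hB).
exists rho.
  split.
    apply: (@continuous_expectation _ _ _ P (fun s w => k (B `|s| w)) K) => //.
      by move=> s; exact: mk.
    move=> w s; apply: (@continuous_comp _ _ _ (fun s => B `|s| w) k); last exact: ck.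
    by case: hB => _ cB _ _; exact: (continuous_abs_halfline (cB w)).
  rewrite /rho -[RHS](Rintegral_prob_cst P 0); apply: eq_Rintegral => w _.
  by case: hB => _ _ B0 _; rewrite normr0 B0 /k normr0 mul0r mulr0.
move=> t x t0; rewrite u_eps_expectation// -{1}(Rintegral_prob_cst P (f x)).
have mS : measurable_fun setT (fun w => damping `|B t w| * S `|eps * `|B t w| | f x).
  have : continuous (fun y => damping y * S `|eps * y| f x).
    move=> y; apply: cvgM; first exact: continuous_damping.
    exact: (continuous_average_time hF hX).
  move=> /continuous_measurable_fun H; apply: (measurableT_comp H).
  by apply: measurableT_comp => //; exact: (measurable_brownian hF hB).
rewrite -RintegralB//.
- rewrite /rho (ger0_norm t0); apply: (le_norm_Rintegral measurableT).
  + by apply: measurable_funB.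
  + by apply: (integrable_bounded P (M := K)); [exact: mk|].
  + by move=> w _; exact: kbound.
- apply: (integrable_bounded P (M := M)) => // w; rewrite normrM -[leRHS]mul1r ler_pM//.
  exact: (average_time_le hF hX).
- by apply: (integrable_bounded P (M := M)).
Qed.

Lemma u_eps_initial : initial_condition f u.
Proof.
move=> x; split; first exact: u_eps0.
have [rho [crho rho0] Hrho] := u_eps_near_initial.
apply/cvgrPdist_lt => e e0; have e20 : 0 < e / 2 by rewrite divr_gt0.
have H1 : \forall z \near (0 : R, x), `|f x - f z.2| < e / 2.
  have : f z.2 @[z --> (0 : R, x)] --> f x.
    by apply: (@cvg_comp _ _ _ snd f _ (nbhs x)); [exact: cvg_snd|exact: cf].
  by move=> /cvgrPdist_lt /(_ _ e20).
have H2 : \forall z \near (0 : R, x), `|0 - rho z.1| < e / 2.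
  have : rho z.1 @[z --> (0 : R, x)] --> 0.
    rewrite -[X in _ --> X]rho0; apply: (@cvg_comp _ _ _ fst rho _ (nbhs (0 : R))); [exact: cvg_fst|exact: crho].
  by move=> /cvgrPdist_lt /(_ _ e20).
suff : \forall z \near (0 : R, x), 0 < z.1 -> `|f x - u z.1 z.2| < e by [].
near=> z => z0.
have -> : f x - u z.1 z.2 = (f x - f z.2) - (u z.1 z.2 - f z.2) by ring.
rewrite (le_lt_trans (ler_normB _ _))// (splitr e) ltrD//; first by near: z; exact: H1.
apply: le_lt_trans (Hrho _ _ (ltW z0)) _.
have : `|0 - rho z.1| < e / 2 by near: z; exact: H2.
by rewrite sub0r normrN; apply: le_lt_trans; exact: ler_norm.
Unshelve. all: by end_near. Qed.

Theorem u_eps_solves_generator_pde : solves_generator_pde S eps f u.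
Proof.
split; last exact: u_eps_initial.
move=> t x t0; have D := u_eps_equation x t0; split; first exact: u_eps_domain.
- by case: D.
- by rewrite derive1E; case: D.
Qed.

End generator_equation.

(** * Bounded uniformly continuous functions and their partial derivatives *)

Section directional_derivatives.
Context {R : realType} {V : normedModType R}.
Implicit Types (g : V -> R) (x y v : V).

Lemma is_derive_line g g1 x v : (forall y, is_derive y v g (g1 y)) ->
  forall r : R, is_derive r 1 (fun s : R => g (x + s *: v)) (g1 (x + r *: v)).
Proof.
move=> gv r; have [dg <-] := gv (x + r *: v).
have E : (fun h : R => h^-1 *: (((fun s : R => g (x + s *: v)) \o shift r) (h *: (1 : R)) -
      g (x + r *: v))) =
    (fun h => h^-1 *: ((g \o shift (x + r *: v)) (h *: v) - g (x + r *: v))).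
  apply/funext => h /=; congr (_ *: (g _ - _)).
  by rewrite /GRing.scale/= mulr1 -/(GRing.scale _ _) scalerDl addrCA addrA addrAC -addrA.
by apply: DeriveDef; rewrite ?/derivable ?/derive E.
Qed.

Lemma mean_value_line g g1 x v (k : R) : (forall y, is_derive y v g (g1 y)) ->
  exists2 s : R, `|s| <= `|k| & g (x + k *: v) - g x = k * g1 (x + s *: v).
Proof.
move=> gv; have [s + E] := mean_value_dist 0 k (is_derive_line x gv).
rewrite !subr0 => sk; exists s => //.
by move: E; rewrite scale0r addr0 subr0 mulrC.
Qed.

Lemma taylor2_line g g1 g2 x v (k M : R) :
  (forall y, is_derive y v g (g1 y)) -> (forall y, is_derive y v g1 (g2 y)) ->
  (forall s : R, `|s| <= `|k| -> `|g2 (x + s *: v)| <= M) ->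
  `|g (x + k *: v) - g x - k * g1 x| <= M * k ^+ 2.
Proof.
move=> gv g1v gM.
have := taylor2 (x := 0) (y := k) (M := M) (is_derive_line x gv) (is_derive_line x g1v).
by rewrite subr0 scale0r addr0 mulrC; apply => s; rewrite subr0; exact: gM.
Qed.

Definition buc g : Prop :=
  (exists M : R, forall x, `|g x| <= M) /\
  forall e : R, 0 < e -> exists2 delta : R, 0 < delta &
    forall x y, `|x - y| < delta -> `|g x - g y| <= e.

Lemma buc_continuous g : buc g -> continuous g.
Proof.
move=> [_ gu] x; apply/cvgrPdist_le => e e0; have [delta d0 Hd] := gu e e0.
near=> y; apply: Hd; near: y.
have /cvgrPdist_lt : id @ x --> x by exact: cvg_id.
by apply.
Unshelve. all: by end_near. Qed.

Lemma continuous_translate g y : continuous g -> continuous (fun x => g (x + y)).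
Proof.
move=> cg x; apply: (@cvg_comp _ _ _ (fun x => x + y) g _ (nbhs (x + y))); last exact: cg.
by apply: cvgD; [exact: cvg_id|exact: cvg_cst].
Qed.

Lemma buc_bounded_fun g : buc g -> bounded_fun g.
Proof. by move=> [gM _]; apply/bounded_funP. Qed.

Lemma buc_lin a g g' : buc g -> buc g' -> buc (fun x => a * g x + g' x).
Proof.
move=> [[M gM] gu] [[M' g'M] g'u]; split.
  exists (`|a| * M + M') => x; rewrite (le_trans (ler_normD _ _))// lerD//.
  by rewrite normrM ler_wpM2l.
move=> e e0; have a1 : 0 < `|a| + 1 by rewrite ltr_wpDl.
have [d1 d10 H1] := gu (e / 2 / (`|a| + 1)) (divr_gt0 (divr_gt0 e0 (ltr0Sn _ _)) a1).
have [d2 d20 H2] := g'u (e / 2) (divr_gt0 e0 (ltr0Sn _ _)).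
exists (Num.min d1 d2) => [|x y]; first by rewrite lt_min d10.
rewrite lt_min => /andP[/H1 h1 /H2 h2].
have -> : a * g x + g' x - (a * g y + g' y) = a * (g x - g y) + (g' x - g' y) by ring.
rewrite (le_trans (ler_normD _ _))// (splitr e) lerD// normrM.
apply: (@le_trans _ _ (`|a| * (e / 2 / (`|a| + 1)))); first by rewrite ler_wpM2l.
rewrite mulrCA ler_piMr ?divr_ge0 ?(ltW e0)//.
by rewrite ler_pdivrMr// mul1r lerDl.
Qed.

Lemma buc_translate g y : buc g -> buc (fun x => g (x + y)).
Proof.
move=> [[M gM] gu]; split; first by exists M.
move=> e e0; have [delta d0 H] := gu e e0; exists delta => // x z xz.
by apply: H; rewrite opprD addrACA subrr addr0.
Qed.

(** Landau's interpolation: a first derivative is close to a difference quotient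
    of [g], with an error controlled by the second derivative, so it inherits
    boundedness and uniform continuity from [g]. *)
Lemma buc_interpolation g g1 g2 v (M : R) : buc g ->
  (forall y, is_derive y v g (g1 y)) -> (forall y, is_derive y v g1 (g2 y)) ->
  (forall y, `|g2 y| <= M) -> buc g1.
Proof.
move=> [[N gN] gu] gv g1v g2M.
have M0 : 0 <= M by exact: le_trans (normr_ge0 _) (g2M 0).
have T x k : `|g (x + k *: v) - g x - k * g1 x| <= M * k ^+ 2 by exact: taylor2_line gv g1v _.
split.
  exists (2 * N + M) => x; have := T x 1; rewrite scale1r mul1r expr1n mulr1 => t.
  have -> : g1 x = g (x + v) + - g x - (g (x + v) - g x - g1 x) by ring.
  rewrite (le_trans (ler_normB _ _))// lerD// (le_trans (ler_normD _ _))// normrN.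
  by rewrite mulr_natl mulr2n lerD.
move=> e e0; pose k := e / (4 * (M + 1)).
have k0 : 0 < k by rewrite divr_gt0// mulr_gt0// ltr_wpDl.
have [delta d0 H] := gu (k * e / 4) (divr_gt0 (mulr_gt0 k0 e0) (ltr0Sn _ _)).
exists delta => // x y xy; rewrite -(ler_pM2l k0).
have -> : k * `|g1 x - g1 y| = `|k * (g1 x - g1 y)| by rewrite normrM gtr0_norm.
have -> : k * (g1 x - g1 y) = ((g (x + k *: v) - g (y + k *: v)) - (g x - g y)) -
  ((g (x + k *: v) - g x - k * g1 x) - (g (y + k *: v) - g y - k * g1 y)) by ring.
rewrite (le_trans (ler_normB _ _))//.
have -> : k * e = (k * e / 4 + k * e / 4) + (k * e / 4 + k * e / 4) by field.
have Mk : M * k ^+ 2 <= k * e / 4.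
  rewrite expr2 mulrCA -mulrA ler_pM2l// /k mulrA ler_pdivrMr ?mulr_gt0 ?ltr_wpDl//.
  have -> : e / 4 * (4 * (M + 1)) = M * e + e by field.
  by rewrite lerDl ltW.
rewrite lerD//.
  rewrite (le_trans (ler_normB _ _))// lerD//; last exact: H.
  by apply: H; rewrite opprD addrACA subrr addr0.
by rewrite (le_trans (ler_normB _ _))// lerD// (le_trans (T _ _)).
Qed.

End directional_derivatives.

Section smooth.
Context {R : realType} {d : nat}.
Local Notation V := 'rV[R]_d.
Implicit Types (g : V -> R) (x y : V).

Definition smooth g : Prop :=
  [/\ buc g, has_laplacian g & forall i, buc (partial2 i i g)].

Lemma coord_le_norm x i : `|x ord0 i| <= `|x|.
Proof. by rewrite [leRHS]/Num.Def.normr/= mx_normrE; apply/bigmax_geP; right; exists (ord0, i). Qed.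

Lemma norm_lt_coord x (e : R) : 0 < e -> (forall i, `|x ord0 i| < e) -> `|x| < e.
Proof.
move=> e0 xe; rewrite [ltLHS]/Num.Def.normr/= mx_normrE; apply/bigmax_ltP.
by split=> // -[i j] _ /=; rewrite ord1.
Qed.

Lemma is_derive_partial i g x : derivable g x (delta_mx ord0 i) ->
  is_derive x (delta_mx ord0 i) g (partial i g x).
Proof. by move=> dg; apply: DeriveDef. Qed.

Lemma smooth_derive1 i g x : smooth g -> is_derive x (delta_mx ord0 i) g (partial i g x).
Proof. by move=> [_ /(_ i x)[]] *; exact: is_derive_partial. Qed.

Lemma smooth_derive2 i g x : smooth g ->
  is_derive x (delta_mx ord0 i) (partial i g) (partial2 i i g x).
Proof. by move=> [_ /(_ i x)[]] *; exact: is_derive_partial. Qed.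

Lemma smooth_intro g (g1 g2 : 'I_d -> V -> R) : buc g ->
  (forall i x, is_derive x (delta_mx ord0 i) g (g1 i x)) ->
  (forall i x, is_derive x (delta_mx ord0 i) (g1 i) (g2 i x)) ->
  (forall i, buc (g2 i)) -> smooth g /\ forall x, laplacian g x = \sum_(i < d) g2 i x.
Proof.
move=> bg gg1 g1g2 bg2.
have E1 i : partial i g = g1 i by apply/funext => x; rewrite /partial derive_val.
have E2 i : partial2 i i g = g2 i.
  by apply/funext => x; rewrite /partial2 E1 /partial derive_val.
split; first split=> //.
- by move=> i x; rewrite E1; split; [case: (gg1 i x)|case: (g1g2 i x)].
- by move=> i; rewrite E2.
by move=> x; apply: eq_bigr => i _; rewrite E2.
Qed.

Lemma buc_partial i g : smooth g -> buc (partial i g).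
Proof.
move=> sg; case: (sg) => bg _ /(_ i)[[M gM] _].
exact: (buc_interpolation bg (fun y => smooth_derive1 i y sg) (fun y => smooth_derive2 i y sg) gM).
Qed.

Lemma smooth_lin a g g' : smooth g -> smooth g' ->
  smooth (fun x => a * g x + g' x) /\
  forall x, laplacian (fun x => a * g x + g' x) x = a * laplacian g x + laplacian g' x.
Proof.
move=> sg sg'; case: (sg) (sg') => bg _ bg2 [bg' _ bg2'].
have D (h h' k k' : V -> R) v : (forall x, is_derive x v h (k x)) ->
    (forall x, is_derive x v h' (k' x)) ->
    forall x, is_derive x v (fun x => a * h x + h' x) (a * k x + k' x).
  by move=> hk hk' x; exact: (is_deriveD (is_deriveZ a (hk x)) (hk' x)).
have [] := @smooth_intro (fun x => a * g x + g' x)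
  (fun i x => a * partial i g x + partial i g' x)
  (fun i x => a * partial2 i i g x + partial2 i i g' x).
- exact: buc_lin.
- move=> i; exact: (D _ _ _ _ _ (fun x => smooth_derive1 i x sg) (fun x => smooth_derive1 i x sg')).
- move=> i; exact: (D _ _ _ _ _ (fun x => smooth_derive2 i x sg) (fun x => smooth_derive2 i x sg')).
- by move=> i; exact: buc_lin.
by move=> s E; split=> // x; rewrite E big_split/= -mulr_sumr.
Qed.

Lemma smooth_scale a g : smooth g ->
  smooth (fun x => a * g x) /\ forall x, laplacian (fun x => a * g x) x = a * laplacian g x.
Proof.
move=> sg; have [] := smooth_lin (a - 1) sg sg.
rewrite (_ : (fun x => _) = (fun x => a * g x)); last by apply/funext => x; ring.
by move=> s E; split=> // x; rewrite E; ring.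
Qed.

(** Along a path that changes one coordinate at a time, bounds on the partial
    derivatives control the oscillation. *)
Lemma lipschitz_partial g (L : R) : (forall i x, derivable g x (delta_mx ord0 i)) ->
  (forall i x, `|partial i g x| <= L) ->
  forall x y, `|g x - g y| <= d%:R * L * `|x - y|.
Proof.
move=> dg gL x y; pose w := x - y.
pose z k : V := y + \sum_(i < d | (i < k)%N) w ord0 i *: delta_mx ord0 i.
have zd : z d = x.
  rewrite /z (eq_bigl xpredT) => [|i]; last by rewrite ltn_ord.
  by rewrite -row_sum_delta /w addrCA subrr addr0.
have z0 : z 0%N = y by rewrite /z big_pred0 ?addr0.
have zS (k : 'I_d) : z k.+1 = z k + w ord0 k *: delta_mx ord0 k.
  rewrite /z (bigD1 k)//= addrAC addrA; congr (_ + _ + _); apply: eq_bigl => i.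
  by rewrite ltnS ltn_neqAle andbC.
have -> : g x - g y = \sum_(k < d) (g (z k.+1) - g (z k)).
  by rewrite -zd -z0 -(telescope_sumr (fun k => g (z k)) (leq0n d)) big_mkord.
rewrite (le_trans (ler_norm_sum _ _ _))//.
rewrite -[X in X%:R * L]card_ord -mulrA mulr_natl -sumr_const ler_sum// => k _.
have [s _ E] := mean_value_line (z k) (w ord0 k) (fun y => is_derive_partial (dg k y)).
by rewrite zS E normrM mulrC ler_pM// coord_le_norm.
Qed.

Lemma hoelder_buc (alpha : R) g : 0 < alpha -> bounded_fun g ->
  hoelder_continuous alpha g -> buc g.
Proof.
move=> a0 /bounded_funP bg [C gC]; split=> // e e0.
have C1 : 0 < `|C| + 1 by rewrite ltr_wpDl.
pose q := e / (`|C| + 1); have q0 : 0 < q by rewrite divr_gt0.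
exists (q `^ alpha^-1) => [|x y xy]; first exact: powR_gt0.
apply: le_trans (gC x y) _.
have : `|x - y| `^ alpha <= q.
  rewrite -[leRHS](powRr1 (ltW q0)) -(mulVf (lt0r_neq0 a0)) powRrM.
  by apply: ge0_ler_powR; rewrite ?nnegrE ?powR_ge0// ltW.
move=> /(ler_pM (normr_ge0 C) (powR_ge0 _ _) (lexx _)) h.
apply: le_trans (ler_wpM2r (powR_ge0 _ _) (ler_norm C)) _; apply: le_trans h _.
by rewrite /q mulrCA ler_piMr ?(ltW e0)// ler_pdivrMr// mul1r lerDl.
Qed.

Lemma hoelder_smooth (alpha : R) g : 0 < alpha -> continuous g -> bounded_fun g ->
  (forall i j, [/\ has_partial2 i j g, bounded_fun (partial2 i j g) &
                   hoelder_continuous alpha (partial2 i j g)]) ->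
  smooth g.
Proof.
move=> a0 cg /bounded_funP[N gN] gD.
have D1 i y : is_derive y (delta_mx ord0 i) g (partial i g y).
  by apply: is_derive_partial; case: (gD i i) => /(_ y)[].
have D2 i y : is_derive y (delta_mx ord0 i) (partial i g) (partial2 i i g y).
  by apply: is_derive_partial; case: (gD i i) => /(_ y)[].
have [L gL] : exists L, forall i y, `|partial i g y| <= L.
  have H i : exists L, forall y, `|partial i g y| <= L.
    case: (gD i i) => _ /bounded_funP[M gM] _.
    exists (2 * N + M) => x.
    have := taylor2_line (x := x) (k := 1) (D1 i) (D2 i) (fun s _ => gM _).
    rewrite scale1r mul1r expr1n mulr1 => t; set v := delta_mx _ _ in t.
    have -> : partial i g x = g (x + v) + - g x - (g (x + v) - g x - partial i g x) by ring.
    rewrite (le_trans (ler_normB _ _))// lerD// (le_trans (ler_normD _ _))// normrN.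
    by rewrite mulr_natl mulr2n lerD.
  have [L HL] := choice H.
  exists (\sum_(i < d) `|L i|) => i y; rewrite (le_trans (HL i y))// (bigD1 i)//=.
  by rewrite (le_trans (ler_norm _))// lerDl sumr_ge0.
split=> //.
- split; first by exists N.
  move=> e e0; pose K := `|d%:R * L| + 1; have K0 : 0 < K by rewrite ltr_wpDl.
  exists (e / K) => [|x y xy]; first by rewrite divr_gt0.
  apply: le_trans (lipschitz_partial (fun i y => @ex_derive _ _ _ _ _ _ _ (D1 i y)) gL x y) _.
  apply: (@le_trans _ _ (K * `|x - y|)).
    by rewrite ler_wpM2r// (le_trans (ler_norm _))// lerDl.
  by rewrite mulrC -ler_pdivlMr// ltW.
- by move=> i; case: (gD i i) => _ b h; exact: hoelder_buc b h.
Qed.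

End smooth.

(** * Random vectors with independent coordinates *)

Section finite_approximation.
Context {R : realType}.

(** [inord] sends the cells beyond the grid to [0]; each point is reached by the
    grid once [m] is large. *)
Definition signed_index (m : nat) (y : R) : bool * 'I_(m.+1 ^ 2).+1 :=
  (y < 0, inord (grid_index m `|y|)).

Definition signed_point (m : nat) (k : bool * 'I_(m.+1 ^ 2).+1) : R :=
  (-1) ^+ k.1 * grid_point m k.2.

Lemma signed_point_cvg (y : R) :
  signed_point (signed_index m y) @[m --> \oo] --> y.
Proof.
rewrite {2}[y]numEsign.
have : (-1) ^+ (y < 0)%R * grid_point m (grid_index m `|y|) @[m --> \oo] -->
    (-1) ^+ (y < 0)%R * `|y|.
  by apply: cvgM; [exact: cvg_cst|exact: grid_point_cvg].
apply: cvg_trans; apply: near_eq_cvg; near=> m.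
rewrite /signed_point /= inordK// ltnW// ltnS.
by near: m; exact: grid_index_small.
Unshelve. all: by end_near. Qed.

Lemma measurable_signed_index m k : measurable [set y | signed_index m y = k].
Proof.
have -> : [set y | signed_index m y = k] =
  [set y | (y < 0) = k.1] `&` \bigcup_(n in [set n | inord n = k.2]) [set y : R | grid_index m `|y| = n].
  apply/seteqP; split=> y /=; case: k => s j /=.
    by move=> [-> <-]; split=> //; exists (grid_index m `|y|).
  by move=> [<- [n /= <- <-]].
apply: measurableI; last by apply: bigcup_measurable => n _; exact: measurable_grid_cell.
case: k.1.
  rewrite (_ : [set _ | _] = `]-oo, 0[%classic); first exact: measurable_itv.
  by apply/seteqP; split=> y; rewrite /= in_itv.
rewrite (_ : [set _ | _] = `[0, +oo[%classic); first exact: measurable_itv.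
by apply/seteqP; split=> y; rewrite /= in_itv/= andbT leNgt; case: (y < 0).
Qed.

End finite_approximation.

Section independent_coordinates.
Context {R : realType} {disp : measure_display} {T : measurableType disp}.
Variable P : probability T R.
Context {d : nat}.
Local Notation V := 'rV[R]_d.
Implicit Types (Z : T -> V) (g : V -> R).

Lemma finite_expectation {I : finType} (N : T -> I) (h : I -> R) :
  (forall i, measurable [set w | N w = i]) ->
  \int[P]_w h (N w) = \sum_i h i * fine (P [set w | N w = i]).
Proof.
move=> mN.
have E w : h (N w) = \sum_i h i * \1_[set w | N w = i] w.
  rewrite (bigD1 (N w))//= indicE mem_set// mulr1 big1 ?addr0// => i iN.
  by rewrite indicE memNset ?mulr0//= => Ni; rewrite Ni eqxx in iN.
have iI i : P.-integrable setT (EFin \o \1_[set w | N w = i]).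
  by apply: (integrable_bounded P (M := 1)) => // w; rewrite indicE; case: (_ \in _); rewrite ?normr1 ?normr0.
under eq_Rintegral do rewrite E.
have [] := @Rintegral_sum _ _ _ P setT measurableT _ (index_enum I)
  (fun i w => h i * \1_[set w | N w = i] w).
  by move=> i; have := integrableZl measurableT (h i) (iI i); apply.
move=> _ ->; apply: eq_bigr => i _.
by rewrite RintegralZl// Rintegral_indic_prob.
Qed.

Definition independent_coordinates Z : Prop :=
  (forall i, measurable_fun setT (fun w => Z w ord0 i)) /\
  forall A : 'I_d -> set R, (forall i, measurable (A i)) ->
    P [set w | forall i, A i (Z w ord0 i)] =
    (\big[mule/1]_(i < d) P [set w | A i (Z w ord0 i)])%E.

Let rounded m Z w : {ffun 'I_d -> bool * 'I_(m.+1 ^ 2).+1} :=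
  [ffun i => signed_index m (Z w ord0 i)].

Let grid_vector m (k : {ffun 'I_d -> bool * 'I_(m.+1 ^ 2).+1}) : V :=
  \row_i signed_point (k i).

Let roundedE m Z k : [set w | rounded m Z w = k] =
  [set w | forall i, [set y | signed_index m y = k i] (Z w ord0 i)].
Proof.
apply/seteqP; split=> w /= => [<- i|H]; first by rewrite ffunE.
by apply/ffunP => i; rewrite ffunE H.
Qed.

Let measurable_rounded m Z k : (forall i, measurable_fun setT (fun w => Z w ord0 i)) ->
  measurable [set w | rounded m Z w = k].
Proof.
move=> mZ; rewrite roundedE.
rewrite (_ : [set _ | _] = \bigcap_(i in setT) ((fun w => Z w ord0 i) @^-1` [set y | signed_index m y = k i])).
  apply: fin_bigcap_measurable => // i _.
  by rewrite -[_ @^-1` _]setTI; apply: mZ => //; exact: measurable_signed_index.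
by apply/seteqP; split=> w /= H i; [move=> _; exact: H|exact: (H i I)].
Qed.

Let rounded_cvg g Z w : continuous g ->
  g (grid_vector (rounded m Z w)) @[m --> \oo] --> g (Z w).
Proof.
move=> cg; apply: (@cvg_comp _ _ _ (fun m => grid_vector (rounded m Z w)) g _ (nbhs (Z w))); last exact: cg.
apply/cvgrPdist_lt => e e0; near=> m; apply: norm_lt_coord => // i.
rewrite !mxE ffunE; move: i; near: m; apply: filter_forall => i.
by move/cvgrPdist_lt : (@signed_point_cvg R (Z w ord0 i)); apply.
Unshelve. all: by end_near. Qed.

Let measurable_rounded_comp m g Z : (forall i, measurable_fun setT (fun w => Z w ord0 i)) ->
  measurable_fun setT (fun w => g (grid_vector (rounded m Z w))).
Proof.
move=> mZ _ A mA; rewrite setTI; apply: (measurable_partition P (N := rounded m Z)) => k.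
have [gA|gA] := pselect (A (g (grid_vector k))).
  rewrite (_ : _ `&` _ = [set w | rounded m Z w = k]); first exact: measurable_rounded.
  by apply/seteqP; split=> w /= => [[]//|Nk]; rewrite Nk.
rewrite (_ : _ `&` _ = set0) //; apply/seteqP; split=> w //= [+ Nk].
by rewrite Nk.
Qed.

Lemma measurable_comp_coordinates g Z : (forall i, measurable_fun setT (fun w => Z w ord0 i)) ->
  continuous g -> measurable_fun setT (fun w => g (Z w)).
Proof.
move=> mZ cg; apply: (measurable_fun_cvg (h := fun m w => g (grid_vector (rounded m Z w)))).
  by move=> m; exact: measurable_rounded_comp.
by move=> w _; exact: rounded_cvg.
Qed.

(** After rounding the coordinates to a finite grid, the expectation is a finite
    sum over grid points, weighted by products of one-dimensional probabilities. *)
Lemma eq_coordinate_laws g Z Z' (M : R) :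
  independent_coordinates Z -> independent_coordinates Z' ->
  (forall i A, measurable A ->
    P [set w | A (Z w ord0 i)] = P [set w | A (Z' w ord0 i)]) ->
  continuous g -> (forall x, `|g x| <= M) ->
  \int[P]_w g (Z w) = \int[P]_w g (Z' w).
Proof.
move=> [mZ pZ] [mZ' pZ'] ZZ' cg gM.
have lim (Y : T -> V) : (forall i, measurable_fun setT (fun w => Y w ord0 i)) ->
    \int[P]_w g (grid_vector (rounded m Y w)) @[m --> \oo] --> \int[P]_w g (Y w).
  move=> mY; apply: (@Rintegral_dominated_cvg _ _ _ P setT measurableT
    (fun m w => g (grid_vector (rounded m Y w))) _ (cst M)).
  - by move=> m; exact: measurable_rounded_comp.
  - by move=> w _; exact: rounded_cvg.
  - by apply: finite_measure_integrable_cst; rewrite ?probability_setT ?ltry.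
  - by move=> m w _; exact: gM.
apply: (@cvg_unique _ _ _ _ _ _ (lim Z mZ)) => //.
rewrite (_ : (fun m => \int[P]_w g (grid_vector (rounded m Z w))) =
  (fun m => \int[P]_w g (grid_vector (rounded m Z' w)))); first exact: lim.
apply/funext => m.
rewrite (finite_expectation (fun k => g (grid_vector k)) (fun k => measurable_rounded k mZ)).
rewrite (finite_expectation (fun k => g (grid_vector k)) (fun k => measurable_rounded k mZ')).
apply: eq_bigr => k _; rewrite !roundedE; congr (_ * fine _).
have mk i := measurable_signed_index (k i).
rewrite (pZ (fun i => [set y | signed_index m y = k i]))//.
rewrite (pZ' (fun i => [set y | signed_index m y = k i]))//.
by apply: eq_bigr => i _; exact: (ZZ' i [set y | signed_index m y = k i]).
Qed.

Lemma independent_coordinates_map (phi : 'I_d -> R -> R) Z :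
  (forall i, measurable_fun setT (phi i)) -> independent_coordinates Z ->
  independent_coordinates (fun w => \row_i phi i (Z w ord0 i)).
Proof.
move=> mphi [mZ pZ]; split=> [i|A mA].
  by under eq_fun do rewrite mxE; apply: measurableT_comp.
have E i : [set w | A i ((\row_i phi i (Z w ord0 i) : V) ord0 i)] =
    [set w | (phi i @^-1` A i) (Z w ord0 i)].
  by apply/seteqP; split=> w /=; rewrite mxE.
under eq_bigr do rewrite E.
rewrite -(pZ (fun i => phi i @^-1` A i)) => [|i]; last by rewrite -[_ @^-1` _]setTI; exact: mphi.
by congr (P _); apply/seteqP; split=> w /= H i; have := H i; rewrite mxE.
Qed.

End independent_coordinates.

(** * The semigroup of Brownian motion *)

Section normal_symmetry.
Context {R : realType}.
Local Notation mu := (@lebesgue_measure R).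

Lemma lebesgue_measure_opp (A : set R) : measurable A -> mu (-%R @^-1` A) = mu A.
Proof.
move=> mA.
have mN : @measurable_fun _ _ (measurableTypeR R) (measurableTypeR R) setT (-%R : R -> R).
  exact: oppr_measurable.
pose m : {measure set (measurableTypeR R) -> \bar R} :=
  @pushforward _ _ (measurableTypeR R) (measurableTypeR R) R mu (-%R : R -> R).
rewrite [RHS](lebesgue_measure_unique (mu := m mN))// => _ [[a b] _ <-].
rewrite /m/= /pushforward/=.
have -> : (-%R : R -> R) @^-1` `]a, b]%classic = `[- b, - a[%classic.
  by apply/seteqP; split=> r; rewrite /= !in_itv/= lerNl ltrNr andbC.
rewrite !lebesgue_measure_itv/= !lte_fin ltrN2; case: ifPn => //= _.
by rewrite -EFinD; congr EFin; ring.
Qed.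

Lemma normal_prob_opp (s : R) (A : set R) : s != 0 -> measurable A ->
  normal_prob 0 s (-%R @^-1` A) = normal_prob 0 s A.
Proof.
move=> s0 mA.
have mN : @measurable_fun _ _ (measurableTypeR R) (measurableTypeR R) setT (-%R : R -> R).
  exact: oppr_measurable.
have pN y : normal_pdf 0 s (- y) = normal_pdf 0 s y.
  by rewrite !normal_pdfE// /normal_fun !subr0 sqrrN.
rewrite /normal_prob.
have := @ge0_integral_pushforward _ _ _ _ _ _ mN mu A (EFin \o normal_pdf 0 s) mA.
move=> H; transitivity (\int[mu]_(y in -%R @^-1` A) ((EFin \o normal_pdf 0 s) \o -%R) y)%E.
  by apply: eq_integral => y _; rewrite /= pN.
rewrite -H.
- by apply: eq_measure_integral => B mB _; exact: lebesgue_measure_opp.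
- by apply/measurable_EFinP; apply: measurable_funTS; exact: measurable_normal_pdf.
- by move=> y _; rewrite lee_fin normal_pdf_ge0.
Qed.

End normal_symmetry.

Section brownian_vector.
Context {R : realType} {disp : measure_display} {T : measurableType disp}.
Variable P : probability T R.
Context {d : nat} {F : R -> set (set T)} {X : 'rV[R]_d -> R -> T -> 'rV[R]_d}.
Hypotheses (hF : filtration F) (hX : continuous_markov_process P F X)
  (hW : forall x, brownian_motion_rV P F x (X x)).
Local Notation V := 'rV[R]_d.
Local Notation S := (semigroup P X).
Implicit Types (g : V -> R) (x y : V) (h : R) (i : 'I_d).

Lemma brownian_independent_coordinates x h : 0 <= h -> independent_coordinates P (X x h).
Proof.
move=> h0; have [xB xI] := hW x; case: (hF) => _ Fm _; split=> [i|A mA].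
  move=> _ A mA; rewrite setTI; have [ad _ _ _] := xB i.
  by apply: (Fm h h0); apply: (ad h A h0); apply/borel_setR.
have := xI (index_enum 'I_d) (fun i => [set w | A i (X x h w ord0 i)]) (index_enum_uniq _) _.
rewrite -bigcap_seq => <- => [|i _].
  congr (P _); apply/seteqP; split=> w /= H i; first by move=> _; exact: H.
  by apply: H; rewrite /= mem_index_enum.
apply: sub_gen_smallest; exists h, (A i); split=> //.
by apply/borel_setR.
Qed.

Lemma brownian_coordinate_law x h i (A : set R) : 0 < h -> measurable A ->
  P [set w | A (X x h w ord0 i)] =
  normal_prob 0 (Num.sqrt h) [set y | A (x ord0 i + y)].
Proof.
move=> h0 mA; have [/(_ i)[_ _ B0 BI] _] := hW x.
have mA' : measurable [set y | A (x ord0 i + y)].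
  have := @measurable_funD _ R R setT (fun=> x ord0 i) id (measurable_cst _) (@measurable_id _ _ _).
  by move=> /(_ measurableT A mA); rewrite setTI.
have := BI 0 h setT [set y | A (x ord0 i + y)] (lexx 0) h0.
rewrite probability_setT mul1e subr0 setTI => <-.
- by congr (P _); apply/seteqP; split=> w /=; rewrite B0 addrC subrK.
- by case: hF => /(_ 0 (lexx 0))[s0 sC _] _ _; rewrite -(setD0 setT); exact: sC.
- by apply/borel_setR.
Qed.

(** The increments of the coordinates have laws that do not depend on the starting
    point [x], and by independence they determine the law of the vector. *)
Lemma brownian_semigroupE g (M : R) h x : continuous g -> (forall y, `|g y| <= M) ->
  0 <= h -> S h g x = \int[P]_w g (x + X 0 h w).
Proof.
move=> cg gM; rewrite le_eqVlt => /predU1P[<-|h0]; rewrite semigroupE.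
  case: hX => _ _ X0 _ _.
  by apply: eq_Rintegral => w _; rewrite !X0 addr0.
have mD i : measurable_fun setT (fun y : R => x ord0 i + y).
  exact: (@measurable_funD _ R R setT (fun=> x ord0 i) id (measurable_cst _) (@measurable_id _ _ _)).
have I1 := brownian_independent_coordinates x (ltW h0).
have I2 := independent_coordinates_map mD (brownian_independent_coordinates 0 (ltW h0)).
rewrite (eq_coordinate_laws I1 I2 _ cg gM) => [|i A mA].
  by apply: eq_Rintegral => w _; congr g; apply/rowP => i; rewrite !mxE.
have E : [set w | A ((\row_i0 (x ord0 i0 + X 0 h w ord0 i0) : V) ord0 i)] =
    [set w | [set y | A (x ord0 i + y)] (X 0 h w ord0 i)].
  by apply/seteqP; split=> w /=; rewrite mxE.
rewrite E !brownian_coordinate_law//.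
  by congr normal_prob; apply/seteqP; split=> y /=; rewrite mxE add0r.
by have := mD i measurableT A mA; rewrite setTI.
Qed.

Lemma brownian_semigroup_shift g h x y : continuous g -> bounded_fun g -> 0 <= h ->
  S h g (x + y) = S h (fun z => g (z + y)) x.
Proof.
move=> cg /bounded_funP[M gM] h0.
rewrite (brownian_semigroupE _ cg gM h0) (@brownian_semigroupE _ M)//.
  by apply: eq_Rintegral => w _; rewrite addrAC.
exact: continuous_translate.
Qed.

Definition flip_coordinate i (v : V) : V :=
  \row_j (if j == i then - v ord0 j else v ord0 j).

(** Centred Gaussian laws are symmetric, and independence allows one coordinate to
    be reflected alone. *)
Lemma brownian_flip g (M : R) h i : continuous g -> (forall y, `|g y| <= M) ->
  0 < h -> \int[P]_w g (X 0 h w) = \int[P]_w g (flip_coordinate i (X 0 h w)).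
Proof.
move=> cg gM h0.
pose phi j : R -> R := if j == i then -%R else id.
have mphi j : measurable_fun setT (phi j).
  by rewrite /phi; case: ifP => _; [exact: oppr_measurable|exact: measurable_id].
have I1 := brownian_independent_coordinates 0 (ltW h0).
have I2 := independent_coordinates_map mphi I1.
rewrite (eq_coordinate_laws I1 I2 _ cg gM) => [|j A mA].
  by apply: eq_Rintegral => w _; congr g; apply/rowP => j; rewrite !mxE /phi; case: ifP.
have E : [set w | A ((\row_i0 phi i0 (X 0 h w ord0 i0) : V) ord0 j)] =
    [set w | (phi j @^-1` A) (X 0 h w ord0 j)].
  by apply/seteqP; split=> w /=; rewrite mxE.
have mphiA : measurable (phi j @^-1` A) by have := mphi j measurableT A mA; rewrite setTI.
rewrite E !brownian_coordinate_law//.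
have E0 (B : set R) : [set y | B ((0 : V) ord0 j + y)] = B.
  by apply/seteqP; split=> y /=; rewrite mxE add0r.
rewrite (E0 A) (E0 (phi j @^-1` A)) /phi; case: ifP => // _.
by rewrite normal_prob_opp// gt_eqF// sqrtr_gt0.
Qed.

End brownian_vector.

(** * The generator of Brownian motion *)

Section damped_square.
Context {R : realType}.
Implicit Types (r s : R).

(** A bounded substitute for [r ^+ 2], differing from it by at most [r ^+ 4]: the
    expectations below only involve bounded functions. *)
Definition damped_sq r : R := r ^+ 2 / (1 + r ^+ 2).

Let den_gt0 r : 0 < 1 + r ^+ 2.
Proof. by rewrite ltr_pwDl// sqr_ge0. Qed.

Lemma damped_sq_ge0 r : 0 <= damped_sq r.
Proof. by rewrite divr_ge0 ?sqr_ge0// ltW. Qed.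

Lemma damped_sq_le1 r : damped_sq r <= 1.
Proof. by rewrite ler_pdivrMr// mul1r lerDr. Qed.

Lemma damped_sq_norm1 r : `|damped_sq r| <= 1.
Proof. by rewrite ger0_norm ?damped_sq_ge0// damped_sq_le1. Qed.

Lemma damped_sq_le r : damped_sq r <= r ^+ 2.
Proof. by rewrite ler_pdivrMr// ler_peMr ?sqr_ge0// lerDl sqr_ge0. Qed.

Lemma damped_sq_error r : r ^+ 2 - damped_sq r = r ^+ 2 * damped_sq r.
Proof. by rewrite /damped_sq; field; rewrite gt_eqF. Qed.

Lemma damped_sq0 : damped_sq 0 = 0.
Proof. by rewrite /damped_sq expr0n mul0r. Qed.

Lemma damped_sq_abs r : damped_sq `|r| = damped_sq r.
Proof. by rewrite /damped_sq real_normK ?num_real. Qed.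

Lemma le_damped_sq r s : `|r| <= `|s| -> damped_sq r <= damped_sq s.
Proof.
move=> rs; have : `|r| ^+ 2 <= `|s| ^+ 2 by rewrite lerXn2r ?nnegrE.
rewrite !real_normK ?num_real//.
rewrite /damped_sq ler_pdivrMr// mulrAC ler_pdivlMr// => H.
by rewrite !mulrDr !mulr1 (mulrC (r ^+ 2) (s ^+ 2)) lerD2r.
Qed.

Lemma continuous_damped_sq : continuous damped_sq.
Proof.
have c2 : continuous (fun r => r ^+ 2) by move=> r; exact: exprn_continuous.
move=> r; apply: cvgM; first exact: c2.
apply: cvgV; first by rewrite gt_eqF.
by apply: cvgD; [exact: cvg_cst|exact: c2].
Qed.

Lemma continuous_damped_sq2 : continuous (fun r => damped_sq r ^+ 2).
Proof. by move=> r; under eq_fun do rewrite expr2; apply: cvgM; exact: continuous_damped_sq. Qed.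

Lemma damped_sq2_norm1 r : `|damped_sq r ^+ 2| <= 1.
Proof. by rewrite normrX expr_le1// damped_sq_norm1. Qed.

(** Bounded uniform continuity in a form that can be integrated: the oscillation
    is small up to a multiple of the damped squares of the increments. *)
Lemma buc_damped_modulus {d : nat} (g : 'rV[R]_d -> R) (e : R) : buc g -> 0 < e ->
  exists2 K, 0 <= K & forall x v : 'rV[R]_d,
    `|g (x + v) - g x| <= e + K * \sum_(j < d) damped_sq (v ord0 j).
Proof.
move=> [[N gN] gu] e0; have [delta d0 H] := gu e e0.
have N0 : 0 <= N by exact: le_trans (normr_ge0 _) (gN 0).
have t0 : 0 < damped_sq delta by rewrite /damped_sq divr_gt0// exprn_gt0.
have K0 : 0 <= 2 * N / damped_sq delta.
  by apply: divr_ge0; [exact: mulr_ge0|exact: ltW].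
exists (2 * N / damped_sq delta) => // x v.
have S0 : 0 <= \sum_(j < d) damped_sq (v ord0 j).
  by apply: sumr_ge0 => j _; exact: damped_sq_ge0.
have [vd|dv] := ltP `|v| delta.
  apply: (@le_trans _ _ e); first by apply: H; rewrite addrAC subrr add0r.
  by rewrite lerDl mulr_ge0.
have [j dj] : exists j, delta <= `|v ord0 j|.
  apply/not_existsP => nv; move: dv; rewrite leNgt => /negP; apply.
  by apply: norm_lt_coord => // j; rewrite ltNge; apply/negP; exact: nv.
apply: (@le_trans _ _ (2 * N)).
  by rewrite (le_trans (ler_normB _ _))// mulr_natl mulr2n lerD.
apply: (@le_trans _ _ (2 * N / damped_sq delta * \sum_(j < d) damped_sq (v ord0 j))); last first.
  by rewrite lerDr ltW.
rewrite -mulrA ler_peMr ?mulr_ge0// mulrC ler_pdivlMr// mul1r.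
rewrite (bigD1 j)//= -[leLHS]addr0 lerD//.
  by apply: le_damped_sq; rewrite (gtr0_norm d0).
by apply: sumr_ge0 => i _; exact: damped_sq_ge0.
Qed.

End damped_square.

Section heat_moments.
Context {R : realType} {disp : measure_display} {T : measurableType disp}.
Variable P : probability T R.
Context {F : R -> set (set T)} {B : R -> T -> R}.
Hypotheses (hF : filtration F) (hB : brownian_motion P F 0 B).
Local Notation mu := (@lebesgue_measure R).
Local Notation H := (`]0, +oo[%classic : set R).
Implicit Types (t r : R).

Let c1 : continuous (fun _ : R => 1 : R).
Proof. by move=> r; exact: cvg_cst. Qed.

Let b1 (r : R) : `|1 : R| <= 1.
Proof. by rewrite normr1. Qed.

Lemma heat_mass t : 0 < t -> laplace (heat_weight 0 t) (fun=> 1) = 1.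
Proof.
by move=> t0; rewrite -(brownian_abs_expectation hF hB t0 c1 b1) Rintegral_prob_cst.
Qed.

(** The total mass does not depend on the time; differentiating it gives the
    variance. *)
Lemma heat_variance t : 0 < t ->
  laplace (gauss_weight 0 (2 * t)^-1 ((2 / Num.sqrt (2 * pi * t)) *: 'X^2)) (fun=> 1) = t.
Proof.
move=> t0; set s := Num.sqrt (2 * pi * t).
have s0 : s != 0 by rewrite gt_eqF// sqrtr_gt0 !mulr_gt0// pi_gt0.
have bt0 : 0 < (2 * t)^-1 by rewrite invr_gt0 mulr_gt0.
have := is_derive_heat_laplace 0 t0 c1 b1.
rewrite /= -/s; set I1 := laplace _ _; set I2 := laplace _ _ => D.
have D0 : is_derive t 1 (fun u => laplace (heat_weight 0 u) (fun=> 1)) 0.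
  apply: (near_eq_is_derive _ (is_derive_cst (1 : R) t 1)).
  near=> u; rewrite heat_mass//; near: u; by apply: open_nbhs_nbhs; split => //; exact: open_gt.
have E : (t * s)^-1 * (I1 / t - I2) = 0.
  by rewrite -(@derive_val _ _ _ _ _ _ _ D) (@derive_val _ _ _ _ _ _ _ D0).
have M1 := heat_mass t0.
rewrite /heat_weight (@laplace_gauss_quadratic R 0 (2 * t)^-1 (2 / s) 0 0 _ _ 1 bt0 c1 b1) in M1; last first.
  by move=> r; rewrite hornerC; ring.
rewrite (@laplace_gauss_quadratic R 0 (2 * t)^-1 0 0 (2 / s) _ _ 1 bt0 c1 b1); last first.
  by move=> r; rewrite hornerZ hornerXn; ring.
rewrite -/I1 -/I2 !mul0r !addr0 ?add0r in M1 *.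
have E' : I1 = t * I2.
  have : I1 / t - I2 = 0.
    by apply: (mulfI (x := (t * s)^-1)); rewrite ?E ?mulr0// invr_eq0 mulf_neq0// gt_eqF.
  by move=> /eqP; rewrite subr_eq0 => /eqP <-; field; rewrite gt_eqF.
by rewrite E' mulrCA M1 mulr1.
Unshelve. all: by end_near. Qed.

(** Half of the Gaussian decay absorbs the fourth power, through
    [v * expR (- v) <= 1]. *)
Lemma heat_weight_quartic t r : 0 < t ->
  heat_weight 0 t r * r ^+ 4 <= 128 * t ^+ 2 * heat_weight 0 (2 * t) r.
Proof.
move=> t0; rewrite /heat_weight /gauss_weight !hornerC mul0r oppr0 !sub0r.
set s := Num.sqrt (2 * pi * t); set s' := Num.sqrt (2 * pi * (2 * t)).
have s0 : 0 < s by rewrite sqrtr_gt0 !mulr_gt0// pi_gt0.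
have s'0 : 0 < s' by rewrite sqrtr_gt0 !mulr_gt0// pi_gt0.
have ss' : s' <= 2 * s.
  have -> : 2 * s = Num.sqrt ((2 * s) ^+ 2) by rewrite sqrtr_sqr ger0_norm// mulr_ge0// ltW.
  apply: ler_wsqrtr; rewrite exprMn sqr_sqrtr; last by rewrite !mulr_ge0 ?pi_ge0// ltW.
  have : 0 < pi * t :> R by rewrite mulr_gt0// pi_gt0.
  by rewrite -!mulrA => h; nra.
pose v := (8 * t)^-1 * r ^+ 2.
have v0 : 0 <= v by rewrite mulr_ge0 ?sqr_ge0// invr_ge0 mulr_ge0// ltW.
have -> : - ((2 * t)^-1 * r ^+ 2) = - (4 * v) by rewrite /v; field; rewrite gt_eqF.
have -> : - ((2 * (2 * t))^-1 * r ^+ 2) = - (2 * v) by rewrite /v; field; rewrite gt_eqF.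
have -> : r ^+ 4 = 64 * t ^+ 2 * v ^+ 2 by rewrite /v; field; rewrite gt_eqF.
have ve : v ^+ 2 * expR (- (4 * v)) <= expR (- (2 * v)).
  have -> : - (4 * v) = - (2 * v) - (v + v) by ring.
  rewrite expRD opprD expRD mulrCA ler_piMr ?expR_ge0//.
  have ev : v * expR (- v) <= 1.
    rewrite expRN ler_pdivrMr ?expR_gt0// mul1r.
    by apply: le_trans (expR_ge1Dx v); rewrite lerDr.
  rewrite expr2 mulrACA; rewrite -[leRHS]mulr1 ler_pM// mulr_ge0 ?expR_ge0//.
have cs : s^-1 <= 2 * s'^-1.
  by rewrite ler_pdivlMr// mulrC ler_pdivrMr.
apply: (@le_trans _ _ (2 / s * (64 * t ^+ 2) * expR (- (2 * v)))).
  have -> : 2 / s * expR (- (4 * v)) * (64 * t ^+ 2 * v ^+ 2) =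
    2 / s * (64 * t ^+ 2) * (v ^+ 2 * expR (- (4 * v))) by ring.
  by rewrite ler_wpM2l// mulr_ge0 ?divr_ge0 ?mulr_ge0 ?sqr_ge0// ltW.
rewrite [leRHS]mulrA ler_wpM2r ?expR_ge0//.
have -> : 2 / s * (64 * t ^+ 2) = 128 * t ^+ 2 * s^-1 by ring.
by rewrite ler_wpM2l// mulr_ge0 ?sqr_ge0.
Qed.

Let ew t : 0 < t -> exp_bounded (heat_weight 0 t : R -> R).
Proof. by move=> t0; apply: exp_bounded_gauss; rewrite invr_gt0 mulr_gt0. Qed.

Let w_ge0 t r : 0 <= heat_weight 0 t r.
Proof. by rewrite /heat_weight /gauss_weight hornerC mulr_ge0 ?expR_ge0// divr_ge0 ?sqrtr_ge0. Qed.

Let bound t : 0 < t ->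
  mu.-integrable H (EFin \o (fun r => 128 * t ^+ 2 * (heat_weight 0 (2 * t) r * 1))) /\
  \int[mu]_(r in H) (128 * t ^+ 2 * (heat_weight 0 (2 * t) r * 1)) = 128 * t ^+ 2.
Proof.
move=> t0; have t20 : 0 < 2 * t by rewrite mulr_gt0.
have m1 : measurable_fun H (fun=> 1 : R) by exact: measurable_cst.
have i := integrable_laplace (ew t20) m1 (fun r _ => b1 r).
have mH : measurable H by exact: measurable_itv.
have iZ : mu.-integrable H (fun r => ((128 * t ^+ 2)%:E * (heat_weight 0 (2 * t) r * 1)%:E)%E).
  by apply: integrableZl => //.
split; first by apply: eq_integrable iZ.
by rewrite RintegralZl// -[X in _ * X]/(laplace _ (fun=> 1)) heat_mass// mulr1.
Qed.

Lemma damped_second_moment t : 0 < t ->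
  `|\int[P]_w damped_sq (B t w) - t| <= 128 * t ^+ 2.
Proof.
move=> t0; under eq_Rintegral do rewrite -damped_sq_abs.
rewrite (brownian_abs_expectation hF hB t0 continuous_damped_sq damped_sq_norm1).
have bt0 : 0 < (2 * t)^-1 by rewrite invr_gt0 mulr_gt0.
have := heat_variance t0; set p := gauss_weight _ _ (_ *: _) => tE.
have [iB IB] := bound t0; rewrite -IB -[X in _ - X]tE.
have ep : exp_bounded p by exact: exp_bounded_gauss.
have mH : measurable H by exact: measurable_itv.
have m1 : measurable_fun H (fun=> 1 : R) by exact: measurable_cst.
have mq : measurable_fun H (@damped_sq R).
  by apply: measurable_funTS; apply: continuous_measurable_fun; exact: continuous_damped_sq.
have i1 := integrable_laplace (ew t0) mq (fun r _ => damped_sq_norm1 r).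
have i2 := integrable_laplace ep m1 (fun r _ => b1 r).
rewrite /laplace -RintegralB//; apply: le_norm_Rintegral => //.
  apply: measurable_funB.
    by apply/measurable_EFinP; case/integrableP : i1.
  by apply/measurable_EFinP; case/integrableP : i2.
move=> r _; apply: le_trans (le_trans _ (heat_weight_quartic r t0)) _; last by rewrite mulr1.
have -> : heat_weight 0 t r * damped_sq r - p r * 1 =
    - (heat_weight 0 t r * (r ^+ 2 - damped_sq r)).
  by rewrite /p /heat_weight /gauss_weight hornerZ hornerXn hornerC; ring.
rewrite normrN damped_sq_error ger0_norm; last first.
  apply: mulr_ge0 (w_ge0 _ _) _.
  by apply: mulr_ge0 (sqr_ge0 _) (damped_sq_ge0 _).
rewrite ler_wpM2l// -[r ^+ 4]/(r ^+ (2 + 2)%N) exprD ler_wpM2l ?sqr_ge0//.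
exact: damped_sq_le.
Qed.

Lemma damped_fourth_moment t : 0 < t ->
  \int[P]_w damped_sq (B t w) ^+ 2 <= 128 * t ^+ 2.
Proof.
move=> t0; under eq_Rintegral do rewrite -damped_sq_abs.
rewrite (brownian_abs_expectation hF hB t0 continuous_damped_sq2 damped_sq2_norm1); have [iB <-] := bound t0.
have mq : measurable_fun H (fun r => damped_sq r ^+ 2).
  by apply: measurable_funTS; apply: continuous_measurable_fun; exact: continuous_damped_sq2.
have i1 := integrable_laplace (ew t0) mq (fun r _ => damped_sq2_norm1 r).
have mH : measurable H by exact: measurable_itv.
rewrite /laplace; apply: le_Rintegral => // r _.
apply: le_trans (le_trans _ (heat_weight_quartic r t0)) _; last by rewrite mulr1.
rewrite ler_wpM2l// -[r ^+ 4]/(r ^+ (2 * 2)%N) exprM lerXn2r ?nnegrE ?damped_sq_ge0 ?sqr_ge0//.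
exact: damped_sq_le.
Qed.

End heat_moments.

Section second_order_taylor.
Context {R : realType}.

Lemma taylor2_oscillation (f df ddf : R -> R) (w M : R) :
  (forall z : R, is_derive z 1 f (df z)) ->
  (forall z : R, is_derive z 1 df (ddf z)) ->
  (forall z, `|z| <= `|w| -> `|ddf z - ddf 0| <= M) ->
  `|f w - f 0 - df 0 * w - 2^-1 * ddf 0 * w ^+ 2| <= M * w ^+ 2.
Proof.
move=> fdf dfddf ddfM; set c := ddf 0.
have Dc (z : R) : is_derive z 1 (fun s : R => 2^-1 * c * s ^+ 2) (c * z).
  apply: (@is_derive_quadratic _ _ _ _ `|2^-1 * c| 1) => // k _.
  have -> : 2^-1 * c * (z + k) ^+ 2 - 2^-1 * c * z ^+ 2 - k * (c * z) = 2^-1 * c * k ^+ 2 by field.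
  by rewrite normrM (ger0_norm (sqr_ge0 k)).
have D1 (z : R) : is_derive z 1 (fun s => f s - 2^-1 * c * s ^+ 2) (df z - c * z).
  exact: (is_deriveB (fdf z) (Dc z)).
have D2 (z : R) : is_derive z 1 (fun s => df s - c * s) (ddf z - c).
  exact: (is_deriveB (dfddf z) (is_derive_mulc c z)).
have := taylor2 (x := 0) (y := w) D1 D2 (M := M).
rewrite !subr0 expr0n/= !mulr0 !subr0 => H.
rewrite (_ : _ - _ - _ - _ = f w - 2^-1 * c * w ^+ 2 - f 0 - df 0 * w); last by ring.
by apply: H => z; rewrite subr0; exact: ddfM.
Qed.

End second_order_taylor.

Section coordinate_path.
Context {R : realType} {d : nat}.
Local Notation V := 'rV[R]_d.
Local Notation e_ k := (delta_mx ord0 k : V).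
Implicit Types (g : V -> R) (x v : V) (k : 'I_d).

(** A path from [0] to [v] that changes one coordinate at a time. *)
Definition first_coordinates (k : nat) v : V :=
  \row_j (if (j < k)%N then v ord0 j else 0).

Lemma first_coordinates0 v : first_coordinates 0 v = 0.
Proof. by apply/rowP => j; rewrite !mxE. Qed.

Lemma first_coordinates_all v : first_coordinates d v = v.
Proof. by apply/rowP => j; rewrite !mxE ltn_ord. Qed.

Lemma first_coordinatesS k v :
  first_coordinates k.+1 v = first_coordinates k v + v ord0 k *: e_ k.
Proof.
apply/rowP => j; rewrite !mxE eqxx/= ltnS leq_eqVlt.
have [->|jk] /= := eqVneq j k; first by rewrite eqxx/= ltnn add0r mulr1.
by rewrite mulr0 addr0 (inj_eq val_inj) (negbTE jk).
Qed.

Lemma first_coordinatesS_flip k v :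
  first_coordinates k.+1 (flip_coordinate k v) = first_coordinates k v - v ord0 k *: e_ k.
Proof.
apply/rowP => j; rewrite !mxE eqxx/= ltnS leq_eqVlt.
have [->|jk] /= := eqVneq j k; first by rewrite eqxx/= ltnn add0r mulr1.
by rewrite mulr0 subr0 (inj_eq val_inj) (negbTE jk).
Qed.

Lemma buc_first_coordinates (k : nat) g x : buc g -> buc (fun v => g (x + first_coordinates k v)).
Proof.
move=> [[N gN] gu]; split; first by exists N.
move=> e e0; have [delta d0 H] := gu e e0; exists delta => // v v' vv'.
apply: H; apply: norm_lt_coord => // j; rewrite opprD addrACA subrr add0r !mxE.
case: ifP => _; last by rewrite subr0 normr0.
by apply: le_lt_trans vv'; have := coord_le_norm (v - v') j; rewrite !mxE.
Qed.

Lemma damped_sq_sum_first_coordinates (k : nat) v :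
  \sum_(j < d) damped_sq (first_coordinates k v ord0 j) <= \sum_(j < d) damped_sq (v ord0 j).
Proof.
apply: ler_sum => j _; rewrite mxE; case: ifP => // _.
by rewrite damped_sq0 damped_sq_ge0.
Qed.

Definition symmetric_difference g x k v : R :=
  g (x + first_coordinates k.+1 v) + g (x + first_coordinates k.+1 (flip_coordinate k v))
    - 2 * g (x + first_coordinates k v).

(** Second-order Taylor expansion, in which the first-order terms cancel. The error
    is controlled by damped squares, whose expectations are known: at time [h] the
    first term is close to [e * h] and the second one at most a multiple of
    [h ^+ 2]. *)
Lemma symmetric_difference_le g x (e : R) : smooth g -> 0 < e ->
  exists2 K, 0 <= K & forall k v,
    `|symmetric_difference g x k v - damped_sq (v ord0 k) * partial2 k k g x| <=
      e * damped_sq (v ord0 k) + K * \sum_(j < d) damped_sq (v ord0 j) ^+ 2.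
Proof.
move=> sg e0; have [[[N gN] _] _ bg2] := sg.
have N0 : 0 <= N by exact: le_trans (normr_ge0 _) (gN 0).
have e50 : 0 < e / 5 by rewrite divr_gt0.
have [M M0 gM] : exists2 M, 0 <= M & forall k y, `|partial2 k k g y| <= M.
  have [M HM] := choice (fun k => (bg2 k).1).
  exists (\sum_(k < d) `|M k|) => [|k y]; first by rewrite sumr_ge0.
  rewrite (le_trans (HM k y))// (bigD1 k)//= (le_trans (ler_norm _))// lerDl.
  by rewrite sumr_ge0.
have [K1 K10 gK] : exists2 K1, 0 <= K1 & forall k x v,
    `|partial2 k k g (x + v) - partial2 k k g x| <=
      e / 5 + K1 * \sum_(j < d) damped_sq (v ord0 j).
  have H k : exists K1, 0 <= K1 /\ forall x v,
      `|partial2 k k g (x + v) - partial2 k k g x| <=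
      e / 5 + K1 * \sum_(j < d) damped_sq (v ord0 j).
    by have [K1 ? ?] := buc_damped_modulus (bg2 k) e50; exists K1.
  have [K1 HK1] := choice H.
  exists (\sum_(k < d) K1 k) => [|k y v].
    by apply: sumr_ge0 => k _; case: (HK1 k).
  apply: (le_trans ((HK1 k).2 y v)); rewrite lerD2l ler_wpM2r//.
    by apply: sumr_ge0 => j _; exact: damped_sq_ge0.
  rewrite (bigD1 k)//= lerDl; apply: sumr_ge0 => j _; by case: (HK1 j).
exists (4 * K1 + 2 * M + (d%:R + 1) * K1 + 4 * (4 * N + M)) => [|k v].
  by rewrite !addr_ge0// mulr_ge0// addr_ge0// mulr_ge0.
set w := v ord0 k; set th := damped_sq w; set y := x + first_coordinates k v.
set Q := \sum_(j < d) damped_sq (v ord0 j) ^+ 2.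
have th0 : 0 <= th by exact: damped_sq_ge0.
have thQ : th ^+ 2 <= Q.
  by rewrite /Q (bigD1 k)//= lerDl sumr_ge0// => j _; exact: sqr_ge0.
have A : symmetric_difference g x k v =
    g (y + w *: e_ k) + g (y + (- w) *: e_ k) - 2 * g y.
  by rewrite /symmetric_difference first_coordinatesS first_coordinatesS_flip scaleNr !addrA.
rewrite A; set a := _ + _ - 2 * g y.
have Q0 : 0 <= Q by apply: sumr_ge0 => j _; exact: sqr_ge0.
(* For a large increment everything is bounded, and [th] is at least [1 / 2]. *)
have [w1|w1] := leP `|w| 1; last first.
  have th1 : 1 <= 4 * th ^+ 2.
    have : 1 / 2 <= th.
      have ww : 1 <= w ^+ 2 by rewrite -(real_normK (num_real w)) exprn_ege1// ltW.
      rewrite /th /damped_sq ler_pdivlMr ?ltr_pwDl ?sqr_ge0//; lra.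
    by move=> h; nra.
  have a1 : `|a - th * partial2 k k g x| <= 4 * N + M.
    rewrite (le_trans (ler_normB _ _))// lerD//.
      have -> : 4 * N = (N + N) + 2 * N by ring.
      rewrite (le_trans (ler_normB _ _))// lerD//.
        by rewrite (le_trans (ler_normD _ _))// lerD.
      by rewrite normrM ger0_norm// ler_wpM2l.
    rewrite normrM -[leRHS]mul1r ler_pM//; exact: damped_sq_norm1.
  apply: (le_trans a1).
  apply: (@le_trans _ _ (4 * (4 * N + M) * th ^+ 2)).
    by rewrite mulrAC ler_peMl// addr_ge0// mulr_ge0.
  apply: (@le_trans _ _ (4 * (4 * N + M) * Q)).
    by rewrite ler_wpM2l// mulr_ge0// addr_ge0// mulr_ge0.
  rewrite -[leLHS]add0r lerD//; first by rewrite mulr_ge0// ltW.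
  by rewrite ler_wpM2r// lerDr !addr_ge0// mulr_ge0// addr_ge0.
have osc (z : R) : `|z| <= `|w| ->
    `|partial2 k k g (y + z *: e_ k) - partial2 k k g (y + 0 *: e_ k)| <= e / 5 + K1 * th.
  move=> zw; rewrite scale0r addr0; apply: (le_trans (gK k y _)).
  rewrite lerD2l ler_wpM2l// (bigD1 k)//= big1 => [|j jk].
    by rewrite addr0 !mxE !eqxx mulr1; exact: le_damped_sq.
  by rewrite !mxE eqxx (negbTE jk) mulr0 damped_sq0.
have D1 := is_derive_line y (fun z => smooth_derive1 k z sg).
have D2 := is_derive_line y (fun z => smooth_derive2 k z sg).
have t1 := taylor2_oscillation D1 D2 osc.
have osc' (z : R) : `|z| <= `|- w| ->
    `|partial2 k k g (y + z *: e_ k) - partial2 k k g (y + 0 *: e_ k)| <= e / 5 + K1 * th.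
  by rewrite normrN; exact: osc.
have t2 := taylor2_oscillation D1 D2 osc'.
rewrite scale0r addr0 sqrrN in t1 t2.
set g2 := partial2 k k g in t1 t2 *.
have w2 : w ^+ 2 <= 2 * th.
  have ww : w ^+ 2 <= 1 by rewrite -(real_normK (num_real w)) exprn_ile1.
  rewrite /th /damped_sq mulrA ler_pdivlMr ?ltr_pwDl ?sqr_ge0//.
  have := sqr_ge0 w; nra.
have b1 : `|a - w ^+ 2 * g2 y| <= 2 * (e / 5 + K1 * th) * w ^+ 2.
  have -> : a - w ^+ 2 * g2 y =
    (g (y + w *: e_ k) - g y - partial k g y * w - 2^-1 * g2 y * w ^+ 2) +
    (g (y + (- w) *: e_ k) - g y - partial k g y * (- w) - 2^-1 * g2 y * w ^+ 2).
    by rewrite /a; field.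
  apply: le_trans (ler_normD _ _) _; rewrite -[leRHS]mulrA mulr_natl mulr2n.
  exact: lerD.
have b2 : `|(w ^+ 2 - th) * g2 y| <= 2 * M * th ^+ 2.
  rewrite normrM damped_sq_error ger0_norm; last exact: (mulr_ge0 (sqr_ge0 _) th0).
  rewrite -/th.
  have -> : 2 * M * th ^+ 2 = (2 * th * th) * M by ring.
  by apply: ler_pM; [exact: (mulr_ge0 (sqr_ge0 _) th0)|by []|rewrite ler_wpM2r|exact: gM].
have b3 : `|th * (g2 y - g2 x)| <= e / 5 * th + K1 * ((d%:R + 1) * Q).
  rewrite normrM ger0_norm//.
  apply: (@le_trans _ _ (th * (e / 5 + K1 * \sum_(j < d) damped_sq (v ord0 j)))).
    rewrite ler_wpM2l//; apply: (le_trans (gK k x _)).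
    by rewrite lerD2l ler_wpM2l//; exact: damped_sq_sum_first_coordinates.
  rewrite mulrDr mulrC lerD2l mulrCA ler_wpM2l// mulr_sumr.
  have -> : (d%:R + 1) * Q = \sum_(j < d) (Q + damped_sq (v ord0 j) ^+ 2).
    by rewrite big_split/= sumr_const card_ord -/Q mulrDl mul1r mulr_natl.
  apply: ler_sum => j _; have := damped_sq_ge0 (v ord0 j).
  move: (damped_sq _) => q q0; have := sqr_ge0 (th - q); nra.
have decompose (p q r s t : R) : p - q * r = (p - s * t) + (s - q) * t + q * (t - r) by ring.
rewrite (decompose a th (g2 x) (w ^+ 2) (g2 y)).
apply: le_trans (ler_normD _ _) _.
apply: (le_trans (lerD (le_trans (ler_normD _ _) (lerD b1 b2)) b3)).
have b4 : 2 * (e / 5 + K1 * th) * w ^+ 2 <= 2 * (e / 5 + K1 * th) * (2 * th).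
  apply: ler_wpM2l => //; apply: mulr_ge0 => //.
  by apply: addr_ge0; [exact: ltW|exact: mulr_ge0].
apply: (le_trans (lerD (lerD b4 (lexx _)) (lexx _))).
have b5 : (4 * K1 + 2 * M) * th ^+ 2 <= (4 * K1 + 2 * M) * Q.
  by rewrite ler_wpM2l// addr_ge0// mulr_ge0.
have b6 : 0 <= 4 * (4 * N + M) * Q by rewrite mulr_ge0// mulr_ge0// addr_ge0// mulr_ge0.
rewrite -subr_ge0; rewrite -subr_ge0 in b5.
have -> : e * th + (4 * K1 + 2 * M + (d%:R + 1) * K1 + 4 * (4 * N + M)) * Q -
  (2 * (e / 5 + K1 * th) * (2 * th) + 2 * M * th ^+ 2 +
    (e / 5 * th + K1 * ((d%:R + 1) * Q))) =
  ((4 * K1 + 2 * M) * Q - (4 * K1 + 2 * M) * th ^+ 2) + 4 * (4 * N + M) * Q by field.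
by rewrite addr_ge0.
Qed.

End coordinate_path.

Section brownian_generator.
Context {R : realType} {disp : measure_display} {T : measurableType disp}.
Variable P : probability T R.
Context {d : nat} {F : R -> set (set T)} {X : 'rV[R]_d -> R -> T -> 'rV[R]_d}.
Hypotheses (hF : filtration F) (hX : continuous_markov_process P F X)
  (hW : forall x, brownian_motion_rV P F x (X x)).
Local Notation V := 'rV[R]_d.
Local Notation S := (semigroup P X).
Local Notation W := (X 0).
Implicit Types (g : V -> R) (x v : V) (h e : R) (k : 'I_d).

Let W_coordinate k : brownian_motion P F 0 (fun t w => W t w ord0 k).
Proof. by have [/(_ k)] := hW 0; rewrite mxE. Qed.

Let mW h k : 0 <= h -> measurable_fun setT (fun w => W h w ord0 k).
Proof. by move=> h0; have [] := brownian_independent_coordinates hF hW 0 h0. Qed.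

Let integrable_W g h : 0 <= h -> buc g -> P.-integrable setT (EFin \o (fun w => g (W h w))).
Proof.
move=> h0 bg; have [[M gM] _] := bg; apply: (integrable_bounded P (M := M)) => //.
by apply: measurable_comp_coordinates (buc_continuous bg) => // k; exact: mW.
Qed.

Let integrable_damped (q : R -> R) h k : continuous q -> (forall r, `|q r| <= 1) -> 0 <= h ->
  P.-integrable setT (EFin \o (fun w => q (W h w ord0 k))).
Proof.
move=> cq q1 h0; apply: (integrable_bounded P (M := 1)) => //.
by apply: measurableT_comp; [exact: continuous_measurable_fun|exact: mW].
Qed.

Let integrable_flip g x h k : buc g -> 0 <= h ->
  P.-integrable setT (EFin \o (fun w => g (x + first_coordinates k.+1 (flip_coordinate k (W h w))))).
Proof.
move=> bg h0; have bG := buc_first_coordinates k.+1 x bg.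
have [[M gM] _] := bG; apply: (integrable_bounded P (M := M)) => //.
apply: (measurable_comp_coordinates P (Z := fun w => flip_coordinate k (W h w)) _ (buc_continuous bG)).
move=> j; under eq_fun do rewrite mxE; case: eqP => _; last exact: mW.
by apply: measurableT_comp => //; exact: mW.
Qed.

(** By the symmetry of the [k]-th coordinate, the increment may be averaged over
    its sign, which removes the first-order term. *)
Lemma brownian_symmetric_difference g x h k : buc g -> 0 < h ->
  2 * (\int[P]_w g (x + first_coordinates k.+1 (W h w)) -
       \int[P]_w g (x + first_coordinates k (W h w))) =
  \int[P]_w symmetric_difference g x k (W h w).
Proof.
move=> bg h0; have bG j := buc_first_coordinates j x bg.
have [[M gM] _] := bG k.+1.
have flip := brownian_flip hF hW k (buc_continuous (bG k.+1)) gM h0.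
have i1 := integrable_W (ltW h0) (bG k.+1); have i0 := integrable_W (ltW h0) (bG k).
have i2 := integrable_flip x k bg (ltW h0).
have i3 : P.-integrable setT (EFin \o (fun w => 2 * g (x + first_coordinates k (W h w)))).
  by have := integrableZl measurableT 2 i0; apply.
rewrite /symmetric_difference RintegralB//; last first.
  by have := integrableD measurableT i1 i2; apply.
rewrite RintegralD// RintegralZl// -flip; ring.
Qed.

Let expected_error g x h e K : smooth g -> 0 < h -> 0 < e -> 0 <= K ->
  (forall k v, `|symmetric_difference g x k v - damped_sq (v ord0 k) * partial2 k k g x| <=
      e * damped_sq (v ord0 k) + K * \sum_(j < d) damped_sq (v ord0 j) ^+ 2) ->
  forall k, `|\int[P]_w symmetric_difference g x k (W h w) - h * partial2 k k g x| <=
    128 * h ^+ 2 * `|partial2 k k g x| + (e * (h + 128 * h ^+ 2) + K * (d%:R * (128 * h ^+ 2))).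
Proof.
move=> [bg _ _] h0 e0 K0 HK k; set c := partial2 k k g x.
have bG j := buc_first_coordinates j x bg.
have i0 := integrable_W (ltW h0) (bG k).
have i1 := integrable_W (ltW h0) (bG k.+1).
have i2 := integrable_flip x k bg (ltW h0).
have i3 : P.-integrable setT (EFin \o (fun w => 2 * g (x + first_coordinates k (W h w)))).
  by have := integrableZl measurableT 2 i0; apply.
have i12 := integrableD measurableT i1 i2.
have iS : P.-integrable setT (EFin \o (fun w => symmetric_difference g x k (W h w))).
  by have := integrableB measurableT i12 i3; apply.
have iq j := integrable_damped j (@continuous_damped_sq R) (@damped_sq_norm1 R) (ltW h0).
have iq2 j := integrable_damped j (@continuous_damped_sq2 R) (@damped_sq2_norm1 R) (ltW h0).
have ic : P.-integrable setT (EFin \o (fun w => damped_sq (W h w ord0 k) * c)).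
  by have := integrableZr measurableT c (iq k); apply.
have [iQ EQ] := Rintegral_sum measurableT (index_enum 'I_d) iq2.
have ie : P.-integrable setT (EFin \o (fun w => e * damped_sq (W h w ord0 k))).
  by have := integrableZl measurableT e (iq k); apply.
have iK : P.-integrable setT
    (EFin \o (fun w => K * \sum_(j < d) damped_sq (W h w ord0 j) ^+ 2)).
  by have := integrableZl measurableT K iQ; apply.
have m2 := damped_second_moment hF (W_coordinate k) h0.
rewrite (_ : _ - _ = (\int[P]_w symmetric_difference g x k (W h w) -
  \int[P]_w (damped_sq (W h w ord0 k) * c)) +
  (\int[P]_w damped_sq (W h w ord0 k) - h) * c); last first.
  by rewrite RintegralZr//; ring.
rewrite (le_trans (ler_normD _ _))// addrC lerD//.
  by rewrite normrM ler_wpM2r.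
rewrite -RintegralB//.
apply: (@le_trans _ _ (\int[P]_w (e * damped_sq (W h w ord0 k) +
    K * \sum_(j < d) damped_sq (W h w ord0 j) ^+ 2))).
  apply: (le_norm_Rintegral measurableT) => //.
  - by have /integrableP[] := integrableB measurableT iS ic => /measurable_EFinP.
  - by have := integrableD measurableT ie iK; apply.
rewrite RintegralD// RintegralZl// RintegralZl// EQ lerD//.
  by rewrite ler_wpM2l ?(ltW e0)// -lerBlDl (le_trans (ler_norm _)).
rewrite ler_wpM2l// -[X in _ <= X%:R * _]card_ord mulr_natl -sumr_const ler_sum// => j _.
exact: (damped_fourth_moment hF (W_coordinate j) h0).
Qed.

(** Each coordinate of the increment contributes half of a second derivative times
    its variance. *)
Lemma brownian_generator g x : smooth g -> generator S g x = 2^-1 * laplacian g x.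
Proof.
move=> sg; have [bg _ _] := sg; have [[N gN] _] := bg.
apply: cvg_lim => //; apply/cvgrPdist_le => eps eps0.
pose e := eps / (d%:R + 1).
have d10 : 0 < d%:R + 1 :> R by rewrite ltr_wpDl.
have e0 : 0 < e by rewrite divr_gt0.
have [K K0 HK] := symmetric_difference_le x sg e0.
pose L := \sum_(k < d) `|partial2 k k g x|.
have L0 : 0 <= L by apply: sumr_ge0.
pose C := 128 * (L + d%:R * (e + K * d%:R)).
have C0 : 0 <= C.
  by rewrite mulr_ge0// addr_ge0// mulr_ge0// addr_ge0 ?mulr_ge0// ltW.
near=> h; have h0 : 0 < h by near: h; exact: nbhs_right_gt.
have hC : C * h <= eps.
  apply: (@le_trans _ _ ((C + 1) * h)); first by rewrite ler_wpM2r ?(ltW h0)// lerDl.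
  rewrite mulrC -ler_pdivlMr ?ltr_wpDl//; near: h; apply: nbhs_right_le.
  by rewrite divr_gt0// ltr_wpDl.
pose a (k : nat) := \int[P]_w g (x + first_coordinates k (W h w)).
have SE : 2 * (S h g x - g x) = \sum_(k < d) \int[P]_w symmetric_difference g x k (W h w).
  have -> : S h g x = a d.
    rewrite (brownian_semigroupE hF hX hW x (buc_continuous bg) gN (ltW h0)).
    by apply: eq_Rintegral => w _; rewrite first_coordinates_all.
  have -> : g x = a 0%N.
    rewrite -[LHS](Rintegral_prob_cst P).
    by apply: eq_Rintegral => w _; rewrite first_coordinates0 addr0.
  rewrite -(telescope_sumr a (leq0n d)) big_mkord mulr_sumr.
  by apply: eq_bigr => k _; exact: brownian_symmetric_difference.
have bound : `|2 * (S h g x - g x) - h * laplacian g x| <= h * (d%:R * e + C * h).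
  rewrite SE /laplacian mulr_sumr -sumrB (le_trans (ler_norm_sum _ _ _))//.
  apply: (le_trans (ler_sum _ (fun k _ => expected_error sg h0 e0 K0 HK k))).
  rewrite big_split/= -mulr_sumr -/L sumr_const card_ord -mulr_natl /C.
  by rewrite le_eqVlt; apply/orP; left; apply/eqP; ring.
have -> : 2^-1 * laplacian g x - (S h g x - g x) / h =
    - ((2 * h)^-1 * (2 * (S h g x - g x) - h * laplacian g x)).
  by field; rewrite gt_eqF.
have h20 : 0 < 2 * h by rewrite mulr_gt0.
rewrite normrN normrM gtr0_norm ?invr_gt0// mulrC ler_pdivrMr//.
apply: (le_trans bound); have -> : eps * (2 * h) = h * (eps + eps) by ring.
apply: ler_wpM2l; first exact: ltW.
apply: lerD => //; rewrite /e mulrCA ler_piMr ?(ltW eps0)// ler_pdivrMr// mul1r.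
by rewrite lerDl.
Unshelve. all: by end_near. Qed.

End brownian_generator.

(** * The equation with Laplacians *)

Section brownian_average.
Context {R : realType} {disp : measure_display} {T : measurableType disp}.
Variable P : probability T R.
Context {d : nat} {F : R -> set (set T)} {X : 'rV[R]_d -> R -> T -> 'rV[R]_d}.
Hypotheses (hF : filtration F) (hX : continuous_markov_process P F X)
  (hW : forall x, brownian_motion_rV P F x (X x)).
Local Notation V := 'rV[R]_d.
Local Notation S := (semigroup P X).
Implicit Types (g : V -> R) (x y v : V).
Variables (eps : R) (phi : R -> R).
Hypothesis bphi : exp_bounded phi.
Local Notation Q g := (@average R disp T P d X g eps phi).

Let measurable_time g x : buc g ->
  measurable_fun (`]0, +oo[%classic : set R) (fun r => S `|eps * r| g x).
Proof.
move=> bg; apply: measurable_funTS; apply: continuous_measurable_fun.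
exact: (continuous_average_time hF hX (buc_continuous bg) (buc_bounded_fun bg)).
Qed.

Let average_lin a g g' x : buc g -> buc g' ->
  Q (fun y => a * g y + g' y) x = a * Q g x + Q g' x.
Proof.
move=> bg bg'; have [[M gM] _] := bg; have [[M' g'M] _] := bg'.
have b := bounded_borel_continuous (buc_continuous bg) (buc_bounded_fun bg).
have b' := bounded_borel_continuous (buc_continuous bg') (buc_bounded_fun bg').
rewrite /average -(@laplace_linr _ a phi _ _ M M')//; try exact: measurable_time.
- by apply: eq_Rintegral => r _; rewrite (semigroup_lin hF hX).
- by move=> r _; exact: (average_time_le hF hX eps (buc_continuous bg) (buc_bounded_fun bg)).
- by move=> r _; exact: (average_time_le hF hX eps (buc_continuous bg') (buc_bounded_fun bg')).
Qed.

Let average_bound : exists2 C, 0 <= C &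
  forall g x (e : R), buc g -> (forall y, `|g y| <= e) -> `|Q g x| <= C * e.
Proof.
have [cphi [C C0 phiC]] := bphi.
exists (C * exp_mass) => [|g x e bg ge]; first by rewrite mulr_ge0// exp_mass_ge0.
rewrite mulrAC; apply: le_laplace => //.
- exact: measurable_time.
- exact: le_trans (normr_ge0 _) (ge 0).
- by move=> r r0; have := phiC r; rewrite (gtr0_norm r0).
- by move=> r _; exact: (average_time_le hF hX eps (buc_continuous bg) (buc_bounded_fun bg)).
Qed.

Lemma average_translate g x y : buc g -> Q g (x + y) = Q (fun z => g (z + y)) x.
Proof.
move=> bg; apply: eq_Rintegral => r _; congr (_ * _).
exact: (brownian_semigroup_shift hF hX hW _ _ (buc_continuous bg) (buc_bounded_fun bg)).
Qed.

Lemma buc_average g : buc g -> buc (Q g).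
Proof.
move=> bg; have [C C0 QC] := average_bound; have [[M gM] gu] := bg.
split; first by exists (C * M) => x; exact: QC.
move=> e e0; have C1 : 0 < C + 1 by rewrite ltr_wpDl.
have [delta d0 H] := gu (e / (C + 1)) (divr_gt0 e0 C1).
exists delta => // x y xy.
have -> : Q g x - Q g y = Q (fun z => (-1) * g (z + y) + g (z + x)) 0.
  rewrite average_lin; try exact: buc_translate.
  by rewrite -!average_translate// !add0r; ring.
apply: (@le_trans _ _ (C * (e / (C + 1)))).
  apply: QC => [|z]; first by apply: buc_lin; exact: buc_translate.
  rewrite mulN1r addrC; apply: H.
  by rewrite opprD addrACA subrr add0r.
by rewrite mulrCA ler_piMr ?(ltW e0)// ler_pdivrMr// mul1r lerDl.
Qed.

(** Translation invariance of the semigroup turns a difference quotient of the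
    average into the average of a difference quotient, which converges uniformly. *)
Lemma is_derive_average g g1 v x : buc g -> buc g1 ->
  (forall y, is_derive y v g (g1 y)) -> is_derive x v (Q g) (Q g1 x).
Proof.
move=> bg bg1 gv; have [C C0 QC] := average_bound; have [_ g1u] := bg1.
apply: is_derive_dist => e e0; have C1 : 0 < C + 1 by rewrite ltr_wpDl.
have [delta d0 H] := g1u (e / (C + 1)) (divr_gt0 e0 C1).
have v1 : 0 < `|v| + 1 by rewrite ltr_wpDl.
exists (delta / (`|v| + 1)) => [|k]; first by rewrite divr_gt0.
rewrite ltr_pdivlMr// => kd.
have bt := buc_translate (k *: v) bg.
have bb : buc (fun y => (-1) * g y + g (y + k *: v)) by exact: buc_lin.
have -> : Q g (x + k *: v) - Q g x - k * Q g1 x =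
    Q (fun y => (- k) * g1 y + ((-1) * g y + g (y + k *: v))) x.
  by rewrite !average_lin// average_translate//; ring.
apply: (@le_trans _ _ (C * (e / (C + 1) * `|k|))).
  apply: QC => [|y]; first exact: buc_lin.
  have [s sk E] := mean_value_line y k gv.
  have -> : - k * g1 y + ((-1) * g y + g (y + k *: v)) = k * (g1 (y + s *: v) - g1 y).
    by rewrite mulrBr -E; ring.
  rewrite normrM mulrC ler_wpM2r//; apply: H.
  rewrite addrAC subrr add0r normrZ; apply: le_lt_trans kd.
  by rewrite ler_pM// lerDl.
rewrite mulrA ler_wpM2r// mulrCA ler_piMr ?(ltW e0)//.
by rewrite ler_pdivrMr// mul1r lerDl.
Qed.

Lemma smooth_average g : smooth g -> smooth (Q g).
Proof.
move=> sg; have [bg _ bg2] := sg.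
have [] := @smooth_intro _ _ (Q g) (fun i => Q (partial i g)) (fun i => Q (partial2 i i g)) => //.
- exact: buc_average.
- move=> i x; apply: is_derive_average => //; first exact: buc_partial.
  by move=> y; exact: smooth_derive1.
- move=> i x; apply: is_derive_average => //; first exact: buc_partial.
  by move=> y; exact: smooth_derive2.
- by move=> i; exact: buc_average.
Qed.

End brownian_average.

Section laplacian_equation.
Context {R : realType} {disp : measure_display} {T : measurableType disp}.
Variable P : probability T R.
Context {d : nat} {F : R -> set (set T)} {X : 'rV[R]_d -> R -> T -> 'rV[R]_d}
  {B : R -> T -> R}.
Hypotheses (hF : filtration F) (hX : continuous_markov_process P F X)
  (hW : forall x, brownian_motion_rV P F x (X x)) (hB : brownian_motion P F 0 B).
Local Notation V := 'rV[R]_d.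
Local Notation S := (semigroup P X).
Variables (f : V -> R) (eps : R) (Y : V -> R -> T -> V).
Hypotheses (sf : smooth f) (eps0 : 0 < eps) (fA : in_domain S f)
  (hY : (exists2 k : nat, (0 < k)%N & k_excursion_process P X B eps k Y) \/
          excursion_process P X B eps Y).
Local Notation u := (u_eps P B eps Y f).

Let bf : buc f. Proof. by case: sf. Qed.
Let cf : continuous f := buc_continuous bf.
Let fb : bounded_fun f := buc_bounded_fun bf.

(** On smooth functions the generator is half the Laplacian. This applies to [f]
    and to [u t], and then to [generator S (u t)], which is smooth because it is
    again a combination of [f] and of an average of the semigroup. *)
Theorem u_eps_solves_laplacian_pde : solves_laplacian_pde eps f u.
Proof.
have [+ init] := u_eps_solves_generator_pde hF hX hB cf fb eps0 fA hY.
move=> gpde; split=> // t x t0; have [_ du eq] := gpde t x t0.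
have b0 : 0 < (2 * t)^-1 by rewrite invr_gt0 mulr_gt0.
have su : smooth (u t).
  have -> : u t = @average R disp T P d X f eps (heat_weight eps^-1 t).
    by apply/funext => y; rewrite (u_epsE hF hX hB cf fb eps0 hY).
  by apply: (smooth_average hF hX hW) => //; exact: exp_bounded_gauss.
have sA : smooth (generator S (u t)).
  rewrite (u_eps_generator hF hX hB cf fb eps0 fA hY t0).
  apply: (smooth_lin _ sf _).1.
  apply: (smooth_scale _ _).1.
  by apply: (smooth_average hF hX hW) => //; exact: exp_bounded_gauss.
have Lu : laplacian (u t) = (fun y => 2 * generator S (u t) y).
  by apply/funext => y; rewrite (brownian_generator hF hX hW)//; field.
have [sL LL] := smooth_scale 2 sA.
split; [by case: su|by rewrite Lu; case: sL|exact: du|].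
rewrite eq (brownian_generator hF hX hW x sf) (brownian_generator hF hX hW x su).
rewrite /generator2 (brownian_generator hF hX hW x sA).
have -> : laplacian (laplacian (u t)) x = 2 * laplacian (generator S (u t)) x.
  by rewrite Lu LL.
have s0 : Num.sqrt (2 * pi * t) != 0 by rewrite gt_eqF// sqrtr_gt0 !mulr_gt0// pi_gt0.
move: (laplacian (generator S (u t)) x) (laplacian (u t) x) (laplacian f x) (u t x) (f x).
move: (Num.sqrt (2 * pi * t)) s0 => s s0 v4 v3 v2 v1 v0.
by field; rewrite s0 gt_eqF.
Qed.

End laplacian_equation.

Theorem theorem1p2 (R : realType) (d : nat) (hd : (0 < d)%N)
    (disp : measure_display) (T : measurableType disp) (P : probability T R)
    (F : R -> set (set T)) (hF : filtration F)
    (X : 'rV[R]_d -> R -> T -> 'rV[R]_d)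
    (hX : continuous_markov_process P F X)
    (B : R -> T -> R) (hB : brownian_motion P F 0 B)
    (hXB : forall x, mutually_independent P
       (fun b : bool => if b then sigma_process (X x) else sigma_process B))
    (f : 'rV[R]_d -> R) (fb : bounded_fun f) (fc : continuous f)
    (fA : in_domain (semigroup P X) f)
    (alpha : R) (halpha : 0 < alpha <= 1)
    (fD : forall i j, [/\ has_partial2 i j f, bounded_fun (partial2 i j f) &
                          hoelder_continuous alpha (partial2 i j f)])
    (eps : R) (heps : 0 < eps)
    (Y : 'rV[R]_d -> R -> T -> 'rV[R]_d)
    (hY : (exists2 k : nat, (0 < k)%N & k_excursion_process P X B eps k Y) \/
          excursion_process P X B eps Y) :
  (property_P (semigroup P X) ->
     solves_generator_pde (semigroup P X) eps f (u_eps P B eps Y f)) /\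
  ((forall x, brownian_motion_rV P F x (X x)) ->
     solves_laplacian_pde eps f (u_eps P B eps Y f)).
Proof.
split=> [_|hW]; first exact: (u_eps_solves_generator_pde hF hX hB fc fb heps fA hY).
have a0 : 0 < alpha by case/andP: halpha.
exact: (u_eps_solves_laplacian_pde hF hX hW hB (hoelder_smooth a0 fc fb fD) heps fA hY).
Qed.
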